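(* For any category of spaces $(\mathbf{Esp},\mathbb{A}^1)$ and any locally finite type fan $Y$, the presheaf $$\mathbb{A}(Y): X \mapsto \mathrm{Hom}_{\mathbf{LMS}}(|X|,Y)$$ on $\mathbf{Esp}$ is representable. If $\mathbb{A}(\mathrm{Spec}\, P)$ is representable for every monoid $P$, then $\mathbb{A}(Y)$ is representable for every fan $Y$. Write $\mathbb{A}(Y)$ also for a representing space, and $\tau_Y:|\mathbb{A}(Y)|\to Y$ for the $\mathbf{LMS}$-morphism corresponding to $\mathrm{Id}_{\mathbb{A}(Y)}$. The resulting functor $\mathbb{A}:\mathbf{Fans}\to\mathbf{Esp}$ (taking $\mathbf{Fans}$ to be the category of locally finite type fans in general, or all fans if $\mathbb{A}(\mathrm{Spec}\, P)$ is representable for every monoid $P$) (1) preserves coproducts, (2) preserves inverse limits, and (3) takes an open embedding of fans $U \to Y$ to an open embedding of spaces $\mathbb{A}(U) \to \mathbb{A}(Y)$ with image $\tau_Y^{-1}(U)$.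
   Context: Monoids are commutative with unit, written additively; $P^*$ denotes units. $h:P\to Q$ is local if $h(P\setminus P^* )\subseteq Q\setminus Q^*$. $\mathbf{LMS}$ is the category of locally monoidal spaces: topological spaces with a sheaf of monoids $\mathcal{M}_X$, with morphisms continuous maps $f$ together with a map $f^{-1}\mathcal{M}_Y\to\mathcal{M}_X$ of sheaves of monoids that is local on stalks. $\mathrm{Spec}\,P$ is the set of prime ideals of $P$ (subsets $\mathfrak{p}$ with $\mathfrak{p}+P\subseteq\mathfrak{p}$ and $P\setminus\mathfrak{p}$ a submonoid) with basic opens $U_p=\{\mathfrak p:p\notin\mathfrak p\}$ and structure sheaf $\mathcal{M}_P$ with $\mathcal{M}_P(U_p)=P_p$ (localization) and stalk at $\mathfrak{p}$ the localization of $P$ at $P\setminus\mathfrak{p}$. A fan is a locally monoidal space locally isomorphic to $\mathrm{Spec}\,P$ for varying monoids $P$; locally finite type if the $P$ can be taken finitely generated. Morphisms of fans are $\mathbf{LMS}$-morphisms. A category of spaces $(\mathbf{Esp},\mathbb{A}^1)$ is a category $\mathbf{Esp}$ with a functor $X\mapsto|X|$ to topological spaces and a monoid object $\mathbb{A}^1$ such that: (S1) $\mathbf{Esp}$ has finite inverse limits; (S2) it has small coproducts; (S3) coproducts commute with $|\cdot|$; (S4) for $X\in\mathbf{Esp}$ and open $|U|\subseteq|X|$ the presheaf $Y\mapsto\{f:Y\to X\mid |f|(|Y|)\subseteq|U|\}$ is represented by some $U\to X$ (such maps are called open embeddings) whose underlying map is (isomorphic to) the inclusion $|U|\subseteq|X|$,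 and $X$ is initial if $|X|=\emptyset$; (S5) Zariski covers ($f:X\to Y$ with $|f|$ surjective such that every point of $X$ lies in the image of an open embedding $U\to X$ whose composition with $f$ is an open embedding) are covers for a subcanonical topology; (S6) the maps $X_i\to\coprod_iX_i$ are open embeddings; (S7) the direct limit of any Zariski gluing datum (a pair of open embeddings $X_0\to X_1$, $X_0\to X_2$, or a functor from a well-ordered set with all transition maps open embeddings) exists, its structure maps are open embeddings, and it is preserved by $|\cdot|$; (S8) the presheaf $\mathbb{G}_m:X\mapsto\mathrm{Hom}(X,\mathbb{A}^1)^*$ is representable and $\mathbb{G}_m\to\mathbb{A}^1$ is an open embedding. For $X\in\mathbf{Esp}$ the structure sheaf is the sheaf of monoids $\mathcal{A}_X(U)=\mathrm{Hom}_{\mathbf{Esp}}(U,\mathbb{A}^1)$ on $|X|$ ($U\to X$ the open embedding corresponding to an open subset of $|X|$). This makes $|X|=(|X|,\mathcal{A}_X)$ a locally monoidal space, functorially in $X$; $|X|$ in the claim denotes this locally monoidal space.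
   Formalization: (2) is stated for inverse limits in Fans that are finite or are also limits in LMS; for other infinite limits it fails: with Esp = Top, A¹ = [0,∞), the limit of Spec Z under multiplication by 2, 3, … among locally finite type fans is Spec 0, but the limit of G_m is (0,∞). *)

(* Defs.v *)
From HB Require Import structures.
From mathcomp Require Import all_boot all_order ssralg generic_quotient.
From mathcomp Require Import boolp classical_sets functions wochoice.
From mathcomp Require Import topology_structure initial_topology bool_topology.
From mathcomp Require Import subtype_topology.

Set Implicit Arguments.
Unset Strict Implicit.
Unset Printing Implicit Defensive.

Import GRing.Theory.
Local Open Scope classical_set_scope.
Local Open Scope quotient_scope.
Local Open Scope ring_scope.

Lemma sig_ext (T : Type) (P : T -> Prop) (u v : {x | P x}) :
  sval u = sval v -> u = v.
Proof. by case: u v => [x Px] [y Py] /= xy; apply: eq_exist. Qed.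

(* The universe of the index sets of coproducts and of coverings. *)
Definition small := Type.

Record category := Category {
  ob :> Type;
  hom : ob -> ob -> Type;
  idm : forall X, hom X X;
  hcomp : forall X Y Z, hom Y Z -> hom X Y -> hom X Z;
  compA : forall X Y Z W (h : hom Z W) (g : hom Y Z) (f : hom X Y),
    hcomp h (hcomp g f) = hcomp (hcomp h g) f;
  comp1m : forall X Y (f : hom X Y), hcomp (idm Y) f = f;
  compm1 : forall X Y (f : hom X Y), hcomp f (idm X) = f
}.

Arguments hom {c} X Y.
Arguments idm {c} X.
Arguments hcomp {c X Y Z} g f.

Notation "g \oc f" := (hcomp g f) (at level 50, left associativity).

Record functor (C D : category) := Functor {
  fob :> C -> D;
  fmor : forall X Y, hom X Y -> hom (fob X) (fob Y);
  fmor1 : forall X, fmor (idm X) = idm (fob X);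
  fmorM : forall X Y Z (g : hom Y Z) (f : hom X Y),
    fmor (g \oc f) = fmor g \oc fmor f
}.

Arguments fmor {C D} f {X Y} u : rename.

Section CompFunctor.
Variables (C D E : category) (G : functor D E) (F : functor C D).

Lemma comp_functor1 X : fmor G (fmor F (idm X)) = idm (G (F X)).
Proof. by rewrite !fmor1. Qed.

Lemma comp_functorM X Y Z (g : hom Y Z) (f : hom X Y) :
  fmor G (fmor F (g \oc f)) = fmor G (fmor F g) \oc fmor G (fmor F f).
Proof. by rewrite !fmorM. Qed.

Definition comp_functor : functor C E :=
  Functor comp_functor1 comp_functorM.
End CompFunctor.

Definition full_sub (C : category) (K : C -> Prop) : category :=
  @Category {X : C | K X} (fun X Y => hom (sval X) (sval Y))
    (fun X => idm (sval X)) (fun _ _ _ g f => g \oc f)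
    (fun _ _ _ _ h g f => compA h g f)
    (fun _ _ f => comp1m f) (fun _ _ f => compm1 f).

Definition full_incl (C : category) (K : C -> Prop) : functor (full_sub K) C :=
  @Functor (full_sub K) C sval (fun _ _ f => f)
    (fun _ => erefl) (fun _ _ _ _ _ => erefl).

Section PosetCategory.
Variables (d : Order.disp_t) (W : porderType d).
Local Open Scope order_scope.

Definition poset_category : category :=
  @Category W (fun x y => x <= y) (fun x => Order.POrderTheory.lexx x)
    (fun x y z (yz : y <= z) (xy : x <= y) =>
       Order.POrderTheory.le_trans xy yz)
    (fun _ _ _ _ _ _ _ => bool_irrelevance _ _)
    (fun _ _ _ => bool_irrelevance _ _) (fun _ _ _ => bool_irrelevance _ _).
End PosetCategory.

Definition finite_type (T : Type) : Prop :=
  exists n (e : 'I_n -> T), forall x, exists k, e k = x.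

Definition finite_category (J : category) : Prop :=
  finite_type J /\ forall i j : J, finite_type (hom i j).

Definition is_iso (C : category) (X Y : C) (f : hom X Y) : Prop :=
  exists g : hom Y X, g \oc f = idm X /\ f \oc g = idm Y.

Section Limits.
Variables (J C : category) (D : functor J C).

Definition is_cone (L : C) (p : forall j, hom L (D j)) : Prop :=
  forall i j (a : hom i j), fmor D a \oc p i = p j.

Definition is_limit (L : C) (p : forall j, hom L (D j)) : Prop :=
  is_cone p /\ forall (L' : C) (p' : forall j, hom L' (D j)), is_cone p' ->
    exists! u : hom L' L, forall j, p j \oc u = p' j.

Definition is_cocone (Q : C) (q : forall j, hom (D j) Q) : Prop :=
  forall i j (a : hom i j), q j \oc fmor D a = q i.

Definition is_colimit (Q : C) (q : forall j, hom (D j) Q) : Prop :=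
  is_cocone q /\ forall (Q' : C) (q' : forall j, hom (D j) Q'), is_cocone q' ->
    exists! u : hom Q Q', forall j, u \oc q j = q' j.
End Limits.

Definition is_initial (C : category) (X : C) : Prop :=
  forall Y : C, exists! f : hom X Y, True.

Definition is_coproduct (C : category) (I : Type) (F : I -> C) (Q : C)
    (q : forall i, hom (F i) Q) : Prop :=
  forall (Q' : C) (q' : forall i, hom (F i) Q'),
    exists! u : hom Q Q', forall i, u \oc q i = q' i.

Definition is_pushout (C : category) (X0 X1 X2 Q : C)
    (f1 : hom X0 X1) (f2 : hom X0 X2) (q1 : hom X1 Q) (q2 : hom X2 Q) : Prop :=
  q1 \oc f1 = q2 \oc f2 /\
  forall (Q' : C) (q1' : hom X1 Q') (q2' : hom X2 Q'),
    q1' \oc f1 = q2' \oc f2 ->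
    exists! u : hom Q Q', u \oc q1 = q1' /\ u \oc q2 = q2'.

Record presheaf (C : category) := Presheaf {
  psh :> C -> Type;
  pull : forall X Y : C, hom X Y -> psh Y -> psh X;
  pull1 : forall (X : C) (s : psh X), pull (idm X) s = s;
  pullM : forall (X Y Z : C) (g : hom Y Z) (f : hom X Y) (s : psh Z),
    pull (g \oc f) s = pull f (pull g s)
}.

Arguments pull {C} p {X Y} f s.

(* By Yoneda, an element [u] of [F X] is the same as a map of presheaves
   [Hom(-, X) -> F]; it is universal when this map is an isomorphism. *)
Definition universal_element (C : category) (F : presheaf C) (X : C) (u : F X) :=
  forall (Y : C) (s : F Y), exists! f : hom Y X, pull F f u = s.

Record representation (C : category) (F : presheaf C) := Representation {
  rep_ob : C;
  rep_elt : F rep_ob;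
  rep_univ : universal_element rep_elt
}.

Definition representable (C : category) (F : presheaf C) : Prop :=
  exists (X : C) (u : F X), universal_element u.

Record sieve (C : category) (X : C) := Sieve {
  in_sieve :> forall Y, hom Y X -> Prop;
  sieve_comp : forall Y Z (f : hom Y X) (g : hom Z Y),
    in_sieve f -> in_sieve (f \oc g)
}.

Definition sieve_max (C : category) (X : C) : sieve X :=
  @Sieve C X (fun _ _ => True) (fun _ _ _ _ _ => I).

Section SieveConstructions.
Variables (C : category) (X Y : C) (f : hom Y X).

Lemma sieve_pull_comp (S : sieve X) Z W (g : hom Z Y) (h : hom W Z) :
  S _ (f \oc g) -> S _ (f \oc (g \oc h)).
Proof. by move=> Sg; rewrite compA; apply: sieve_comp. Qed.

Definition sieve_pull (S : sieve X) : sieve Y :=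
  @Sieve C Y (fun Z g => S Z (f \oc g)) (sieve_pull_comp (S := S)).

Lemma sieve_gen_comp Z W (g : hom Z X) (h : hom W Z) :
  (exists k, g = f \oc k) -> exists k, g \oc h = f \oc k.
Proof. by move=> [k ->]; exists (k \oc h); rewrite compA. Qed.

Definition sieve_gen : sieve X :=
  @Sieve C X (fun Z g => exists k : hom Z Y, g = f \oc k) sieve_gen_comp.
End SieveConstructions.

Record grothendieck_topology (C : category) := GrothendieckTopology {
  covering : forall X : C, sieve X -> Prop;
  covering_max : forall X : C, covering (sieve_max X);
  covering_pull : forall (X Y : C) (f : hom Y X) (S : sieve X),
    covering S -> covering (sieve_pull f S);
  covering_trans : forall (X : C) (S R : sieve X), covering S ->
    (forall Y (f : hom Y X), S Y f -> covering (sieve_pull f R)) -> covering R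
}.

Definition is_cover (C : category) (T : grothendieck_topology C) (X Y : C)
  (f : hom X Y) : Prop := covering T (sieve_gen f).

Definition subcanonical (C : category) (T : grothendieck_topology C) : Prop :=
  forall (X : C) (S : sieve X), covering T S ->
  forall (Z : C) (s : forall Y (f : hom Y X), S Y f -> hom Y Z),
    (forall Y Y' (f : hom Y X) (g : hom Y' Y) (Sf : S Y f) (Sfg : S Y' (f \oc g)),
       s Y' (f \oc g) Sfg = s Y f Sf \oc g) ->
    exists! t : hom X Z, forall Y (f : hom Y X) (Sf : S Y f), t \oc f = s Y f Sf.

Definition munit (P : nmodType) (p : P) : Prop := exists q, p + q = 0.

Definition local_hom (P Q : nmodType) (h : P -> Q) : Prop :=
  forall p, ~ munit p -> ~ munit (h p).

Definition fin_gen (P : nmodType) : Prop :=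
  exists s : seq P, forall p, exists n : nat -> nat,
    p = \sum_(i < size s) s`_i *+ n i.

(* A commutative monoid object through its functor of points: a structure of
   commutative monoid on [Hom(X, mo_ob)], natural in [X]. *)
Record monoid_object (C : category) := MonoidObject {
  mo_ob :> C;
  mo_zero : forall X, hom X mo_ob;
  mo_add : forall X, hom X mo_ob -> hom X mo_ob -> hom X mo_ob;
  mo_addA : forall X, associative (@mo_add X);
  mo_addC : forall X, commutative (@mo_add X);
  mo_add0 : forall X, left_id (mo_zero X) (@mo_add X);
  mo_zero_comp : forall X Y (f : hom X Y), mo_zero Y \oc f = mo_zero X;
  mo_add_comp : forall X Y (a b : hom Y mo_ob) (f : hom X Y),
    mo_add a b \oc f = mo_add (a \oc f) (b \oc f)
}.

Definition mhom (C : category) (A : monoid_object C) (X : C) : Type := hom X A.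

HB.instance Definition _ C A X := gen_eqMixin (@mhom C A X).
HB.instance Definition _ C A X := gen_choiceMixin (@mhom C A X).
HB.instance Definition _ C A X :=
  GRing.isNmodule.Build (@mhom C A X)
    (@mo_addA C A X) (@mo_addC C A X) (@mo_add0 C A X).

Section UnitsPresheaf.
Variables (C : category) (A : monoid_object C).

Lemma munit_comp (X Y : C) (f : hom X Y) (u : mhom A Y) :
  munit u -> munit (u \oc f : mhom A X).
Proof.
move=> [v uv]; exists (v \oc f : mhom A X).
rewrite /GRing.add /= -mo_add_comp; move: uv; rewrite /GRing.add /= => ->.
exact: mo_zero_comp.
Qed.

Definition units_psh (X : C) : Type := {u : mhom A X | munit u}.

Definition units_pull (X Y : C) (f : hom X Y) (u : units_psh Y) : units_psh X :=
  exist _ (sval u \oc f : mhom A X) (munit_comp f (svalP u)).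

Lemma units_pull1 (X : C) (u : units_psh X) : units_pull (idm X) u = u.
Proof. by apply: sig_ext; rewrite /= compm1. Qed.

Lemma units_pullM (X Y Z : C) (g : hom Y Z) (f : hom X Y) (u : units_psh Z) :
  units_pull (g \oc f) u = units_pull f (units_pull g u).
Proof. by apply: sig_ext; rewrite /= compA. Qed.

Definition Gm_presheaf : presheaf C := Presheaf units_pull1 units_pullM.
End UnitsPresheaf.

Record monoid_presentation := MonoidPresentation {
  mp_car :> Type;
  mp_eq : mp_car -> mp_car -> Prop;
  mp_zero : mp_car;
  mp_add : mp_car -> mp_car -> mp_car;
  mp_refl : forall a, mp_eq a a;
  mp_sym : forall a b, mp_eq a b -> mp_eq b a;
  mp_trans : forall a b c, mp_eq a b -> mp_eq b c -> mp_eq a c;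
  mp_congr : forall a a' b, mp_eq a a' -> mp_eq (mp_add a b) (mp_add a' b);
  mp_addA : forall a b c,
    mp_eq (mp_add a (mp_add b c)) (mp_add (mp_add a b) c);
  mp_addC : forall a b, mp_eq (mp_add a b) (mp_add b a);
  mp_add0 : forall a, mp_eq (mp_add mp_zero a) a
}.

Section MonoidQuotient.
Variable M : monoid_presentation.

Definition mp_eqb (a b : {classic M}) : bool := `[< mp_eq (a : M) b >].

Lemma mp_eqb_refl : reflexive mp_eqb.
Proof. by move=> a; apply/asboolP; apply: mp_refl. Qed.

Lemma mp_eqb_sym : symmetric mp_eqb.
Proof. by move=> a b; apply/asboolP/asboolP; apply: mp_sym. Qed.

Lemma mp_eqb_trans : transitive mp_eqb.
Proof.
by move=> b a c /asboolP ab /asboolP bc; apply/asboolP; apply: mp_trans ab bc.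
Qed.

Definition mp_equiv := EquivRel mp_eqb mp_eqb_refl mp_eqb_sym mp_eqb_trans.

Definition mquot : Type := {eq_quot mp_equiv}.
HB.instance Definition _ := Choice.copy mquot {eq_quot mp_equiv}.

Definition mclass (a : M) : mquot := \pi_{eq_quot mp_equiv} (a : {classic M}).
Definition mrepr (c : mquot) : M := repr (c : {eq_quot mp_equiv}).

Lemma mreprK c : mclass (mrepr c) = c.
Proof. exact: reprK. Qed.

Lemma mclassP a b : mclass a = mclass b <-> mp_eq a b.
Proof.
split=> [ab|ab]; last by apply/eqmodP/asboolP.
by apply/asboolP; move/eqmodP: ab.
Qed.

Lemma mrepr_eq a : mp_eq (mrepr (mclass a)) a.
Proof. by apply/mclassP; rewrite mreprK. Qed.

Definition mquot_add (c d : mquot) : mquot := mclass (mp_add (mrepr c) (mrepr d)).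

Lemma mclassD a b : mquot_add (mclass a) (mclass b) = mclass (mp_add a b).
Proof.
apply/mclassP; apply: (mp_trans (mp_congr _ (mrepr_eq a))).
apply: (mp_trans (mp_addC _ _)).
exact: (mp_trans (mp_congr _ (mrepr_eq b)) (mp_addC _ _)).
Qed.

Lemma mquot_addA : associative mquot_add.
Proof.
move=> a b c; rewrite -(mreprK a) -(mreprK b) -(mreprK c) !mclassD.
by apply/mclassP; apply: mp_addA.
Qed.

Lemma mquot_addC : commutative mquot_add.
Proof.
move=> a b; rewrite -(mreprK a) -(mreprK b) !mclassD.
by apply/mclassP; apply: mp_addC.
Qed.

Lemma mquot_add0 : left_id (mclass (mp_zero M)) mquot_add.
Proof.
by move=> a; rewrite -(mreprK a) mclassD; apply/mclassP; apply: mp_add0.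
Qed.

HB.instance Definition _ :=
  GRing.isNmodule.Build mquot mquot_addA mquot_addC mquot_add0.
End MonoidQuotient.

Record submonoid (P : nmodType) := Submonoid {
  sm_set : set P;
  sm_0 : sm_set 0;
  sm_D : forall a b, sm_set a -> sm_set b -> sm_set (a + b)
}.

Section Localization.
Variables (P : nmodType) (S : submonoid P).

Definition pre_frac : Type := (P * {b : P | sm_set S b})%type.

Definition frac_eq (x y : pre_frac) : Prop :=
  exists2 t, sm_set S t & t + (x.1 + sval y.2) = t + (y.1 + sval x.2).

Definition frac_zero : pre_frac := (0, exist _ 0 (sm_0 S)).

Definition frac_add (x y : pre_frac) : pre_frac :=
  (x.1 + y.1, exist _ (sval x.2 + sval y.2) (sm_D (svalP x.2) (svalP y.2))).

Lemma frac_refl x : frac_eq x x.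
Proof. by exists 0 => //; apply: sm_0. Qed.

Lemma frac_sym x y : frac_eq x y -> frac_eq y x.
Proof. by move=> [t St e]; exists t. Qed.

Lemma frac_trans x y z : frac_eq x y -> frac_eq y z -> frac_eq x z.
Proof.
move: x y z => [a [b Sb]] [c [d Sd]] [e [f Sf]] [t St /= E1] [s Ss /= E2].
exists (t + s + d) => /=; first by apply: sm_D => //; apply: sm_D.
have -> : t + s + d + (a + f) = t + (a + d) + (s + f).
  by rewrite !addrA (AC 5 ((1*4)*3*2*5))%AC.
rewrite E1 (_ : t + (c + b) + (s + f) = t + b + (s + (c + f))).
  rewrite E2; by rewrite !addrA (AC 5 ((1*3)*5*4*2))%AC.
by rewrite !addrA (AC 5 ((1*3)*4*2*5))%AC.
Qed.

Lemma frac_congr x x' y : frac_eq x x' -> frac_eq (frac_add x y) (frac_add x' y).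
Proof.
move: x x' y => [a [b Sb]] [c [d Sd]] [e [f Sf]] [t St /= E].
exists t => //=.
rewrite (addrACA a e d f) (addrACA c e b f) !addrA -(addrA t) E.
by rewrite !addrA.
Qed.

Lemma frac_addA x y z :
  frac_eq (frac_add x (frac_add y z)) (frac_add (frac_add x y) z).
Proof. by exists 0; [apply: sm_0 | rewrite /= !addrA]. Qed.

Lemma frac_addC x y : frac_eq (frac_add x y) (frac_add y x).
Proof.
by exists 0; [apply: sm_0 | rewrite /= (addrC x.1) (addrC (sval y.2))].
Qed.

Lemma frac_add0 x : frac_eq (frac_add frac_zero x) x.
Proof. by exists 0; [apply: sm_0 | rewrite /= !add0r]. Qed.

Definition frac_presentation : monoid_presentation :=
  MonoidPresentation frac_refl frac_sym frac_trans frac_congr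
    frac_addA frac_addC frac_add0.

Definition localization : nmodType := mquot frac_presentation.

Definition lfrac (a b : P) (Sb : sm_set S b) : localization :=
  mclass ((a, exist _ b Sb) : frac_presentation).

Lemma lfracD (a b a' b' : P) (Sb : sm_set S b) (Sb' : sm_set S b')
    (Sbb' : sm_set S (b + b')) :
  lfrac a Sb + lfrac a' Sb' = lfrac (a + a') Sbb'.
Proof.
rewrite [LHS]mclassD; congr mclass; rewrite /= /frac_add /=; congr pair.
exact: sig_ext.
Qed.
End Localization.

Section TopCategory.
Variables X Y Z : topologicalType.

Definition cts_id_map : continuousType X X := @idfun X.

Definition cts_comp_map (g : continuousType Y Z) (f : continuousType X Y) :
  continuousType X Z := g \o f.
End TopCategory.

Lemma cts_compA (X Y Z W : topologicalType) (h : continuousType Z W) (g : continuousType Y Z)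
  (f : continuousType X Y) :
  cts_comp_map h (cts_comp_map g f) = cts_comp_map (cts_comp_map h g) f.
Proof. exact/continuousEP. Qed.

Lemma cts_comp1m (X Y : topologicalType) (f : continuousType X Y) :
  cts_comp_map (cts_id_map Y) f = f.
Proof. exact/continuousEP. Qed.

Lemma cts_compm1 (X Y : topologicalType) (f : continuousType X Y) :
  cts_comp_map f (cts_id_map X) = f.
Proof. exact/continuousEP. Qed.

Definition Top : category := Category cts_compA cts_comp1m cts_compm1.

Record opens (X : topologicalType) := Opens {
  oset :> set X;
  openP : open oset
}.

Lemma opens_ext (X : topologicalType) (U V : opens X) :
  oset U = oset V -> U = V.
Proof.
case: U V => [U oU] [V oV] /= UV; case: V / UV oV => oV.
by rewrite (Prop_irrelevance oU oV).
Qed.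

Definition opensT (X : topologicalType) : opens X := Opens (@openT X).

Definition opensI (X : topologicalType) (U V : opens X) : opens X :=
  Opens (openI (openP U) (openP V)).

Lemma opensIl (X : topologicalType) (U V : opens X) : opensI U V `<=` U.
Proof. exact: subIsetl. Qed.

Lemma opensIr (X : topologicalType) (U V : opens X) : opensI U V `<=` V.
Proof. exact: subIsetr. Qed.

Definition preopen (X Y : topologicalType) (f : continuousType X Y)
  (V : opens Y) : opens X :=
  Opens ((continuousP f).1 (@cts_fun _ _ f) _ (openP V)).

Lemma preopen_sub (X Y : topologicalType) (f : continuousType X Y)
  (V : opens Y) : preopen f V `<=` f @^-1` V.
Proof. by []. Qed.

(* [f] is, up to a homeomorphism of its source, the inclusion of the open
   subspace [U]; as [U] is open, a homeomorphism onto [U] is the same as an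
   injective continuous open map with image [U]. *)
Definition is_open_inclusion (X Y : topologicalType) (f : continuousType X Y)
    (U : set Y) : Prop :=
  [/\ injective f, range f = U & forall W : set X, open W -> open (f @` W)].

Record sheaf (X : topologicalType) := Sheaf {
  sect :> opens X -> nmodType;
  res : forall U V : opens X, V `<=` U -> {additive sect U -> sect V};
  res_id : forall (U : opens X) (UU : U `<=` U) (s : sect U), res UU s = s;
  res_res : forall (U V W : opens X) (VU : V `<=` U) (WV : W `<=` V)
    (WU : W `<=` U) (s : sect U), res WV (res VU s) = res WU s;
  sheaf_glue : forall (I : small) (U : opens X) (V : I -> opens X)
    (VU : forall i, V i `<=` U), U `<=` \bigcup_i V i ->
    forall s : (forall i, sect (V i)),
    (forall i j (W : opens X) (Wi : W `<=` V i) (Wj : W `<=` V j),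
       res Wi (s i) = res Wj (s j)) ->
    exists! t : sect U, forall i, res (VU i) t = s i
}.

Arguments res {X} s {U V} VU : rename.

Section ResTheory.
Variables (X : topologicalType) (M : sheaf X).

Lemma res_irr (U V : opens X) (h h' : V `<=` U) (s : M U) :
  res M h s = res M h' s.
Proof. by rewrite (Prop_irrelevance h h'). Qed.

Lemma res_trans (U V W : opens X) (VU : V `<=` U) (WV : W `<=` V) (s : M U) :
  res M WV (res M VU s) = res M (subset_trans WV VU) s.
Proof. exact: res_res. Qed.
End ResTheory.

Section Stalks.
Variables (X : topologicalType) (M : sheaf X) (x : X).

Record pregerm := Pregerm {
  pg_open : opens X;
  pg_in : oset pg_open x;
  pg_sect : M pg_open
}.

Definition pregerm_eq (a b : pregerm) : Prop :=
  exists W : opens X, oset W x /\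
  exists (Wa : W `<=` pg_open a) (Wb : W `<=` pg_open b),
    res M Wa (pg_sect a) = res M Wb (pg_sect b).

Definition pregerm_zero : pregerm := @Pregerm (opensT X) I 0.

Definition pregerm_add (a b : pregerm) : pregerm :=
  @Pregerm (opensI (pg_open a) (pg_open b)) (conj (pg_in a) (pg_in b))
    (res M (@opensIl _ _ _) (pg_sect a) + res M (@opensIr _ _ _) (pg_sect b)).

Lemma pregerm_refl a : pregerm_eq a a.
Proof.
by exists (pg_open a); split; [exact: pg_in | exists (fun _ h => h), (fun _ h => h)].
Qed.

Lemma pregerm_sym a b : pregerm_eq a b -> pregerm_eq b a.
Proof. by move=> [W [Wx [Wa [Wb e]]]]; exists W; split=> //; exists Wb, Wa. Qed.

Lemma pregerm_trans a b c : pregerm_eq a b -> pregerm_eq b c -> pregerm_eq a c.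
Proof.
move=> [W [Wx [Wa [Wb e]]]] [W' [W'x [W'b [W'c e']]]].
have WW : opensI W W' `<=` W by move=> y [].
have WW' : opensI W W' `<=` W' by move=> y [].
exists (opensI W W'); split=> //.
exists (subset_trans WW Wa), (subset_trans WW' W'c).
rewrite -!res_trans e -e' !res_trans; exact: res_irr.
Qed.

Lemma pregerm_congr a a' b :
  pregerm_eq a a' -> pregerm_eq (pregerm_add a b) (pregerm_add a' b).
Proof.
move=> [W [Wx [Wa [Wa' e]]]].
have WW : opensI W (pg_open b) `<=` W by move=> y [].
have h : opensI W (pg_open b) `<=` pg_open (pregerm_add a b).
  by move=> y [/Wa ? ?]; split.
have h' : opensI W (pg_open b) `<=` pg_open (pregerm_add a' b).
  by move=> y [/Wa' ? ?]; split.
exists (opensI W (pg_open b)); split; first by split=> //; exact: pg_in.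
exists h, h'; rewrite /= !raddfD /= !res_trans; congr (_ + _).
  have := congr1 (res M WW) e; rewrite !res_trans.
  by move=> {}e; rewrite (res_irr _ (subset_trans WW Wa)) e; apply: res_irr.
exact: res_irr.
Qed.

Lemma pregerm_addA a b c :
  pregerm_eq (pregerm_add a (pregerm_add b c)) (pregerm_add (pregerm_add a b) c).
Proof.
pose W := pg_open (pregerm_add (pregerm_add a b) c).
have h : W `<=` pg_open (pregerm_add a (pregerm_add b c)).
  by move=> y [[? ?] ?]; split=> //; split.
exists W; split; first by do 2?split; exact: pg_in.
exists h, (fun _ k => k).
rewrite /= !raddfD /= !res_trans addrA.
by congr (_ + _ + _); apply: res_irr.
Qed.

Lemma pregerm_addC a b : pregerm_eq (pregerm_add a b) (pregerm_add b a).
Proof.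
have h : pg_open (pregerm_add a b) `<=` pg_open (pregerm_add b a).
  by move=> y [? ?]; split.
exists (pg_open (pregerm_add a b)); split; first by split; exact: pg_in.
exists (fun _ k => k), h; rewrite /= !raddfD /= !res_trans addrC.
by congr (_ + _); apply: res_irr.
Qed.

Lemma pregerm_add0 a : pregerm_eq (pregerm_add pregerm_zero a) a.
Proof.
have h : pg_open a `<=` pg_open (pregerm_add pregerm_zero a).
  by move=> y ay; split.
exists (pg_open a); split; first exact: pg_in.
exists h, (fun _ k => k); rewrite /= !raddfD /= !raddf0 add0r res_trans.
exact: res_irr.
Qed.

Definition stalk_presentation : monoid_presentation :=
  MonoidPresentation pregerm_refl pregerm_sym pregerm_trans pregerm_congr
    pregerm_addA pregerm_addC pregerm_add0.

Definition stalk : nmodType := mquot stalk_presentation.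

Definition germ (U : opens X) (Ux : oset U x) (s : M U) : stalk :=
  mclass (Pregerm Ux s : stalk_presentation).

Lemma germP (U V : opens X) (Ux : oset U x) (Vx : oset V x) (s : M U) (t : M V) :
  germ Ux s = germ Vx t <-> exists W : opens X, oset W x /\ exists (WU : W `<=` U) (WV : W `<=` V), res M WU s = res M WV t.
Proof. exact: mclassP. Qed.

Lemma germ_surj (c : stalk) : exists (U : opens X) (Ux : oset U x) (s : M U),
  c = germ Ux s.
Proof.
rewrite -(mreprK c); case: (mrepr c) => U Ux s.
by exists U, Ux, s.
Qed.

Lemma germ_res (U V : opens X) (VU : V `<=` U) (Vx : oset V x) (s : M U) :
  germ Vx (res M VU s) = germ (VU x Vx) s.
Proof.
apply/germP; exists V; split=> //; exists (fun _ k => k), VU; exact: res_id.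
Qed.

Lemma germ_unitP (U : opens X) (Ux : oset U x) (s : M U) :
  munit (germ Ux s) <->
  exists V : opens X, oset V x /\ exists VU : V `<=` U, munit (res M VU s).
Proof.
split.
  move=> [c]; have [V [Vx [t ->]]] := germ_surj c.
  rewrite [_ + _]mclassD => /germP [W [Wx [WI [WT e]]]].
  have WU : W `<=` U by move=> y /WI [].
  have WV : W `<=` V by move=> y /WI [].
  exists W; split=> //; exists WU, (res M WV t).
  move: e; rewrite /= raddfD raddf0 /= !res_trans => <-.
  by congr (_ + _); apply: res_irr.
move=> [V [Vx [VU [t e]]]]; exists (germ Vx t).
have -> : germ Ux s = germ Vx (res M VU s).
  by rewrite germ_res (Prop_irrelevance (VU x Vx) Ux).
rewrite [_ + _]mclassD.
apply/germP; exists V; split=> //=.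
exists (fun _ h => conj h h), (fun _ _ => I).
rewrite raddfD raddf0 /= !res_trans -[RHS]e.
by congr (_ + _); [apply: res_irr | apply: res_id].
Qed.
End Stalks.


Record lms := Lms {
  lms_space :> topologicalType;
  lms_sheaf : sheaf lms_space
}.

Notation "\M_ X" := (lms_sheaf X) (at level 8, X at level 2).

(* A map of sheaves of monoids [f^-1 M_Y -> M_X].  The presheaf whose
   sheafification is [f^-1 M_Y] sends [U] to the colimit of the [M_Y V] over the
   open sets [V] containing [f U]; so such a map is a family of monoid maps
   [M_Y V -> M_X U], for [U] contained in [f^-1 V], compatible with
   restrictions. *)
Record comorphism (X Y : lms) (f : continuousType X Y) := Comorphism {
  comap :> forall (U : opens X) (V : opens Y), U `<=` f @^-1` V ->
    \M_Y V -> \M_X U;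
  comap_additive : forall (U : opens X) (V : opens Y) (UV : U `<=` f @^-1` V),
    nmod_morphism (comap UV);
  comap_res : forall (U U' : opens X) (V V' : opens Y) (UV : U `<=` f @^-1` V)
    (U'V' : U' `<=` f @^-1` V') (U'U : U' `<=` U) (VV' : V `<=` V') (s : \M_Y V'),
    comap U'V' s = res \M_X U'U (comap UV (res \M_Y VV' s))
}.

Arguments comap {X Y f} c {U V} UV s : rename.

HB.instance Definition _ (X Y : lms) (f : continuousType X Y)
    (phi : comorphism f) (U : opens X) (V : opens Y) (UV : U `<=` f @^-1` V) :=
  GRing.isNmodMorphism.Build (\M_Y V) (\M_X U) (comap phi UV)
    (comap_additive phi UV).

Section StalkMap.
Variables (X Y : lms) (f : continuousType X Y) (phi : comorphism f) (x : X).

Lemma comap_irr (U : opens X) (V : opens Y) (h h' : U `<=` f @^-1` V) s :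
  comap phi h s = comap phi h' s.
Proof. by rewrite (Prop_irrelevance h h'). Qed.

Lemma comap_resr (U : opens X) (V V' : opens Y) (UV : U `<=` f @^-1` V)
    (UV' : U `<=` f @^-1` V') (VV' : V `<=` V') s :
  comap phi UV (res \M_Y VV' s) = comap phi UV' s.
Proof. by rewrite (comap_res _ UV UV' (fun _ k => k) VV') res_id. Qed.

Lemma comap_resl (U U' : opens X) (V : opens Y) (UV : U `<=` f @^-1` V)
    (U'V : U' `<=` f @^-1` V) (U'U : U' `<=` U) s :
  res \M_X U'U (comap phi UV s) = comap phi U'V s.
Proof. by rewrite (comap_res _ UV U'V U'U (fun _ k => k)) res_id. Qed.

Definition stalk_map (c : stalk \M_Y (f x)) : stalk \M_X x :=
  let g := mrepr c in
  @germ _ _ x (preopen f (pg_open g)) (pg_in g)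
    (comap phi (@preopen_sub _ _ f (pg_open g)) (pg_sect g)).

Lemma stalk_map_germ (U : opens X) (V : opens Y) (UV : U `<=` f @^-1` V)
    (Ux : oset U x) (Vfx : oset V (f x)) (s : \M_Y V) :
  stalk_map (germ Vfx s) = germ Ux (comap phi UV s).
Proof.
rewrite /stalk_map; have := mrepr_eq (Pregerm Vfx s : stalk_presentation _ _).
rewrite -/(germ Vfx s); case: (mrepr _) => V' V'fx s' /= [W [Wfx [WV' [WV e]]]].
apply/germP; exists (opensI U (preopen f W)); split; first by split.
have h : opensI U (preopen f W) `<=` preopen f V' by move=> y [_ /WV'].
exists h, (@opensIl _ _ _).
have hW : opensI U (preopen f W) `<=` f @^-1` W by move=> y [].
have hV' : opensI U (preopen f W) `<=` f @^-1` V' by move=> y /h.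
have hV : opensI U (preopen f W) `<=` f @^-1` V by move=> y /hW /WV.
rewrite (comap_resl _ hV') (comap_resl _ hV).
by rewrite -(comap_resr hW hV' WV') e (comap_resr hW hV).
Qed.
End StalkMap.

Record lms_hom (X Y : lms) := LmsHom {
  lms_map : continuousType X Y;
  lms_comap : comorphism lms_map;
  lms_local : forall x, local_hom (stalk_map lms_comap (x := x))
}.

Arguments lms_local {X Y} f x : rename.

Lemma local_germP (X Y : lms) (f : continuousType X Y) (phi : comorphism f) x :
  local_hom (stalk_map phi (x := x)) <->
  forall (U : opens X) (V : opens Y) (UV : U `<=` f @^-1` V)
    (Ux : oset U x) (Vfx : oset V (f x)) (s : \M_Y V),
    munit (germ Ux (comap phi UV s)) -> munit (germ Vfx s).
Proof.
split=> [loc U V UV Ux Vfx s u|loc c nc].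
  by apply: contrapT => /loc; rewrite (stalk_map_germ phi UV Ux).
have [V [Vfx [s e]]] := germ_surj c; move: nc; rewrite {}e => nc.
by rewrite (@stalk_map_germ _ _ _ _ _ (preopen f V) _ (@preopen_sub _ _ f V)) => /loc.
Qed.

Lemma lms_hom_ext (X Y : lms) (f g : lms_hom X Y) :
  lms_map f =1 lms_map g ->
  (forall (U : opens X) (V : opens Y) (UV : U `<=` lms_map f @^-1` V)
     (UV' : U `<=` lms_map g @^-1` V) (s : \M_Y V),
     comap (lms_comap f) UV s = comap (lms_comap g) UV' s) ->
  f = g.
Proof.
case: f g => [f phi lf] [g psi lg] /= /continuousEP fg; case: g / fg psi lg => psi lg E.
suff e : phi = psi.
  by case: psi / e lg E => lg _; rewrite (Prop_irrelevance lf lg).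
case: phi psi E {lf lg} => [c ca cr] [c' ca' cr'] /= E.
have e : c = c'.
  by do 4![apply/functional_extensionality_dep => ?]; apply: E.
by case: c' / e ca' cr' E => ca' cr' _; congr Comorphism; apply: Prop_irrelevance.
Qed.

Section LmsCategory.

Section Identity.
Variable X : lms.

Definition lms_id_comap (U V : opens X) (UV : U `<=` cts_id_map X @^-1` V)
  (s : \M_X V) : \M_X U := res \M_X UV s.

Lemma lms_id_comap_additive (U V : opens X) (UV : U `<=` cts_id_map X @^-1` V) :
  nmod_morphism (lms_id_comap UV).
Proof. by split=> [|s t]; rewrite /lms_id_comap ?raddf0 ?raddfD. Qed.

Lemma lms_id_comap_res (U U' V V' : opens X) (UV : U `<=` cts_id_map X @^-1` V)
    (U'V' : U' `<=` cts_id_map X @^-1` V') (U'U : U' `<=` U) (VV' : V `<=` V') s :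
  lms_id_comap U'V' s = res \M_X U'U (lms_id_comap UV (res \M_X VV' s)).
Proof. by rewrite /lms_id_comap !res_trans; apply: res_irr. Qed.

Definition lms_id_comorphism : comorphism (cts_id_map X) :=
  @Comorphism X X (cts_id_map X) lms_id_comap lms_id_comap_additive lms_id_comap_res.

Lemma lms_id_local x : local_hom (stalk_map lms_id_comorphism (x := x)).
Proof.
apply/local_germP => U V UV Ux Vx s /germ_unitP [W [Wx [WU u]]].
apply/germ_unitP; exists W; split=> //; exists (subset_trans WU UV).
by move: u; rewrite /= /lms_id_comap res_trans.
Qed.

Definition lms_id : lms_hom X X := LmsHom lms_id_local.
End Identity.

Section Composition.
Variables (X Y Z : lms) (g : lms_hom Y Z) (f : lms_hom X Y).
Let gf := cts_comp_map (lms_map g) (lms_map f).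

Definition lms_comp_comap (U : opens X) (W : opens Z) (UW : U `<=` gf @^-1` W)
    (s : \M_Z W) : \M_X U :=
  @comap _ _ _ (lms_comap f) U (preopen (lms_map g) W) UW
    (comap (lms_comap g) (@preopen_sub _ _ (lms_map g) W) s).

Lemma lms_comp_comap_additive (U : opens X) (W : opens Z) (UW : U `<=` gf @^-1` W) :
  nmod_morphism (lms_comp_comap UW).
Proof. by split=> [|s t]; rewrite /lms_comp_comap ?raddf0 ?raddfD. Qed.

Lemma lms_comp_comapE (U : opens X) (V : opens Y) (W : opens Z)
    (UW : U `<=` gf @^-1` W) (UV : U `<=` lms_map f @^-1` V)
    (VW : V `<=` lms_map g @^-1` W) s :
  lms_comp_comap UW s = comap (lms_comap f) UV (comap (lms_comap g) VW s).
Proof.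
have VW' : V `<=` preopen (lms_map g) W by move=> y /VW.
rewrite /lms_comp_comap -(comap_resl _ (@preopen_sub _ _ _ W) VW VW').
by rewrite (comap_resr _ UV (UW : U `<=` lms_map f @^-1` preopen (lms_map g) W) VW').
Qed.

Lemma lms_comp_comap_res (U U' : opens X) (V V' : opens Z)
    (UV : U `<=` gf @^-1` V) (U'V' : U' `<=` gf @^-1` V')
    (U'U : U' `<=` U) (VV' : V `<=` V') s :
  lms_comp_comap U'V' s = res \M_X U'U (lms_comp_comap UV (res \M_Z VV' s)).
Proof.
have U'V : U' `<=` lms_map f @^-1` preopen (lms_map g) V by move=> x /U'U /UV.
have VV'g : preopen (lms_map g) V `<=` lms_map g @^-1` V' by move=> x /VV'.
rewrite (lms_comp_comapE U'V' U'V VV'g) /lms_comp_comap.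
by rewrite (comap_resr _ (@preopen_sub _ _ _ V) VV'g VV') (comap_resl _ _ U'V U'U).
Qed.

Definition lms_comp_comorphism : comorphism gf :=
  @Comorphism X Z gf lms_comp_comap lms_comp_comap_additive lms_comp_comap_res.

Lemma lms_comp_local x : local_hom (stalk_map lms_comp_comorphism (x := x)).
Proof.
apply/local_germP => U V UV Ux Vx s u.
have /local_germP lf := lms_local f x.
have /local_germP lg := lms_local g (lms_map f x).
have Vfx : oset (preopen (lms_map g) V) (lms_map f x) by [].
apply: (lg _ _ (@preopen_sub _ _ _ V) Vfx).
exact: (lf _ (preopen (lms_map g) V) UV Ux).
Qed.

Definition lms_comp : lms_hom X Z := LmsHom lms_comp_local.
End Composition.

Lemma lms_compA (X Y Z W : lms) (h : lms_hom Z W) (g : lms_hom Y Z)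
  (f : lms_hom X Y) : lms_comp h (lms_comp g f) = lms_comp (lms_comp h g) f.
Proof.
apply: lms_hom_ext => // U V UV UV' s.
pose V' := preopen (lms_map g) (preopen (lms_map h) V).
have UV'' : U `<=` lms_map f @^-1` V' by move=> x /UV.
have V'V : V' `<=` lms_map (lms_comp h g) @^-1` V by [].
rewrite [RHS](@lms_comp_comapE _ _ _ (lms_comp h g) f U V' V UV' UV'' V'V).
rewrite [RHS](_ : _ = comap (lms_comap f) UV'' (comap (lms_comap g)
  (@preopen_sub _ _ (lms_map g) _)
  (comap (lms_comap h) (@preopen_sub _ _ (lms_map h) V) s))); last first.
  congr comap; exact: lms_comp_comapE.
exact: (@lms_comp_comapE _ _ _ g f U V' (preopen (lms_map h) V)).
Qed.

Lemma lms_comp1m (X Y : lms) (f : lms_hom X Y) : lms_comp (lms_id Y) f = f.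
Proof.
apply: lms_hom_ext => // U V UV UV' s /=.
by rewrite (lms_comp_comapE UV UV' (fun _ k => k)) /= /lms_id_comap res_id.
Qed.

Lemma lms_compm1 (X Y : lms) (f : lms_hom X Y) : lms_comp f (lms_id X) = f.
Proof.
apply: lms_hom_ext => // U V UV UV' s /=.
rewrite (lms_comp_comapE UV (fun _ k => k) UV') /= /lms_id_comap res_id //.
Qed.
End LmsCategory.

Definition LMS : category := Category lms_compA lms_comp1m lms_compm1.

Section Restriction.
Variables (X : lms) (U : opens X).
Let T : topologicalType := set_type (oset U).

Definition incl_map (x : T) : X := val x.

Lemma incl_map_continuous : continuous incl_map.
Proof. exact: initial_continuous. Qed.

Definition incl_cts : continuousType T X := mkcts incl_map_continuous.

Lemma open_incl_image (V : set T) : open V -> open (incl_map @` V).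
Proof.
move=> [W oW <-]; rewrite (_ : _ @` _ = W `&` oset U).
  by apply: openI => //; exact: openP.
apply/seteqP; split=> [_ [x Wx <-]|x [Wx Ux]]; first by split=> //; exact: set_valP.
by exists (SigSub (mem_set Ux)).
Qed.

Definition opens_image (V : opens T) : opens X := Opens (open_incl_image (openP V)).

Lemma opens_imageS (V W : opens T) : W `<=` V -> opens_image W `<=` opens_image V.
Proof. exact: image_subset. Qed.

Definition restr_sect (V : opens T) : nmodType := \M_X (opens_image V).

Definition restr_res (V W : opens T) (WV : W `<=` V) :
  {additive restr_sect V -> restr_sect W} := res \M_X (opens_imageS WV).

Lemma restr_res_id (V : opens T) (VV : V `<=` V) s : restr_res VV s = s.
Proof. exact: res_id. Qed.

Lemma restr_res_res (V W W' : opens T) (WV : W `<=` V) (W'W : W' `<=` W)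
  (W'V : W' `<=` V) s : restr_res W'W (restr_res WV s) = restr_res W'V s.
Proof. exact: res_res. Qed.

Lemma restr_glue (I : small) (V : opens T) (W : I -> opens T)
    (WV : forall i, W i `<=` V) : V `<=` \bigcup_i W i ->
  forall s : (forall i, restr_sect (W i)),
  (forall i j (W' : opens T) (Wi : W' `<=` W i) (Wj : W' `<=` W j),
     restr_res Wi (s i) = restr_res Wj (s j)) ->
  exists! t : restr_sect V, forall i, restr_res (WV i) t = s i.
Proof.
move=> cov s compat.
apply: (@sheaf_glue _ \M_X I (opens_image V) (fun i => opens_image (W i))
  (fun i => opens_imageS (WV i)) _ s).
  by move=> _ [x /cov [i _ Wx] <-]; exists i => //; exists x.
move=> i j Z Zi Zj.
have ZZ' : Z `<=` opens_image (preopen incl_cts Z).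
  by move=> x Zx; have [y _ yx] := Zi x Zx; exists y; rewrite /= /mkcts ?yx.
have Wi : preopen incl_cts Z `<=` W i.
  by move=> x /Zi [y Wy] /val_inj <-.
have Wj : preopen incl_cts Z `<=` W j.
  by move=> x /Zj [y Wy] /val_inj <-.
have := congr1 (res \M_X ZZ') (compat i j _ Wi Wj).
rewrite /restr_res !res_trans => e.
by rewrite (res_irr Zi (subset_trans ZZ' (opens_imageS Wi))) e; apply: res_irr.
Qed.

Definition restr_sheaf : sheaf T :=
  Sheaf restr_res_id restr_res_res restr_glue.

Definition restr : lms := @Lms T restr_sheaf.
End Restriction.

Section RestrictionInclusion.
Variables (X : lms) (U : opens X).

Lemma opens_image_sub (V : opens (restr U)) (W : opens X) :
  V `<=` incl_cts U @^-1` W -> opens_image V `<=` W.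
Proof. by move=> VW _ [x /VW Wx <-]. Qed.

Definition restr_incl_comap (V : opens (restr U)) (W : opens X)
    (VW : V `<=` incl_cts U @^-1` W) (s : \M_X W) : \M_(restr U) V :=
  res \M_X (opens_image_sub VW) s.

Lemma restr_incl_comap_additive (V : opens (restr U)) (W : opens X)
  (VW : V `<=` incl_cts U @^-1` W) : nmod_morphism (restr_incl_comap VW).
Proof.
by split=> [|s t]; rewrite /restr_incl_comap; [apply: raddf0 | apply: raddfD].
Qed.

Lemma restr_incl_comap_res (V V' : opens (restr U)) (W W' : opens X)
    (VW : V `<=` incl_cts U @^-1` W) (V'W' : V' `<=` incl_cts U @^-1` W')
    (V'V : V' `<=` V) (WW' : W `<=` W') s :
  restr_incl_comap V'W' s =
  res \M_(restr U) V'V (restr_incl_comap VW (res \M_X WW' s)).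
Proof.
rewrite /restr_incl_comap /= /restr_res !res_trans; exact: res_irr.
Qed.

Definition restr_incl_comorphism : @comorphism (restr U) X (incl_cts U) :=
  @Comorphism (restr U) X (incl_cts U) restr_incl_comap
    restr_incl_comap_additive restr_incl_comap_res.

Lemma restr_incl_local x : local_hom (stalk_map restr_incl_comorphism (x := x)).
Proof.
apply/local_germP => V W VW Vx Wx s /germ_unitP [V' [V'x [V'V u]]].
apply/germ_unitP; exists (opens_image V'); split; first by exists x.
have V'W : V' `<=` incl_cts U @^-1` W by move=> y /V'V /VW.
exists (opens_image_sub V'W).
move: u; rewrite /= /restr_incl_comap /restr_res /= res_trans.
by rewrite (res_irr _ (opens_image_sub V'W)).
Qed.

Definition restr_incl : @hom LMS (restr U) X := LmsHom restr_incl_local.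
End RestrictionInclusion.

Definition lms_open_embedding (X Y : LMS) (f : hom X Y) : Prop :=
  exists (U : opens Y) (g : @hom LMS X (restr U)),
    is_iso g /\ f = restr_incl U \oc g.

Record prime_ideal (P : nmodType) := PrimeIdeal {
  pr : set P;
  pr_ideal : forall p q, pr p -> pr (p + q);
  pr_0 : ~ pr 0;
  pr_D : forall p q, ~ pr p -> ~ pr q -> ~ pr (p + q)
}.

HB.instance Definition _ P := gen_eqMixin (prime_ideal P).
HB.instance Definition _ P := gen_choiceMixin (prime_ideal P).

Section Spec.
Variable P : nmodType.

Definition basic_open (p : P) : set (prime_ideal P) := [set x | ~ pr x p].

Definition spec_open (W : set (prime_ideal P)) : Prop :=
  forall x, W x -> exists p, basic_open p x /\ basic_open p `<=` W.

Lemma spec_openT : spec_open setT.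
Proof. by move=> x _; exists 0; split=> //; apply: pr_0. Qed.

Lemma spec_openI : setI_closed spec_open.
Proof.
move=> V W oV oW x [/oV [p [px pV]] /oW [q [qx qW]]].
exists (p + q); split; first exact: pr_D.
move=> y ny; split; [apply: pV => yp | apply: qW => yq]; apply: ny.
  exact: pr_ideal.
by rewrite addrC; apply: pr_ideal.
Qed.

Lemma spec_open_bigU (I : Type) (f : I -> set (prime_ideal P)) :
  (forall i, spec_open (f i)) -> spec_open (\bigcup_i f i).
Proof.
move=> o x [i _ /o [p [px pf]]]; exists p; split=> // y /pf fy; by exists i.
Qed.

HB.instance Definition _ := isOpenTopological.Build (prime_ideal P)
  spec_openT spec_openI spec_open_bigU.

Definition spec_space : topologicalType := prime_ideal P.

Definition pr_compl (x : spec_space) : submonoid P :=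
  @Submonoid P [set p | ~ pr x p] (@pr_0 _ x) (@pr_D _ x).

Definition local_at (x : spec_space) : nmodType := localization (pr_compl x).

Definition locally_fraction (W : opens spec_space)
    (s : forall x, oset W x -> local_at x) : Prop :=
  forall x, oset W x -> exists (V : opens spec_space) (a b : P),
    [/\ oset V x, V `<=` W & forall y (Wy : oset W y), oset V y ->
      exists nb : ~ pr y b, s y Wy = @lfrac P (pr_compl y) a b nb].

(* Over [basic_open p] the sections are the localization of [P] at the multiples
   of [p]: the elements of [P] dividing no multiple of [p] form a prime, the
   localization there is the localization of [P] at [p], and every open set
   containing this prime contains [basic_open p]. *)
Record spec_sect (W : opens spec_space) := SpecSect {
  ss_val : forall x, oset W x -> local_at x;
  ss_loc : locally_fraction ss_val
}.

Lemma spec_sect_ext (W : opens spec_space) (s t : spec_sect W) :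
  (forall x (Wx : oset W x), ss_val s Wx = ss_val t Wx) -> s = t.
Proof.
case: s t => [s sl] [t tl] /= st.
have e : s = t by do 2![apply/functional_extensionality_dep => ?]; apply: st.
by case: t / e tl st => tl _; rewrite (Prop_irrelevance sl tl).
Qed.

Lemma ss_val_irr (W : opens spec_space) (s : spec_sect W) x
  (h h' : oset W x) : ss_val s h = ss_val s h'.
Proof. by rewrite (Prop_irrelevance h h'). Qed.

HB.instance Definition _ W := gen_eqMixin (spec_sect W).
HB.instance Definition _ W := gen_choiceMixin (spec_sect W).

Section SpecSectMonoid.
Variable W : opens spec_space.

Lemma spec_zero_loc : locally_fraction (fun x (_ : oset W x) => 0 : local_at x).
Proof.
by move=> x Wx; exists W, 0, 0; split=> // y Wy _; exists (@pr_0 _ y).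
Qed.

Definition spec_zero : spec_sect W := SpecSect spec_zero_loc.

Lemma spec_add_loc (s t : spec_sect W) :
  locally_fraction (fun x (Wx : oset W x) => ss_val s Wx + ss_val t Wx).
Proof.
move=> x Wx; have [V [a [b [Vx VW Vs]]]] := ss_loc s Wx.
have [V' [a' [b' [V'x V'W V't]]]] := ss_loc t Wx.
exists (opensI V V'), (a + a'), (b + b'); split=> //; first by move=> y [/VW].
move=> y Wy [Vy V'y]; have [nb ->] := Vs y Wy Vy; have [nb' ->] := V't y Wy V'y.
by exists (pr_D nb nb'); exact: lfracD.
Qed.

Definition spec_add (s t : spec_sect W) : spec_sect W := SpecSect (spec_add_loc s t).

Lemma spec_addA : associative spec_add.
Proof. by move=> r s t; apply: spec_sect_ext => x Wx /=; rewrite addrA. Qed.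

Lemma spec_addC : commutative spec_add.
Proof. by move=> s t; apply: spec_sect_ext => x Wx /=; rewrite addrC. Qed.

Lemma spec_add0 : left_id spec_zero spec_add.
Proof. by move=> s; apply: spec_sect_ext => x Wx /=; rewrite add0r. Qed.

HB.instance Definition _ :=
  GRing.isNmodule.Build (spec_sect W) spec_addA spec_addC spec_add0.
End SpecSectMonoid.

Section SpecRestriction.
Variables (U V : opens spec_space) (VU : V `<=` U).

Lemma spec_res_loc (s : spec_sect U) :
  locally_fraction (fun x (Vx : oset V x) => ss_val s (VU Vx)).
Proof.
move=> x Vx; have [W [a [b [Wx WU Ws]]]] := ss_loc s (VU Vx).
exists (opensI V W), a, b; split=> //; first by move=> y [].
by move=> y Vy [_ Wy]; have [nb e] := Ws y (VU Vy) Wy; exists nb.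
Qed.

Definition spec_res (s : spec_sect U) : spec_sect V := SpecSect (spec_res_loc s).

Lemma spec_res_additive : nmod_morphism spec_res.
Proof. by split=> [|s t]; apply: spec_sect_ext. Qed.

HB.instance Definition _ :=
  GRing.isNmodMorphism.Build (spec_sect U) (spec_sect V) spec_res spec_res_additive.

Definition spec_res_additive_fun : {additive spec_sect U -> spec_sect V} := spec_res.
End SpecRestriction.

Lemma spec_res_id (U : opens spec_space) (UU : U `<=` U) s :
  spec_res_additive_fun UU s = s.
Proof.
apply: spec_sect_ext => x Ux /=; exact: ss_val_irr.
Qed.

Lemma spec_res_res (U V W : opens spec_space) (VU : V `<=` U) (WV : W `<=` V)
  (WU : W `<=` U) s :
  spec_res_additive_fun WV (spec_res_additive_fun VU s) = spec_res_additive_fun WU s.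
Proof.
apply: spec_sect_ext => x Wx /=; exact: ss_val_irr.
Qed.

Lemma spec_glue (I : small) (U : opens spec_space) (V : I -> opens spec_space)
    (VU : forall i, V i `<=` U) : U `<=` \bigcup_i V i ->
  forall s : (forall i, spec_sect (V i)),
  (forall i j (W : opens spec_space) (Wi : W `<=` V i) (Wj : W `<=` V j),
     spec_res_additive_fun Wi (s i) = spec_res_additive_fun Wj (s j)) ->
  exists! t : spec_sect U, forall i, spec_res_additive_fun (VU i) t = s i.
Proof.
move=> cov s compat.
have cov' x : oset U x -> exists i, oset (V i) x by move=> /cov [i _ Vx]; exists i.
have agree i j x (Vi : oset (V i) x) (Vj : oset (V j) x) :
    ss_val (s i) Vi = ss_val (s j) Vj.
  have := compat i j (opensI (V i) (V j)) (@opensIl _ _ _) (@opensIr _ _ _).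
  pose VV := opensI (V i) (V j); have VVx : oset VV x by [].
  move=> /(congr1 (fun r : spec_sect VV => ss_val r VVx)) /=.
  by rewrite (ss_val_irr _ _ Vi) (ss_val_irr _ _ Vj).
pose ix x (Ux : oset U x) := projT1 (cid (cov' x Ux)).
have ixP x (Ux : oset U x) : oset (V (ix x Ux)) x by rewrite /ix; case: cid.
pose t x (Ux : oset U x) : local_at x := ss_val (s (ix x Ux)) (ixP x Ux).
have tE i x (Ux : oset U x) (Vx : oset (V i) x) : t x Ux = ss_val (s i) Vx.
  exact: agree.
have tl : locally_fraction t.
  move=> x Ux; have [i Vx] := cov' x Ux.
  have [W [a [b [Wx WV Ws]]]] := ss_loc (s i) Vx.
  exists W, a, b; split=> //; first by move=> y /WV /VU.
  by move=> y Uy Wy; rewrite (tE i y Uy (WV y Wy)); apply: Ws.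
exists (SpecSect tl); split=> [i|t' t'E].
  by apply: spec_sect_ext => x Vx /=; apply: tE.
apply: spec_sect_ext => x Ux /=; have [i Vx] := cov' x Ux.
rewrite (tE i x Ux Vx) -(t'E i) /=; exact: ss_val_irr.
Qed.

Definition spec_sheaf : sheaf spec_space :=
  @Sheaf spec_space (fun U => spec_sect U : nmodType)
    (fun U V VU => spec_res_additive_fun VU)
    spec_res_id spec_res_res spec_glue.

Definition Spec : LMS := Lms spec_sheaf.
End Spec.

Definition locally_spec (Q : nmodType -> Prop) (X : LMS) : Prop :=
  forall x : lms_space X, exists U : opens (lms_space X), oset U x /\
    exists P : nmodType, Q P /\
    exists f : @hom LMS (restr U) (Spec P), is_iso f.

Definition is_fan (X : LMS) : Prop := locally_spec (fun _ => True) X.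

Definition is_lft_fan (X : LMS) : Prop := locally_spec fin_gen X.

Definition is_surjective (X Y : Type) (f : X -> Y) : Prop :=
  forall y, exists x, f x = y.

Section Underlying.
Variables (E : category) (und : functor E Top).

Definition und_space (X : E) : topologicalType := und X.

Definition und_map (X Y : E) (f : hom X Y) :
  continuousType (und_space X) (und_space Y) := fmor und f.

Definition represents_open (X : E) (U : set (und_space X)) (V : E) (j : hom V X) :
    Prop :=
  range (und_map j) `<=` U /\
  forall (Y : E) (f : hom Y X), range (und_map f) `<=` U ->
    exists! g : hom Y V, j \oc g = f.

Definition open_embedding (V X : E) (j : hom V X) : Prop :=
  exists U : opens (und_space X), represents_open U j.

Definition zariski_cover (X Y : E) (f : hom X Y) : Prop :=
  is_surjective (und_map f) /\
  forall x : und_space X, exists (U : E) (j : hom U X),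
    [/\ open_embedding j, open_embedding (f \oc j) & range (und_map j) x].
End Underlying.

Record category_of_spaces := CategoryOfSpaces {
  Esp :> category;
  und : functor Esp Top;
  A1 : monoid_object Esp;

  esp_finite_limits : forall (J : category) (D : functor J Esp),
    finite_category J ->
    exists (L : Esp) (p : forall j, hom L (D j)), is_limit p;

  esp_coproducts : forall (I : small) (F : I -> Esp),
    exists (Q : Esp) (q : forall i, hom (F i) Q), is_coproduct q;

  esp_und_coproducts : forall (I : small) (F : I -> Esp) (Q : Esp)
    (q : forall i, hom (F i) Q), is_coproduct q ->
    is_coproduct (fun i => fmor und (q i));

  esp_open : forall (X : Esp) (U : opens (und_space und X)),
    exists (V : Esp) (j : hom V X),
      represents_open U j /\ is_open_inclusion (und_map und j) U;

  esp_empty : forall X : Esp, (und_space und X -> False) -> is_initial X;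

  esp_zariski : exists T : grothendieck_topology Esp, subcanonical T /\
    forall (X Y : Esp) (f : hom X Y), zariski_cover und f -> is_cover T f;

  esp_coproduct_open : forall (I : small) (F : I -> Esp) (Q : Esp)
    (q : forall i, hom (F i) Q), is_coproduct q ->
    forall i, open_embedding und (q i);

  esp_pushout : forall (X0 X1 X2 : Esp) (f1 : hom X0 X1) (f2 : hom X0 X2),
    open_embedding und f1 -> open_embedding und f2 ->
    exists (Q : Esp) (q1 : hom X1 Q) (q2 : hom X2 Q),
      [/\ is_pushout f1 f2 q1 q2,
          open_embedding und q1, open_embedding und q2,
          open_embedding und (q1 \oc f1) &
          is_pushout (fmor und f1) (fmor und f2) (fmor und q1) (fmor und q2)];

  esp_well_ordered : forall (d : Order.disp_t) (W : orderType d)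
    (D : functor (poset_category W) Esp),
    well_order (fun x y : W => (x <= y)%O) ->
    (forall (x y : poset_category W) (a : hom x y), open_embedding und (fmor D a)) ->
    exists (Q : Esp) (q : forall x, hom (D x) Q),
      [/\ is_colimit q, forall x, open_embedding und (q x) &
          @is_colimit _ _ (comp_functor und D) (und Q) (fun x => fmor und (q x))];

  esp_Gm : exists (G : Esp) (u : Gm_presheaf A1 G),
    universal_element u /\ open_embedding und (sval u : hom G A1)
}.

Section StructureSheaf.
Variable E : category_of_spaces.
Local Notation sp := (und_space (und E)).
Local Notation mp := (@und_map E (und E) _ _).

Lemma und_map1 (X : E) (x : (sp X)) : (mp (idm X)) x = x.
Proof. by rewrite /und_map fmor1. Qed.

Lemma und_mapM (X Y Z : E) (g : hom Y Z) (f : hom X Y) (x : (sp X)) :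
  (mp (g \oc f)) x = (mp g) ((mp f) x).
Proof. by rewrite /und_map fmorM. Qed.

Lemma range_comp (X Y Z : E) (g : hom Y Z) (f : hom X Y) :
  range (mp (g \oc f)) `<=` range (mp g).
Proof. by move=> _ [x _ <-]; rewrite und_mapM; exists ((mp f) x). Qed.

Definition opn_sig (X : E) (U : opens (sp X)) :
  {V : E & {j : hom V X | represents_open U j /\ is_open_inclusion (mp j) U}} :=
  let V := cid (esp_open U) in existT _ (projT1 V) (cid (projT2 V)).

Definition opn (X : E) (U : opens (sp X)) : E := projT1 (opn_sig U).
Definition opn_incl (X : E) (U : opens (sp X)) : hom (opn U) X :=
  sval (projT2 (opn_sig U)).

Lemma opn_rep (X : E) (U : opens (sp X)) : represents_open U (opn_incl U).
Proof. exact: (svalP (projT2 (opn_sig U))).1. Qed.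

Lemma opn_inclusion (X : E) (U : opens (sp X)) :
  is_open_inclusion (mp (opn_incl U)) U.
Proof. exact: (svalP (projT2 (opn_sig U))).2. Qed.

Lemma opn_open_embedding (X : E) (U : opens (sp X)) :
  open_embedding (und E) (opn_incl U).
Proof. by exists U; apply: opn_rep. Qed.

Lemma represents_mono (X V : E) (U : set (sp X)) (j : hom V X) :
  represents_open U j ->
  forall (Y : E) (a b : hom Y V), j \oc a = j \oc b -> a = b.
Proof.
move=> [jU uni] Y a b ab.
have [|c [_ cU]] := uni Y (j \oc a).
  by apply: subset_trans jU; apply: range_comp.
by rewrite -(cU a erefl); apply: cU.
Qed.

Lemma represents_inclusion (X V : E) (U : opens (sp X)) (j : hom V X) :
  represents_open U j -> is_open_inclusion (mp j) U.
Proof.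
move=> rj; have rk := opn_rep U; have [kinj kU kop] := opn_inclusion U.
have [a [ja _]] := rj.2 _ _ rk.1.
have [b [kb _]] := rk.2 _ _ rj.1.
have ab : a \oc b = idm V.
  by apply: (represents_mono rj); rewrite compA ja kb compm1.
have ba : b \oc a = idm _.
  by apply: (represents_mono rk); rewrite compA kb ja compm1.
have abx x : (mp a) ((mp b) x) = x by rewrite -und_mapM ab und_map1.
have bax x : (mp b) ((mp a) x) = x by rewrite -und_mapM ba und_map1.
have jE x : (mp j) x = (mp (opn_incl U)) ((mp b) x) by rewrite -und_mapM kb.
split.
- move=> x y; rewrite !jE => /kinj bxy.
  by rewrite -[x]abx bxy abx.
- rewrite -kU; apply/seteqP; split=> [_ [x _ <-]|_ [x _ <-]].
    by exists ((mp b) x); rewrite ?jE.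
  by exists ((mp a) x); rewrite ?jE ?bax.
- move=> W oW.
  have oaW : open ((mp a) @^-1` W) by apply: (continuousP (mp a)).1 => //; apply: cts_fun.
  rewrite (_ : _ @` W = (mp (opn_incl U)) @` ((mp a) @^-1` W)); first exact: kop.
  apply/seteqP; split=> [_ [x Wx <-]|_ [x Wx <-]].
    by exists ((mp b) x); rewrite /= ?abx ?jE.
  by exists ((mp a) x); rewrite // jE bax.
Qed.

Definition opn_lift (X Y : E) (U : opens (sp X)) (f : hom Y X)
  (fU : range (mp f) `<=` U) : hom Y (opn U) := sval (cid ((opn_rep U).2 Y f fU)).

Lemma opn_liftK (X Y : E) (U : opens (sp X)) (f : hom Y X)
  (fU : range (mp f) `<=` U) : opn_incl U \oc opn_lift fU = f.
Proof. by rewrite /opn_lift; case: cid => g []. Qed.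

Lemma opn_mono (X Y : E) (U : opens (sp X)) (a b : hom Y (opn U)) :
  opn_incl U \oc a = opn_incl U \oc b -> a = b.
Proof. exact: (represents_mono (opn_rep U)). Qed.

Lemma opn_range (X : E) (U : opens (sp X)) : range (mp (opn_incl U)) = U.
Proof. by case: (opn_inclusion U). Qed.

(* Points of a coproduct of spaces come from the summands: test against maps to
   a two-point indiscrete space. *)
Lemma coproduct_surj (I : small) (F : I -> E) (Q : E) (q : forall i, hom (F i) Q) :
  is_coproduct q -> forall x : (sp Q), exists (i : I) (y : (sp (F i))), (mp (q i)) y = x.
Proof.
move=> /(@esp_und_coproducts E) cop.
pose B : topologicalType := initial_topology (fun _ : bool => true).
have ctsB (T : topologicalType) (f : T -> B) : continuous f.
  apply/continuousP => A [A' _ <-].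
  have [At|At] := pselect (A' true).
    rewrite (_ : _ @^-1` _ = setT); first exact: openT.
    by apply/seteqP; split.
  rewrite (_ : _ @^-1` _ = set0); first exact: open0.
  by apply/seteqP; split.
pose S := [set x : (sp Q) | exists (i : I) (y : (sp (F i))), (mp (q i)) y = x].
pose f : continuousType (sp Q) B := mkcts (ctsB (sp Q) (fun x => `[< S x >])).
pose g : continuousType (sp Q) B := mkcts (ctsB (sp Q) (fun=> true)).
pose h i : continuousType (sp (F i)) B := mkcts (ctsB (sp (F i)) (fun=> true)).
have [u [_ uU]] := cop (B : Top) (fun i => h i).
have uf : u = f.
  apply: uU => i; apply/continuousEP => y; apply/asboolP.
  by exists i, y.
have ug : u = g by apply: uU => i; apply/continuousEP.
move=> x; apply/asboolP; change (f x = g x); by rewrite -uf -ug.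
Qed.

Section Gluing.
Variables (X Z : E) (I : small) (V : I -> E) (j : forall i, hom (V i) X).
Hypothesis jopen : forall i, open_embedding (und E) (j i).
Hypothesis jcov : forall x : (sp X), exists (i : I) (y : (sp (V i))), (mp (j i)) y = x.

Lemma zariski_coproduct (Q : E) (q : forall i, hom (V i) Q) (f : hom Q X) :
  is_coproduct q -> (forall i, f \oc q i = j i) -> zariski_cover (und E) f.
Proof.
move=> cop fq; split=> [x|y].
  by have [i [y <-]] := jcov x; exists ((mp (q i)) y); rewrite -und_mapM fq.
have [i [z zy]] := coproduct_surj cop y.
exists (V i), (q i); split; [exact: esp_coproduct_open cop _ | | by exists z].
by rewrite fq.
Qed.

Lemma zariski_epi (a b : hom X Z) : (forall i, a \oc j i = b \oc j i) -> a = b.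
Proof.
move=> ab; have [Q [q cop]] := esp_coproducts V.
have [f [fq _]] := cop X j.
have [T [sub Tcov]] := esp_zariski E.
have := sub _ _ (Tcov _ _ _ (zariski_coproduct cop fq)) Z (fun Y g _ => a \oc g).
case=> [Y Y' g h _ _|t [_ tU]]; first by rewrite compA.
have af : a \oc f = b \oc f.
  have [u [_ uU]] := cop Z (fun i => a \oc j i).
  rewrite -(uU (a \oc f)); last by move=> i; rewrite -compA fq.
  by apply: uU => i; rewrite -compA fq ab.
rewrite -(tU a) //; apply: tU => Y _ [k ->].
by rewrite !compA af.
Qed.
End Gluing.

Lemma zariski_glue (X Z : E) (I : small) (V : I -> E) (j : forall i, hom (V i) X)
    (s : forall i, hom (V i) Z) :
  (forall i, open_embedding (und E) (j i)) ->
  (forall x : (sp X), exists (i : I) (y : (sp (V i))), (mp (j i)) y = x) ->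
  (forall i k (T : E) (a : hom T (V i)) (b : hom T (V k)),
     j i \oc a = j k \oc b -> s i \oc a = s k \oc b) ->
  exists! t : hom X Z, forall i, t \oc j i = s i.
Proof.
move=> jopen jcov compat.
have [Q [q cop]] := esp_coproducts V.
have [f [fq _]] := cop X j.
have [r [rq _]] := cop Z s.
have [T [sub Tcov]] := esp_zariski E.
have qrange i : open (range (mp (q i))).
  have [U rU] := esp_coproduct_open cop i.
  by have [_ -> _] := represents_inclusion rU; apply: openP.
have key (Y : E) (a b : hom Y Q) : f \oc a = f \oc b -> r \oc a = r \oc b.
  move=> fab.
  pose W (p : I * I) : opens (sp Y) :=
    opensI (preopen (mp a) (Opens (qrange p.1))) (preopen (mp b) (Opens (qrange p.2))).
  apply: (@zariski_epi Y Z (I * I)%type (fun p => opn (W p)) (fun p => opn_incl (W p))).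
  - by move=> p; apply: opn_open_embedding.
  - move=> y.
    have [i [u iu]] := coproduct_surj cop ((mp a) y).
    have [k [v kv]] := coproduct_surj cop ((mp b) y).
    have : oset (W (i, k)) y by split; [exists u | exists v].
    rewrite -(opn_range (W (i, k))) => -[z _ zy].
    by exists (i, k), z.
  - move=> [i k]; set w := opn_incl _.
    have [Ui rUi] := esp_coproduct_open cop i.
    have [Uk rUk] := esp_coproduct_open cop k.
    have [_ eUi _] := represents_inclusion rUi.
    have [_ eUk _] := represents_inclusion rUk.
    have [|a' [ea _]] := rUi.2 _ (a \oc w).
      rewrite -eUi => _ [x _ <-]; rewrite und_mapM.
      have : oset (W (i, k)) ((mp w) x) by rewrite -(opn_range (W (i, k))); exists x.
      by case.
    have [|b' [eb _]] := rUk.2 _ (b \oc w).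
      rewrite -eUk => _ [x _ <-]; rewrite und_mapM.
      have : oset (W (i, k)) ((mp w) x) by rewrite -(opn_range (W (i, k))); exists x.
      by case.
    rewrite -!compA -ea -eb !compA !rq; apply: compat.
    by rewrite -!fq -!compA ea eb !compA fab.
have := sub _ _ (Tcov _ _ _ (zariski_coproduct jopen jcov cop fq)) Z
  (fun Y g (gS : exists k, g = f \oc k) => r \oc projT1 (cid gS)).
case=> [Y Y' g h Sg Sgh|t [tE tU]].
  rewrite -compA; apply: key.
  by case: (cid Sgh) (cid Sg) => k1 /= <- [k2 /= e]; rewrite compA -e.
exists t; split=> [i|t' t'E].
  have S : exists k, j i = f \oc k by exists (q i).
  rewrite (tE _ _ S) -rq; apply: key.
  by case: (cid S) => k /= <-; rewrite fq.
apply: tU => Y g gS; case: (cid gS) => k /= ->.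
rewrite compA; congr (_ \oc _).
have [u [_ uU]] := cop Z s.
by rewrite -(uU r) //; apply/esym/uU => i; rewrite -compA fq.
Qed.

Section SheafOf.
Variable X : E.

Definition A_sect (U : opens (sp X)) : nmodType := mhom (A1 E) (opn U).

Lemma opn_incl_sub (U V : opens (sp X)) : V `<=` U -> range (mp (opn_incl V)) `<=` U.
Proof. by rewrite opn_range. Qed.

Definition opn_sub (U V : opens (sp X)) (VU : V `<=` U) : hom (opn V) (opn U) :=
  opn_lift (opn_incl_sub VU).

Lemma opn_subK (U V : opens (sp X)) (VU : V `<=` U) :
  opn_incl U \oc opn_sub VU = opn_incl V.
Proof. exact: opn_liftK. Qed.

Definition A_res_fun (U V : opens (sp X)) (VU : V `<=` U) (s : A_sect U) : A_sect V :=
  s \oc opn_sub VU.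

Lemma A_res_additive (U V : opens (sp X)) (VU : V `<=` U) :
  nmod_morphism (A_res_fun VU).
Proof. by split; [exact: mo_zero_comp | move=> s t; exact: mo_add_comp]. Qed.

HB.instance Definition _ (U V : opens (sp X)) (VU : V `<=` U) :=
  GRing.isNmodMorphism.Build (A_sect U) (A_sect V) (A_res_fun VU)
    (A_res_additive VU).

Definition A_res (U V : opens (sp X)) (VU : V `<=` U) :
  {additive A_sect U -> A_sect V} := A_res_fun VU.

Lemma A_res_id (U : opens (sp X)) (UU : U `<=` U) s : A_res UU s = s.
Proof.
rewrite /A_res /= /A_res_fun (_ : opn_sub UU = idm _) ?compm1 //.
by apply: opn_mono; rewrite opn_subK compm1.
Qed.

Lemma A_res_res (U V W : opens (sp X)) (VU : V `<=` U) (WV : W `<=` V)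
  (WU : W `<=` U) s : A_res WV (A_res VU s) = A_res WU s.
Proof.
rewrite /A_res /= /A_res_fun -compA; congr (_ \oc _).
by apply: opn_mono; rewrite compA !opn_subK.
Qed.

Lemma A_glue (I : small) (U : opens (sp X)) (V : I -> opens (sp X))
    (VU : forall i, V i `<=` U) : U `<=` \bigcup_i V i ->
  forall s : (forall i, A_sect (V i)),
  (forall i k (W : opens (sp X)) (Wi : W `<=` V i) (Wk : W `<=` V k),
     A_res Wi (s i) = A_res Wk (s k)) ->
  exists! t : A_sect U, forall i, A_res (VU i) t = s i.
Proof.
move=> cov s compat.
apply: (@zariski_glue (opn U) (A1 E) I (fun i => opn (V i))
  (fun i => opn_sub (VU i)) s).
- move=> i; exists (preopen (mp (opn_incl U)) (V i)); split.
    move=> _ [x _ <-] /=; rewrite -und_mapM opn_subK -opn_range; by exists x.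
  move=> Y f fV.
  have fV' : range (mp (opn_incl U \oc f)) `<=` V i.
    by move=> _ [y _ <-]; rewrite und_mapM; apply: fV; exists y.
  exists (opn_lift fV'); split.
    by apply: opn_mono; rewrite compA opn_subK opn_liftK.
  move=> g gf; apply: opn_mono.
  by rewrite opn_liftK -gf compA opn_subK.
- move=> x.
  have /cov [i _] : oset U ((mp (opn_incl U)) x) by rewrite -opn_range; exists x.
  rewrite -(opn_range (V i)) => -[y _ yx]; exists i, y.
  have [inj _ _] := opn_inclusion U; apply: inj.
  by rewrite -und_mapM opn_subK.
- move=> i k T a b ab.
  have iab : opn_incl (V i) \oc a = opn_incl (V k) \oc b.
    by rewrite -(opn_subK (VU i)) -(opn_subK (VU k)) -!compA ab.
  pose W := opensI (V i) (V k).
  have rW : range (mp (opn_incl (V i) \oc a)) `<=` W.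
    move=> _ [x _ <-]; split; [|rewrite iab]; rewrite und_mapM -opn_range.
      by exists ((mp a) x).
    by exists ((mp b) x).
  have -> : a = opn_sub (@opensIl _ (V i) (V k)) \oc opn_lift rW.
    by apply: opn_mono; rewrite compA opn_subK opn_liftK.
  have -> : b = opn_sub (@opensIr _ (V i) (V k)) \oc opn_lift rW.
    by apply: opn_mono; rewrite compA opn_subK opn_liftK.
  by rewrite !compA; congr (_ \oc _); apply: compat.
Qed.

Definition A_sheaf : sheaf (sp X) := Sheaf A_res_id A_res_res A_glue.

Definition lms_of : lms := Lms A_sheaf.
End SheafOf.

Section Functoriality.
Variables (X Y : E) (f : hom X Y).

Lemma A_pull_range (U : opens (sp X)) (V : opens (sp Y)) :
  U `<=` mp f @^-1` V -> range (mp (f \oc opn_incl U)) `<=` V.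
Proof.
move=> UV _ [x _ <-]; rewrite und_mapM; apply: UV.
by rewrite -opn_range; exists x.
Qed.

Definition opn_map (U : opens (sp X)) (V : opens (sp Y))
  (UV : U `<=` mp f @^-1` V) : hom (opn U) (opn V) := opn_lift (A_pull_range UV).

Lemma opn_mapK (U : opens (sp X)) (V : opens (sp Y)) (UV : U `<=` mp f @^-1` V) :
  opn_incl V \oc opn_map UV = f \oc opn_incl U.
Proof. exact: opn_liftK. Qed.

Definition A_comap (U : opens (sp X)) (V : opens (sp Y)) (UV : U `<=` mp f @^-1` V)
  (s : A_sect V) : A_sect U := s \oc opn_map UV.

Lemma A_comap_additive (U : opens (sp X)) (V : opens (sp Y))
  (UV : U `<=` mp f @^-1` V) : nmod_morphism (A_comap UV).
Proof. by split; [exact: mo_zero_comp | move=> s t; exact: mo_add_comp]. Qed.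

Lemma A_comap_res (U U' : opens (sp X)) (V V' : opens (sp Y))
    (UV : U `<=` mp f @^-1` V) (U'V' : U' `<=` mp f @^-1` V')
    (U'U : U' `<=` U) (VV' : V `<=` V') s :
  A_comap U'V' s = A_res U'U (A_comap UV (A_res VV' s)).
Proof.
rewrite /A_comap /A_res /= /A_res_fun -!compA; congr (_ \oc _).
apply: opn_mono; rewrite opn_mapK !compA opn_subK opn_mapK -compA.
by rewrite opn_subK.
Qed.

Definition A_comorphism : @comorphism (lms_of X) (lms_of Y) (mp f) :=
  @Comorphism (lms_of X) (lms_of Y) (mp f) A_comap A_comap_additive A_comap_res.

(* If [s] pulls back to a unit near [x], then it sends [f x] to the open
   subspace [Gm] of [A1], hence is a unit near [f x]. *)
Lemma A_local (x : lms_of X) : local_hom (stalk_map A_comorphism (x := x)).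
Proof.
apply/local_germP => U V UV Ux Vx s /germ_unitP [W [Wx [WU u]]].
have [G [g [guniv [O rO]]]] := esp_Gm E.
have [_ rgO _] := represents_inclusion rO.
have sc : open (mp (s : hom _ _) @^-1` O).
  by apply: (continuousP (mp _)).1; [exact: cts_fun | exact: openP].
have [inj rV oV] := opn_inclusion V.
pose V' : opens (sp Y) := Opens (oV _ sc).
have V'V : V' `<=` V by move=> _ [y _ <-]; rewrite -rV; exists y.
have V'fx : oset V' (mp f x).
  have [k [kE _]] := guniv _ (exist _ _ u : Gm_presheaf (A1 E) (opn W)).
  have [w _ wx] : range (mp (opn_incl W)) x by rewrite opn_range.
  have e : (s : hom _ (A1 E)) \oc (opn_map UV \oc opn_sub WU) = sval g \oc k.
    rewrite compA; exact: (esym (congr1 (@sval _ _) kE)).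
  exists (mp (opn_map UV \oc opn_sub WU) w).
    by rewrite /= -und_mapM e -rgO; exists (mp k w); rewrite ?und_mapM.
  by rewrite -und_mapM compA opn_mapK -compA opn_subK und_mapM wx.
apply/germ_unitP; exists V'; split=> //; exists V'V.
have sV' : range (mp ((s : hom _ (A1 E)) \oc opn_sub V'V)) `<=` O.
  move=> _ [y _ <-]; rewrite und_mapM.
  have : oset V' (mp (opn_incl V') y) by rewrite -(opn_range V'); exists y.
  move=> [z Oz zy]; rewrite (_ : mp (opn_sub V'V) y = z) //.
  by apply: inj; rewrite zy -und_mapM opn_subK.
have [k [kE _]] := rO.2 _ _ sV'.
have [v gv] := svalP g.
exists (v \oc k : mhom (A1 E) (opn V')).
rewrite /= /A_res_fun -kE.
rewrite [_ + _](_ : _ = (sval g + v : mhom (A1 E) G) \oc k); last first.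
  by rewrite [RHS]mo_add_comp.
by rewrite gv; apply: mo_zero_comp.
Qed.

Definition lms_of_map : @hom LMS (lms_of X) (lms_of Y) := LmsHom A_local.
End Functoriality.

Lemma lms_of_map1 (X : E) : lms_of_map (idm X) = idm (lms_of X : LMS).
Proof.
apply: lms_hom_ext => [x|U V UV UV' s] /=; first exact: und_map1.
rewrite /A_comap /lms_id_comap /= /A_res_fun; congr (_ \oc _).
by apply: opn_mono; rewrite opn_mapK opn_subK comp1m.
Qed.

Lemma lms_of_mapM (X Y Z : E) (g : hom Y Z) (f : hom X Y) :
  lms_of_map (g \oc f) = lms_of_map g \oc lms_of_map f.
Proof.
apply: lms_hom_ext => [x|U V UV UV' s] /=; first exact: und_mapM.
rewrite /lms_comp_comap /= /A_comap -compA; congr (_ \oc _).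
by apply: opn_mono; rewrite compA !opn_mapK -!compA opn_mapK.
Qed.

Definition lms_functor : functor E LMS := Functor lms_of_map1 lms_of_mapM.

Section RealizationPresheaf.
Variable Y : LMS.

Definition A_psh_pull (X X' : E) (f : hom X X') (s : hom (lms_functor X') Y) :
  hom (lms_functor X) Y := s \oc fmor lms_functor f.

Lemma A_psh_pull1 (X : E) (s : hom (lms_functor X) Y) : A_psh_pull (idm X) s = s.
Proof. by rewrite /A_psh_pull fmor1 compm1. Qed.

Lemma A_psh_pullM (X X' X'' : E) (g : hom X' X'') (f : hom X X')
  (s : hom (lms_functor X'') Y) :
  A_psh_pull (g \oc f) s = A_psh_pull f (A_psh_pull g s).
Proof. by rewrite /A_psh_pull fmorM compA. Qed.

Definition A_presheaf : presheaf E := Presheaf A_psh_pull1 A_psh_pullM.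
End RealizationPresheaf.

Section RealizationFunctor.
Variables (K : LMS -> Prop).
Variable R : forall Y : full_sub K, representation (A_presheaf (sval Y)).

Definition A_tau (Y : full_sub K) : @hom LMS (lms_functor (rep_ob (R Y))) (sval Y) :=
  rep_elt (R Y).

Lemma A_map_ex (Y Y' : full_sub K) (f : hom Y Y') :
  exists! g : hom (rep_ob (R Y)) (rep_ob (R Y')),
    A_tau Y' \oc fmor lms_functor g = @hcomp LMS _ _ _ f (A_tau Y).
Proof. exact: (rep_univ (R Y')). Qed.

Definition A_map (Y Y' : full_sub K) (f : hom Y Y') :
  hom (rep_ob (R Y)) (rep_ob (R Y')) := sval (cid (A_map_ex f)).

Lemma A_mapE (Y Y' : full_sub K) (f : hom Y Y') :
  A_tau Y' \oc fmor lms_functor (A_map f) = @hcomp LMS _ _ _ f (A_tau Y).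
Proof. by rewrite /A_map; case: cid => g []. Qed.

Lemma A_map_uniq (Y Y' : full_sub K) (f : hom Y Y') g :
  A_tau Y' \oc fmor lms_functor g = @hcomp LMS _ _ _ f (A_tau Y) -> g = A_map f.
Proof. by move=> gE; rewrite /A_map; case: cid => h [_ hU] /=; rewrite (hU g). Qed.

Lemma A_map1 (Y : full_sub K) : A_map (idm Y) = idm _.
Proof. by apply/esym/A_map_uniq; rewrite fmor1 compm1 comp1m. Qed.

Lemma A_mapM (Y Y' Y'' : full_sub K) (g : hom Y' Y'') (f : hom Y Y') :
  A_map (g \oc f) = A_map g \oc A_map f.
Proof.
apply/esym/A_map_uniq; rewrite fmorM compA A_mapE.
transitivity (@hcomp LMS _ _ _ g (A_tau Y' \oc fmor lms_functor (A_map f))).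
  by rewrite compA.
by rewrite A_mapE; apply: (@compA LMS).
Qed.

Definition A_functor : functor (full_sub K) E := Functor A_map1 A_mapM.
End RealizationFunctor.
End StructureSheaf.

(* Main.v *)
Require Import Defs.
From HB Require Import structures.
From mathcomp Require Import all_boot all_order ssralg.
From mathcomp Require Import boolp classical_sets wochoice cardinality.
From mathcomp Require Import topology_structure initial_topology bool_topology.
From mathcomp Require Import subtype_topology.
From mathcomp Require Import sigT_topology.
(* once more, so that these names shadow those of the libraries *)
Require Import Defs.

(** The functor [X |-> Hom(|X|, Y)] is a sheaf for open coverings of [X], and
    everything follows from gluing together with the affine case.

    For any locally monoidal space [X], morphisms [X -> Spec P] are the same as monoid
    maps from [P] to the global sections of [X] ([spec_hom], [spec_dual_inj]); for
    [X] in [E] the latter form the monoid [Hom(X, A1)].  If [P] is finitely generated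
    it is finitely presented ([redei]), so such a map is a solution in [A1] of finitely
    many equations between monomials, and these solutions are represented by an
    equalizer of two morphisms between powers of [A1] ([spec_realizable]).

    To pass to a general fan [Y], say that a space [Z] with a morphism [|Z| -> Y]
    realizes an open subset [O] of [Y] if it represents the morphisms with values in
    [O].  A realization of [O] restricts to its open subsets ([realizes_sub]).
    Conversely, let [Q] be glued from realizations of the members of an open cover,
    in such a way that two morphisms to the pieces become equal in [Q] exactly when
    they have the same composite to [Y]: then [Q] realizes the union
    ([realizes_glue]).  This applies to pushouts along the realization of an
    intersection, to well-ordered unions and to disjoint unions.  A well-ordering of
    the points of [Y], each with a neighbourhood that is realized, then gives a
    realization of [Y] by transfinite induction ([realizable_cover]).

    Open embeddings are handled by restricting realizations.  A coproduct of fans is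
    their disjoint union ([fan_coproduct]), so that its realization is the coproduct of
    the realizations.  A limit computed among locally monoidal spaces is preserved
    because the realization functor is a partial right adjoint of [X |-> |X|]; it
    remains to see that a finite limit [L] in the category of fans is one among
    locally monoidal spaces ([fan_finite_limit]).  The point is that a finite diagram
    of morphisms from [X] to fans factors, near any point of [X], through a diagram of
    the same shape starting from one affine fan [Spec N] ([local_factor]), where [N] is
    a monoid of sections of [X] near the point that contains the pullbacks of finitely
    many coordinate monoids and the inverses of some of these pullbacks; it can be
    taken finitely generated if the coordinate monoids are.  So cones over the
    diagram lift locally to [L], two lifts of one cone agree locally, and the lifts
    glue. *)

Set Implicit Arguments.
Unset Strict Implicit.
Unset Printing Implicit Defensive.

Import GRing.Theory.
Local Open Scope classical_set_scope.
Local Open Scope ring_scope.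

(** * Finitely generated commutative monoids are finitely presented *)

(** Dickson's lemma, by induction on the number of coordinates: if [H] bounds the last
    coordinate on a basis for the first [n] coordinates, this basis dominates all
    vectors whose last coordinate is at least [H], and each smaller value of the last
    coordinate contributes a finite basis of its own. *)
Lemma dickson n (B : set (nat -> nat)) :
  exists2 F, finite_set F & F `<=` B /\
    forall v, B v -> exists2 b, F b & forall i, (i < n)%N -> (b i <= v i)%N.
Proof.
elim: n B => [|n IHn] B.
  have [[b Bb]|nB] := pselect (exists b, B b); last first.
    by exists set0 => //; split=> // v Bv; case: nB; exists v.
  by exists [set b] => //; split=> [_ ->//|v _]; exists b.
have [F finF [FB Fbase]] := IHn B.
have /choice [G Gprop] : forall h, exists G, finite_set G /\
    (G `<=` B `&` [set v | v n = h] /\ forall v, (B `&` [set v | v n = h]) v ->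
       exists2 b, G b & forall i, (i < n)%N -> (b i <= v i)%N).
  by move=> h; have [G] := IHn (B `&` [set v | v n = h]); exists G.
have [H FH] : exists H, forall b, F b -> (b n <= H)%N.
  have /finite_seqP [s sF] := finF; exists (\max_(b <- s) b n)%N => b.
  by rewrite sF /= => bs; apply: (@leq_bigmax_seq _ s xpredT (fun b => b n) b).
exists (F `|` \bigcup_(h in `I_H) G h).
  rewrite finite_setU; split=> //; apply: bigcup_finite => // h _.
  by have [] := Gprop h.
split=> [v [/FB//|[h _ Gv]]|v Bv].
  by have [_ [/(_ v Gv) []]] := Gprop h.
have [Hv|vH] := leqP H (v n).
  have [b Fb bv] := Fbase v Bv; exists b; first by left.
  move=> i; rewrite ltnS leq_eqVlt => /orP[/eqP->|/bv//].
  by apply: leq_trans Hv; apply: FH.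
have [_ [Gsub /(_ v) []// b Gb bv]] := Gprop (v n).
exists b; first by right; exists (v n).
move=> i; rewrite ltnS leq_eqVlt => /orP[/eqP->|/bv//].
by have [_ ->] := Gsub b Gb.
Qed.

Section Lexicographic.

Definition agree n (v w : nat -> nat) := forall i, (i < n)%N -> v i = w i.

Definition lex n (v w : nat -> nat) := exists k,
  [/\ (k < n)%N, (v k < w k)%N & agree k v w].

Lemma lex_total n v w : [\/ lex n v w, lex n w v | agree n v w].
Proof.
elim: n => [|n [[k [kn vw e]]|[k [kn vw e]]|IHn]]; first by constructor 3.
- by constructor 1; exists k; split=> //; apply: ltnW.
- by constructor 2; exists k; split=> //; apply: ltnW.
have [vw|vw|vw] := ltngtP (v n) (w n).
- by constructor 1; exists n.
- by constructor 2; exists n; split=> // i /IHn.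
- by constructor 3=> i; rewrite ltnS leq_eqVlt => /orP[/eqP->|/IHn].
Qed.

(** Least elements exist as the coordinates can be minimized one after the other;
    they are unique only up to agreement in the first [n] coordinates. *)
Lemma lex_min n (S : set (nat -> nat)) v : S v ->
  exists2 m, S m & forall w, S w -> ~ lex n w m.
Proof.
elim: n S v => [|n IHn] S v Sv; first by exists v => // w _ [k []].
have [u Su umin] := IHn S v Sv.
pose P m := `[< exists w, [/\ S w, agree n w u & w n = m] >].
have exP : exists m, P m by exists (u n); apply/asboolP; exists u.
case: (ex_minnP exP) => m /asboolP [w [Sw wu wm]] mmin; exists w => // x Sx.
move=> [k [kn xw e]]; move: kn; rewrite ltnS leq_eqVlt => /orP[/eqP kn|kn].
  have /mmin : P (x n).
    by apply/asboolP; exists x; split=> // i ni; rewrite -wu ?e ?kn.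
  by rewrite leqNgt -wm -kn xw.
apply: (umin x) => //; exists k; split=> // [|i ik]; first by rewrite -wu.
by rewrite e// wu// (ltn_trans ik).
Qed.

Lemma lex_add n v w c c' : agree n c c' -> lex n v w ->
  lex n (fun i => v i + c i)%N (fun i => w i + c' i)%N.
Proof.
move=> cc' [k [kn vw e]]; exists k; split=> //; first by rewrite cc'// ltn_add2r.
by move=> i ik; rewrite e// cc'// (ltn_trans ik).
Qed.
End Lexicographic.

Definition evaluation (M : nmodType) n (x v : nat -> _) : M :=
  \sum_(i < n) x i *+ v i.

Lemma evaluation_agree (M : nmodType) n (x : nat -> M) v w :
  agree n v w -> evaluation n x v = evaluation n x w.
Proof. by move=> vw; apply: eq_bigr => i _; rewrite vw. Qed.

Lemma evaluationD (M : nmodType) n (x : nat -> M) v w :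
  evaluation n x (fun i => v i + w i)%N = evaluation n x v + evaluation n x w.
Proof. by rewrite -big_split; apply: eq_bigr => i _; rewrite mulrnDr. Qed.

(** Redei's theorem, by Groebner reduction: call a vector reducible if it is not
    lexicographically least among those with its value.  Reducible vectors form an
    ideal, generated by finitely many vectors; the relations equating each of
    these generators with a smaller vector imply all others, since they allow one
    to descend from any vector to the least one with the same value.  That the
    relations imply all others is expressed by families [x] in arbitrary monoids. *)
Lemma redei (P : nmodType) n (s : nat -> P) : exists k (a b : 'I_k -> nat -> nat),
  (forall j, evaluation n s (a j) = evaluation n s (b j)) /\
  forall (M : nmodType) (x : nat -> M),
    (forall j, evaluation n x (a j) = evaluation n x (b j)) ->
    forall v w, evaluation n s v = evaluation n s w ->
      evaluation n x v = evaluation n x w.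
Proof.
pose B := [set a | exists2 b, evaluation n s b = evaluation n s a & lex n b a].
have [F finF [FB Fbase]] := dickson n B.
have /finite_seqP [r rF] := finF.
pose a (j : 'I_(size r)) := nth (fun=> 0)%N r j.
have /choice [b bP] : forall j, exists b,
    evaluation n s b = evaluation n s (a j) /\ lex n b (a j).
  move=> j; have [|b] := FB (a j); first by rewrite rF /= mem_nth.
  by exists b.
exists (size r), a, b; split=> [j|M x xab v w]; first by case: (bP j).
move=> svw; apply: contrapT => vw.
pose bad := [set u | exists2 u', evaluation n s u = evaluation n s u' &
  evaluation n x u <> evaluation n x u'].
(* a least vector [u] at which a relation fails, and a least partner [u'] of [u]:
   then [u'] is reducible, and reducing it gives a smaller partner *)
have [u [u0 su0 xu0] umin] := @lex_min n bad v (ex_intro2 _ _ w svw vw).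
have [u' [su' xu'] u'min] := @lex_min n
  [set u' | evaluation n s u = evaluation n s u' /\
            evaluation n x u <> evaluation n x u'] u0 (conj su0 xu0).
have uu' : lex n u u'.
  have [//|u'u|e] := lex_total n u u'.
    by case: (umin u' _ u'u); exists u => //; apply: nesym.
  by case: xu'; apply: evaluation_agree.
have [|c Fc cu'] := Fbase u'; first by exists u.
move: Fc; rewrite rF /= => /(nthP (fun=> 0)%N) [j0 j0r e].
have [sj lj] := bP (Ordinal j0r); have := xab (Ordinal j0r).
move: sj lj; rewrite /a /= e => sj lj xj.
pose d i := (u' i - c i)%N.
have du' : agree n (fun i => c i + d i)%N u' by move=> i /cu' ?; apply: subnKC.
refine (u'min (fun i => b (Ordinal j0r) i + d i)%N _ _).
  by split; rewrite evaluationD ?sj -?xj -evaluationD (evaluation_agree _ du').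
have [k [kn kl ke]] := @lex_add n _ _ d d (fun _ _ => erefl) lj.
exists k; split=> //; first by rewrite -(du' k kn).
by move=> i ik; rewrite ke// du'// (ltn_trans ik).
Qed.

(** * Open embeddings of locally monoidal spaces *)

Local Notation "g \ol f" := (@hcomp LMS _ _ _ g f) (at level 50, left associativity).

Lemma lms_comp_comap_at (X Y Z : lms) (g : lms_hom Y Z) (f : lms_hom X Y)
    (U : opens X) (V : opens Y) (W : opens Z)
    (UW : U `<=` lms_map (g \ol f) @^-1` W) (UV : U `<=` lms_map f @^-1` V)
    (VW : V `<=` lms_map g @^-1` W) s :
  comap (lms_comap (g \ol f)) UW s =
  comap (lms_comap f) UV (comap (lms_comap g) VW s).
Proof. exact: lms_comp_comapE. Qed.

Lemma comap_eq (X Y : lms) (f g : lms_hom X Y) (U : opens X) (V : opens Y)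
    (UV : U `<=` lms_map f @^-1` V) (UV' : U `<=` lms_map g @^-1` V) s :
  f = g -> comap (lms_comap f) UV s = comap (lms_comap g) UV' s.
Proof. by move=> fg; case: g / fg UV' => UV'; apply: comap_irr. Qed.

(** The universal property of an open subspace, for an arbitrary subset as in the
    definition of open embeddings of spaces; it is stable under composition and
    isomorphisms, unlike being a restriction. *)
Definition lms_represents (X V : lms) (U : set X) (j : lms_hom V X) : Prop :=
  range (lms_map j) `<=` U /\
  forall (T : lms) (g : lms_hom T X), range (lms_map g) `<=` U ->
    exists! h : lms_hom T V, j \ol h = g.

Lemma sheaf_sep (X : topologicalType) (M : sheaf X) (U : opens X) (s t : M U) :
  (forall x, oset U x -> exists V : opens X, oset V x /\
     exists VU : V `<=` U, res M VU s = res M VU t) -> s = t.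
Proof.
move=> st; pose I := {V : opens X & {VU : V `<=` U | res M VU s = res M VU t}}.
pose V (i : I) := projT1 i; pose VU (i : I) : V i `<=` U := sval (projT2 i).
have [|i k W Wi Wk|r [_ rU]] := @sheaf_glue _ M I U V VU _ (fun i => res M (VU i) s).
- move=> x /st [W [Wx [WU e]]].
  by exists (existT _ W (exist _ WU e)).
- by rewrite !res_trans; apply: res_irr.
by rewrite -(rU s)//; apply: rU => i; rewrite (svalP (projT2 i)).
Qed.

Section RepresentsCriterion.
Variables (X V : lms) (j : lms_hom V X) (U : opens X).
Hypothesis jU : is_open_inclusion (lms_map j) U.

Definition image_open (W : opens V) : opens X :=
  let: And3 _ _ jo := jU in Opens (jo W (openP W)).

Lemma image_openE W : oset (image_open W) = lms_map j @` W.
Proof. by rewrite /image_open; case: jU. Qed.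

Lemma image_open_sub (W : opens V) : W `<=` lms_map j @^-1` image_open W.
Proof. by move=> x Wx; rewrite /= image_openE; exists x. Qed.

Hypothesis jbij : forall W, bijective (comap (lms_comap j) (@image_open_sub W)).

Let inv W : \M_V W -> \M_X (image_open W) :=
  sval (cid (let: Bijective g gK jK := jbij W in ex_intro
    (fun g => cancel g (comap (lms_comap j) (@image_open_sub W))) g jK)).

Let invK W s : comap (lms_comap j) (@image_open_sub W) (@inv W s) = s.
Proof. by rewrite /inv; case: cid. Qed.

Let comapK W s : @inv W (comap (lms_comap j) (@image_open_sub W) s) = s.
Proof. by apply: (bij_inj (jbij W)); rewrite invK. Qed.

Section Lift.
Variables (T : lms) (g : lms_hom T X).
Hypothesis gU : range (lms_map g) `<=` U.

Let lift_ex t : exists v, lms_map j v = lms_map g t.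
Proof.
case: jU => _ jr _; have : oset U (lms_map g t) by apply: gU; exists t.
by rewrite -jr => -[v _ vE]; exists v.
Qed.

Let lift_fun t : V := sval (cid (lift_ex t)).

Let lift_funE t : lms_map j (lift_fun t) = lms_map g t.
Proof. by rewrite /lift_fun; case: cid. Qed.

Let lift_preimage (W : opens V) : lift_fun @^-1` W = lms_map g @^-1` image_open W.
Proof.
apply/seteqP; split=> t /=; rewrite image_openE -lift_funE.
  by move=> Wt; exists (lift_fun t).
by move=> [v Wv]; case: jU => inj _ _ /inj <-.
Qed.

Let lift_continuous : continuous lift_fun.
Proof.
apply/continuousP => W oW; rewrite (lift_preimage (Opens oW)).
by apply: (continuousP _).1; [exact: cts_fun | exact: openP].
Qed.

Let lift_map : continuousType T V := mkcts lift_continuous.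

Let lift_image (O : opens T) (W : opens V) :
  O `<=` lift_map @^-1` W -> O `<=` lms_map g @^-1` image_open W.
Proof. by rewrite -lift_preimage. Qed.

Let lift_comap (O : opens T) (W : opens V) (OW : O `<=` lift_map @^-1` W)
  (s : \M_V W) : \M_T O := comap (lms_comap g) (lift_image OW) (inv s).

Let invD W : nmod_morphism (@inv W).
Proof.
split=> [|s t]; apply: (bij_inj (jbij W)).
  by rewrite invK raddf0.
by rewrite raddfD /= !invK.
Qed.

Let lift_comap_additive (O : opens T) (W : opens V) (OW : O `<=` lift_map @^-1` W) :
  nmod_morphism (lift_comap OW).
Proof.
have [i0 iD] := invD W.
by split=> [|s t]; rewrite /lift_comap ?i0 ?iD ?raddf0 ?raddfD.
Qed.

Let lift_comap_res (O O' : opens T) (W W' : opens V) (OW : O `<=` lift_map @^-1` W)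
    (O'W' : O' `<=` lift_map @^-1` W') (O'O : O' `<=` O) (WW' : W `<=` W') s :
  lift_comap O'W' s = res \M_T O'O (lift_comap OW (res \M_V WW' s)).
Proof.
have iWW' : image_open W `<=` image_open W'.
  by rewrite !image_openE => _ [x /WW' Wx <-]; exists x.
rewrite /lift_comap (comap_res _ (lift_image OW) (lift_image O'W') O'O iWW').
congr (res _ _ (comap _ _ _)); apply: (bij_inj (jbij W)); rewrite invK.
have WiW' : W `<=` lms_map j @^-1` image_open W' by move=> x /WW' /image_open_sub.
rewrite (comap_resr _ _ WiW') -(comap_resl _ (@image_open_sub W') WiW' WW').
by rewrite invK.
Qed.

Let lift_comorphism : comorphism lift_map :=
  @Comorphism T V lift_map lift_comap lift_comap_additive lift_comap_res.

Let lift_local x : local_hom (stalk_map lift_comorphism (x := x)).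
Proof.
apply/local_germP => O W OW Ox Wx s u.
have /local_germP lg := lms_local g x.
have iWx : oset (image_open W) (lms_map g x) by apply: (lift_image OW).
have /germ_unitP [O' [O'x [O'W [t ut]]]] := lg _ _ (lift_image OW) Ox iWx (inv s) u.
pose W' := preopen (lms_map j) O'.
have W'W : W' `<=` W.
  move=> v /= /O'W; rewrite image_openE => -[v' Wv'].
  by case: jU => inj _ _ /inj <-.
apply/germ_unitP; exists W'; split; first by rewrite /= lift_funE.
exists W'W, (comap (lms_comap j) (@preopen_sub _ _ (lms_map j) O') t).
have W'i : W' `<=` lms_map j @^-1` image_open W by move=> v /W'W /image_open_sub.
rewrite -{1}[s]invK (comap_resl _ _ W'i).
by rewrite -(comap_resr _ (@preopen_sub _ _ (lms_map j) O') _ O'W) -raddfD ut raddf0.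
Qed.

Definition lms_lift : lms_hom T V := LmsHom lift_local.

Lemma lms_liftK : j \ol lms_lift = g.
Proof.
apply: lms_hom_ext => [t|O W OW OW' s]; first exact: lift_funE.
pose W' := preopen (lms_map j) W.
have OW'' : O `<=` lms_map lms_lift @^-1` W' by move=> t /OW.
rewrite (lms_comp_comap_at OW OW'' (@preopen_sub _ _ (lms_map j) W)) /= /lift_comap.
have iW : image_open W' `<=` W by rewrite image_openE => _ [v Wv <-].
rewrite -(comap_resr _ (@image_open_sub W') (@preopen_sub _ _ (lms_map j) W) iW).
by rewrite comapK (comap_resr _ _ OW').
Qed.

Lemma lms_lift_uniq h : j \ol h = g -> lms_lift = h.
Proof.
move=> jh; have e t : lms_map lms_lift t = lms_map h t.
  by case: jU => inj _ _; apply: inj; rewrite lift_funE -jh.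
apply: lms_hom_ext => // O W OW OW' s.
rewrite -[s in RHS]invK /= /lift_comap.
have Og : O `<=` lms_map (j \ol h) @^-1` image_open W.
  by move=> x /OW' /image_open_sub.
rewrite -(lms_comp_comap_at Og OW' (@image_open_sub W)).
exact/comap_eq/esym.
Qed.
End Lift.

(** The lift of a morphism [g] is forced: on points by injectivity of [j], and on
    sections because a section over [W] comes from a unique section over the image of
    [W], to which [g] applies. *)
Lemma lms_represents_crit : lms_represents U j.
Proof.
split=> [|T g gU]; first by case: jU => _ -> _.
by exists (lms_lift gU); split; [apply: lms_liftK | exact: lms_lift_uniq].
Qed.
End RepresentsCriterion.

Lemma restr_incl_inclusion (X : lms) (U : opens X) :
  is_open_inclusion (lms_map (restr_incl U : lms_hom _ _)) U.
Proof.
split=> [x y /val_inj//||W oW]; last exact: (openP (opens_image (Opens oW))).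
apply/seteqP; split=> [_ [x _ <-]|x Ux]; first exact: set_valP.
by exists (SigSub (mem_set Ux)).
Qed.

Lemma restr_represents (X : lms) (U : opens X) :
  lms_represents U (restr_incl U : lms_hom _ _).
Proof.
apply: (lms_represents_crit (jU := restr_incl_inclusion U)) => W.
have WW' : image_open (restr_incl_inclusion U) W `<=` opens_image W.
  by rewrite image_openE.
exists (res \M_X WW' : \M_X (opens_image W) -> _) => s; rewrite /= /restr_incl_comap.
  by rewrite res_trans res_id.
by rewrite res_trans res_id.
Qed.

Section Represents.
Variables (X V : lms) (U : set X) (j : lms_hom V X).
Hypothesis rj : lms_represents U j.

Lemma lms_represents_mono (T : lms) (a b : lms_hom T V) :
  j \ol a = j \ol b -> a = b.
Proof.
move=> ab; have [|c [_ cU]] := rj.2 T (j \ol a).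
  by move=> _ [x _ <-]; apply: rj.1; exists (lms_map a x).
by rewrite -(cU a erefl); apply: cU.
Qed.

Lemma lms_represents_iso (V' : lms) (j' : lms_hom V' X) : lms_represents U j' ->
  exists2 k : lms_hom V' V, is_iso (k : @hom LMS _ _) & j \ol k = j'.
Proof.
move=> rj'; have [k [jk _]] := rj.2 _ _ rj'.1; have [l [jl _]] := rj'.2 _ _ rj.1.
exists k => //; exists l; split; last first.
  by apply: lms_represents_mono; rewrite (@compA LMS) jk jl (@compm1 LMS).
have [m [_ mU]] := rj'.2 _ _ rj'.1.
rewrite -(mU (idm (V' : LMS))) ?(@compm1 LMS)//; apply/esym/mU.
by rewrite (@compA LMS) jl jk.
Qed.
End Represents.

Lemma lms_represents_comp_iso (X V V' : lms) (U : set X) (j : lms_hom V X)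
    (k : lms_hom V' V) :
  lms_represents U j -> is_iso (k : @hom LMS _ _) -> lms_represents U (j \ol k).
Proof.
move=> rj [l [lk kl]]; split=> [_ [x _ <-]|T g /rj.2 [h [jh hU]]].
  by apply: rj.1; exists (lms_map k x).
exists (l \ol h); split.
  by rewrite (@compA LMS) -[_ \ol l](@compA LMS) kl (@compm1 LMS).
move=> h' h'E; rewrite (hU (k \ol h')); last by rewrite (@compA LMS).
by rewrite (@compA LMS) lk (@comp1m LMS).
Qed.

Lemma lms_represents_inclusion (X V : lms) (U : opens X) (j : lms_hom V X) :
  lms_represents U j -> is_open_inclusion (lms_map j) U.
Proof.
move=> rj; have [k [l [lk kl]] jk] := lms_represents_iso (restr_represents U) rj.
have [inj rU op] := restr_incl_inclusion U.
have lkx x : lms_map l (lms_map k x) = x.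
  by change (lms_map (l \ol k) x = x); rewrite lk.
have klx x : lms_map k (lms_map l x) = x.
  by change (lms_map (k \ol l) x = x); rewrite kl.
have jE x : lms_map j x = lms_map (restr_incl U : lms_hom _ _) (lms_map k x).
  by rewrite -jk.
split=> [x y| |W oW].
- by rewrite !jE => /inj e; rewrite -(lkx x) e lkx.
- rewrite -rU; apply/seteqP; split=> _ [x _ <-]; rewrite ?jE; first by exists (lms_map k x).
  by exists (lms_map l x) => //; rewrite jE klx.
rewrite (_ : _ @` W = lms_map (restr_incl U : lms_hom _ _) @` (lms_map l @^-1` W)).
  by apply: op; apply: (continuousP _).1 => //; exact: cts_fun.
apply/seteqP; split=> [_ [x Wx <-]|_ [x Wx <-]].
  by exists (lms_map k x); rewrite /= ?lkx ?jE.
by exists (lms_map l x); rewrite // jE klx.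
Qed.

Lemma lms_represents_range (X V : lms) (U : opens X) (j : lms_hom V X) :
  lms_represents U j -> range (lms_map j) = U.
Proof. by move=> /lms_represents_inclusion []. Qed.

Lemma lms_open_embeddingP (X V : LMS) (j : hom V X) :
  lms_open_embedding j <-> exists U : opens (lms_space X), lms_represents U j.
Proof.
split=> [[U [g [ig ->]]]|[U rj]]; exists U.
  by apply: lms_represents_comp_iso => //; apply: restr_represents.
by have [g ig jg] := lms_represents_iso (restr_represents U) rj; exists g.
Qed.

Lemma lms_represents_comp (X V V' : lms) (U : opens X) (W : opens V)
    (j : lms_hom V X) (k : lms_hom V' V) :
  lms_represents U j -> lms_represents W k ->
  lms_represents (lms_map j @` W) (j \ol k).
Proof.
move=> rj rk; have [inj jU _] := lms_represents_inclusion rj.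
split=> [_ [x _ <-]|T g gW].
  by exists (lms_map k x) => //; apply: rk.1; exists x.
have [|h [jh hU]] := rj.2 _ g.
  by apply: subset_trans gW _; rewrite -jU; apply: image_subset.
have [|l [kl lU]] := rk.2 _ h.
  move=> _ [x _ <-]; have [w Ww] : (lms_map j @` W) (lms_map g x) by apply: gW; exists x.
  by rewrite -jh => /inj <-.
exists l; split; first by rewrite -(@compA LMS) kl.
by move=> l' l'E; apply: lU; apply/esym/hU; rewrite (@compA LMS).
Qed.

Lemma lms_is_iso_represents (X V : lms) (k : lms_hom V X) :
  is_iso (k : @hom LMS _ _) -> lms_represents (opensT X) k.
Proof.
move=> [l [lk kl]]; split=> // T g _; exists (l \ol g); split.
  by rewrite (@compA LMS) kl (@comp1m LMS).
by move=> h <-; rewrite (@compA LMS) lk (@comp1m LMS).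
Qed.

Section GlueMorphisms.
Variables (X Y : lms) (I : small) (U : I -> opens X).
Variable s : forall i, lms_hom (restr (U i)) Y.
Hypothesis Ucov : forall x, exists i, oset (U i) x.
Hypothesis compat : forall i k (T : lms) (a : lms_hom T (restr (U i)))
  (b : lms_hom T (restr (U k))),
  restr_incl (U i) \ol a = restr_incl (U k) \ol b -> s i \ol a = s k \ol b.

Let inc i : lms_hom (restr (U i)) X := restr_incl (U i).

(* The compatibility hypothesis, tested on an open subspace of the overlap. *)
Let overlap i k (W : opens X) (Wi : W `<=` U i) (Wk : W `<=` U k) :
  exists (a : lms_hom (restr W) (restr (U i))) (b : lms_hom (restr W) (restr (U k))),
    [/\ inc i \ol a = restr_incl W, inc k \ol b = restr_incl W & s i \ol a = s k \ol b].
Proof.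
have rW V : W `<=` V -> range (lms_map (restr_incl W : lms_hom _ _)) `<=` V.
  by move=> WV _ [x _ <-]; apply/WV/set_valP.
have [a [ia _]] := (restr_represents (U i)).2 _ _ (rW _ Wi).
have [b [kb _]] := (restr_represents (U k)).2 _ _ (rW _ Wk).
by exists a, b; split=> //; apply: compat; exact: etrans ia (esym kb).
Qed.

Let pt i x (Ux : oset (U i) x) : restr (U i) := SigSub (mem_set Ux).

Let pt_eq i k x (Ui : oset (U i) x) (Uk : oset (U k) x) :
  lms_map (s i) (pt Ui) = lms_map (s k) (pt Uk).
Proof.
have [a [b [ia kb /(congr1 (fun f : lms_hom _ _ => lms_map f))]]] :=
  overlap (@opensIl _ (U i) (U k)) (@opensIr _ (U i) (U k)).
have Wx : oset (opensI (U i) (U k)) x by [].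
pose x' : restr (opensI (U i) (U k)) := SigSub (mem_set Wx).
move=> /(congr1 (fun f : continuousType _ _ => f x')) /=.
rewrite (_ : pt Ui = lms_map a x'); last first.
  by apply: val_inj; change (val (pt Ui) = lms_map (inc i \ol a) x'); rewrite ia.
rewrite (_ : pt Uk = lms_map b x') //.
by apply: val_inj; change (val (pt Uk) = lms_map (inc k \ol b) x'); rewrite kb.
Qed.

Let glue_fun x : Y := lms_map (s (sval (cid (Ucov x)))) (pt (svalP (cid (Ucov x)))).

Let glue_funE i (y : restr (U i)) : glue_fun (val y) = lms_map (s i) y.
Proof.
rewrite /glue_fun; have Uy : oset (U i) (val y) by apply: set_valP.
by rewrite (pt_eq _ Uy); congr (lms_map _ _); apply: val_inj.
Qed.

Let glue_continuous : continuous glue_fun.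
Proof.
apply/continuousP => W oW.
rewrite (_ : _ @^-1` _ =
  \bigcup_i opens_image (preopen (lms_map (s i)) (Opens oW))).
  by apply: bigcup_open => i _; apply: openP.
apply/seteqP; split=> [x Wx|_ [i _ [y Wy <-]]]; last by rewrite /= glue_funE.
have [i Ux] := Ucov x; exists i => //; exists (pt Ux) => //.
by rewrite /= -glue_funE.
Qed.

Let glue_map : continuousType X Y := mkcts glue_continuous.

Let part (O : opens X) i : opens (restr (U i)) := preopen (lms_map (inc i)) O.

Let part_sub (O : opens X) (W : opens Y) (OW : O `<=` glue_map @^-1` W) i :
  part O i `<=` lms_map (s i) @^-1` W.
Proof. by move=> y /OW Wy; rewrite /= -glue_funE. Qed.

Let at_part (O : opens X) i (r : \M_X O) : \M_(restr (U i)) (part O i) :=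
  comap (lms_comap (inc i)) (@preopen_sub _ _ _ O) r.

Let at_part_inj (O : opens X) (r r' : \M_X O) : (forall i, at_part i r = at_part i r') -> r = r'.
Proof.
move=> e; apply: sheaf_sep => x Ox; have [i Ux] := Ucov x.
exists (opens_image (part O i)); split; first by exists (pt Ux).
by exists (opens_image_sub (@preopen_sub _ _ (incl_cts (U i)) O)); apply: e.
Qed.

(* The unique section restricting to the given ones; additivity and compatibility
   with restrictions follow from uniqueness. *)
Let comap_ex (O : opens X) (W : opens Y) (OW : O `<=` glue_map @^-1` W)
  (t : \M_Y W) : exists! r : \M_X O,
  forall i, at_part i r = comap (lms_comap (s i)) (part_sub OW (i := i)) t.
Proof.
suff [r rE] : exists r : \M_X O,
    forall i, at_part i r = comap (lms_comap (s i)) (part_sub OW (i := i)) t.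
  by exists r; split=> // r' r'E; apply: at_part_inj => i; rewrite rE r'E.
have partO i : opens_image (part O i) `<=` O by move=> _ [x Ox <-].
have [x Ox|i k Z Zi Zk|r [rE _]] := @sheaf_glue _ \M_X I O
  (fun i => opens_image (part O i)) partO _
  (fun i => comap (lms_comap (s i)) (part_sub OW (i := i)) t).
- by have [i Ux] := Ucov x; exists i => //; exists (pt Ux).
- have ZU l : Z `<=` opens_image (part O l) -> Z `<=` U l.
    by move=> Zl _ /Zl [y _ <-]; apply: set_valP.
  have [a [b [ia kb sab]]] := overlap (ZU _ Zi) (ZU _ Zk).
  have key l (Zl : Z `<=` opens_image (part O l)) (c : lms_hom (restr Z) (restr (U l)))
      (lc : inc l \ol c = restr_incl Z) (q : \M_X (opens_image (part O l)))
      (cl : opensT _ `<=` lms_map c @^-1` part O l) :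
      comap (lms_comap c) cl q =
      comap (lms_comap (restr_incl Z : lms_hom _ _))
        (fun x _ => set_valP x : oset Z _) (res \M_X Zl q).
    pose O' := opens_image (part O l).
    have cO' : opensT _ `<=` lms_map (inc l \ol c) @^-1` O'.
      by move=> y _; exists (lms_map c y); first exact: cl.
    have lO' : part O l `<=` lms_map (inc l) @^-1` O' by move=> y Oy; exists y.
    transitivity (comap (lms_comap (inc l \ol c)) cO' q).
      rewrite (lms_comp_comap_at cO' cl lO').
      suff -> : comap (lms_comap (inc l)) lO' q = q by [].
      exact: (@res_id _ \M_X (opens_image (part O l))).
    have iO' : opensT _ `<=` lms_map (restr_incl Z : lms_hom _ _) @^-1` O'.
      by move=> y _; apply: Zl; apply: set_valP.
    rewrite (comap_resr _ _ iO'); exact: comap_eq.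
  have cl l (Zl : Z `<=` opens_image (part O l)) (c : lms_hom (restr Z) (restr (U l)))
      (lc : inc l \ol c = restr_incl Z) : opensT _ `<=` lms_map c @^-1` part O l.
    move=> y _; have : oset (opens_image (part O l)) (val y) by apply/Zl/set_valP.
    move=> [z Oz /= zy]; suff -> : lms_map c y = z by [].
    by apply: val_inj; rewrite [RHS]zy; change (lms_map (inc l \ol c) y = val y); rewrite lc.
  have inj (q q' : \M_X Z) :
      comap (lms_comap (restr_incl Z : lms_hom _ _))
        ((fun x _ => set_valP x) : opensT _ `<=` _ @^-1` Z) q =
      comap (lms_comap (restr_incl Z : lms_hom _ _)) (fun x _ => set_valP x) q' -> q = q'.
    rewrite /= /restr_incl_comap => e; apply: sheaf_sep => x Zx.
    exists (opens_image (opensT (restr Z))); split; last by eexists; exact: e.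
    by exists (SigSub (mem_set Zx)).
  apply: inj; rewrite -(key _ Zi a ia _ (cl _ Zi a ia)) -(key _ Zk b kb _ (cl _ Zk b kb)).
  have aW : opensT _ `<=` lms_map (s i \ol a) @^-1` W.
    by move=> y /(cl _ Zi a ia) /(part_sub OW).
  have bW : opensT _ `<=` lms_map (s k \ol b) @^-1` W.
    by move=> y /(cl _ Zk b kb) /(part_sub OW).
  rewrite -(lms_comp_comap_at aW) -(lms_comp_comap_at bW); exact: comap_eq.
exists r => i; rewrite -rE /at_part /= /restr_incl_comap; exact: res_irr.
Qed.

Let glue_comap (O : opens X) (W : opens Y) (OW : O `<=` glue_map @^-1` W)
  (t : \M_Y W) : \M_X O := sval (cid (comap_ex OW t)).

Let glue_comapE (O : opens X) (W : opens Y) (OW : O `<=` glue_map @^-1` W) t i :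
  at_part i (glue_comap OW t) = comap (lms_comap (s i)) (part_sub OW (i := i)) t.
Proof. by rewrite /glue_comap; case: cid => r []. Qed.

Let glue_comap_additive (O : opens X) (W : opens Y) (OW : O `<=` glue_map @^-1` W) :
  nmod_morphism (glue_comap OW).
Proof.
split=> [|t t']; apply: at_part_inj => i; rewrite glue_comapE.
  by rewrite raddf0 /at_part raddf0.
rewrite /at_part [LHS]raddfD [RHS]raddfD.
by congr (_ + _); exact: esym (glue_comapE _ _ _).
Qed.

Let glue_comap_res (O O' : opens X) (W W' : opens Y) (OW : O `<=` glue_map @^-1` W)
    (O'W' : O' `<=` glue_map @^-1` W') (O'O : O' `<=` O) (WW' : W `<=` W') t :
  glue_comap O'W' t = res \M_X O'O (glue_comap OW (res \M_Y WW' t)).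
Proof.
apply: at_part_inj => i; rewrite glue_comapE /at_part.
have pO'O : part O' i `<=` part O i by move=> y /O'O.
have pO : part O' i `<=` lms_map (inc i) @^-1` O by move=> y /O'O.
rewrite (comap_resr _ _ pO) -(comap_resl _ (@preopen_sub _ _ _ O) _ pO'O).
rewrite -/(at_part _ _) glue_comapE; exact: comap_res.
Qed.

Let glue_comorphism : comorphism glue_map :=
  @Comorphism X Y glue_map glue_comap glue_comap_additive glue_comap_res.

Let glue_local x : local_hom (stalk_map glue_comorphism (x := x)).
Proof.
apply/local_germP => O W OW Ox Wx t /germ_unitP [O' [O'x [O'O [r u]]]].
have [i Ux] := Ucov x; have /local_germP ls := lms_local (s i) (pt Ux).
have Wy : oset W (lms_map (s i) (pt Ux)) by rewrite -glue_funE.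
suff u' : munit (germ Wy t).
  have [V [Vy [VW u'']]] := (germ_unitP Wy t).1 u'.
  apply/germ_unitP; exists V; split.
    by change (oset V (glue_fun (val (pt Ux)))); rewrite glue_funE.
  by exists VW.
apply: (ls (part O i) W (part_sub OW (i := i)) Ox); apply/germ_unitP.
have pO'O : part O' i `<=` part O i by move=> y /O'O.
exists (part O' i); split=> //; exists pO'O, (at_part i r).
have pO : part O' i `<=` lms_map (inc i) @^-1` O by move=> y /O'O.
rewrite -glue_comapE /at_part (comap_resl _ _ pO) -(comap_resr _ (@preopen_sub _ _ _ O') _ O'O).
by rewrite -raddfD u raddf0.
Qed.

Definition glued_hom : lms_hom X Y := LmsHom glue_local.

Lemma glued_homE i : glued_hom \ol restr_incl (U i) = s i.
Proof.
apply: lms_hom_ext => [y|O W OW OW' t]; first exact: glue_funE.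
pose O' := preopen glue_map W.
have OO' : O `<=` lms_map (inc i) @^-1` O' by move=> y /OW.
rewrite (lms_comp_comap_at OW OO' (@preopen_sub _ _ _ W)).
have Op : O `<=` part O' i by [].
rewrite -(comap_resl _ (@preopen_sub _ _ (lms_map (inc i)) O') _ Op).
by rewrite -/(at_part _ _) [at_part _ _]glue_comapE (comap_resl _ _ OW').
Qed.
End GlueMorphisms.

Section Gluing.
Variables (X Y : lms) (I : small) (U : I -> opens X) (V : I -> lms).
Variable j : forall i, lms_hom (V i) X.
Hypothesis rj : forall i, lms_represents (U i) (j i).
Hypothesis Ucov : forall x, exists i, oset (U i) x.

Lemma lms_local_eq (t t' : lms_hom X Y) :
  (forall i, t \ol j i = t' \ol j i) -> t = t'.
Proof.
move=> tt'; pose inc i : lms_hom (restr (U i)) X := restr_incl (U i).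
have {}tt' i : t \ol inc i = t' \ol inc i.
  have [k _ jk] := lms_represents_iso (rj i) (restr_represents (U i)).
  by rewrite /inc -jk !(@compA LMS) tt'.
apply: lms_hom_ext => [x|O W OW OW' s].
  have [i Ux] := Ucov x; pose y : restr (U i) := SigSub (mem_set Ux).
  by change (lms_map (t \ol inc i) y = lms_map (t' \ol inc i) y); rewrite tt'.
apply: sheaf_sep => x Ox; have [i Ux] := Ucov x.
pose O' := preopen (lms_map (inc i)) O.
exists (opens_image O'); split; first by exists (SigSub (mem_set Ux)).
exists (opens_image_sub (@preopen_sub _ _ (incl_cts (U i)) O)).
have O'W : O' `<=` lms_map (t \ol inc i) @^-1` W by move=> y /OW.
have O'W' : O' `<=` lms_map (t' \ol inc i) @^-1` W by move=> y /OW'.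
have := comap_eq O'W O'W' s (tt' i).
by rewrite (lms_comp_comap_at O'W (@preopen_sub _ _ _ O) OW)
           (lms_comp_comap_at O'W' (@preopen_sub _ _ _ O) OW').
Qed.

(** Compatibility is tested on morphisms from arbitrary objects instead of
    intersections of the cover, so that the statement is invariant under isomorphism
    and applies to open embeddings coming from elsewhere. *)
Lemma lms_glue (s : forall i, lms_hom (V i) Y) :
  (forall i k (T : lms) (a : lms_hom T (V i)) (b : lms_hom T (V k)),
     j i \ol a = j k \ol b -> s i \ol a = s k \ol b) ->
  exists! t : lms_hom X Y, forall i, t \ol j i = s i.
Proof.
move=> compat.
have ex i : exists k : lms_hom (restr (U i)) (V i),
    is_iso (k : @hom LMS _ _) /\ j i \ol k = restr_incl (U i).
  by have [k] := lms_represents_iso (rj i) (restr_represents (U i)); exists k.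
pose k i := sval (cid (ex i)).
have kP i : is_iso (k i : @hom LMS _ _) /\ j i \ol k i = restr_incl (U i).
  exact: svalP (cid (ex i)).
have compat' i l (T : lms) (a : lms_hom T (restr (U i))) (b : lms_hom T (restr (U l))) :
    restr_incl (U i) \ol a = restr_incl (U l) \ol b ->
    (s i \ol k i) \ol a = (s l \ol k l) \ol b.
  have [_ <-] := kP i; have [_ <-] := kP l; rewrite -!(@compA LMS); exact: compat.
pose t := @glued_hom X Y I U (fun i => s i \ol k i) Ucov compat'.
exists t; split=> [i|t' t'E].
  have [[l [_ kl]] jk] := kP i.
  have := glued_homE (s := fun i => s i \ol k i) Ucov compat' i.
  move=> /(congr1 (fun f => f \ol l)).
  by rewrite -jk -!(@compA LMS) kl !(@compm1 LMS).
apply: lms_local_eq => i; rewrite t'E.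
have [[l [_ kl]] jk] := kP i.
have := glued_homE (s := fun i => s i \ol k i) Ucov compat' i.
move=> /(congr1 (fun f => f \ol l)).
by rewrite -jk -!(@compA LMS) kl !(@compm1 LMS).
Qed.
End Gluing.

Lemma lms_hom_empty (X Y : lms) (f g : lms_hom X Y) : (X -> False) -> f = g.
Proof.
move=> X0; apply: lms_hom_ext => [x|U V UV UV' s]; first by case: (X0 x).
by apply: sheaf_sep => x; case: (X0 x).
Qed.

(** * Morphisms to the spectrum of a monoid *)

Lemma munitD (P : nmodType) (p q : P) : munit (p + q) <-> munit p /\ munit q.
Proof.
split=> [[r pqr]|[[p' pp'] [q' qq']]].
  split; first by exists (q + r); rewrite addrA.
  by exists (p + r); rewrite addrA (addrC q).
by exists (p' + q'); rewrite addrACA pp' qq' addr0.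
Qed.

Lemma munit_inj (P : nmodType) (u a b : P) : munit u -> a + u = b + u -> a = b.
Proof.
by move=> [v uv] /(congr1 (fun c => c + v)); rewrite -!addrA uv !addr0.
Qed.

Lemma lfrac_eqP (P : nmodType) (S : submonoid P) (a b a' b' : P)
    (Sb : sm_set S b) (Sb' : sm_set S b') :
  lfrac a Sb = lfrac a' Sb' <-> exists2 t, sm_set S t & t + (a + b') = t + (a' + b).
Proof. exact: mclassP. Qed.

Lemma open_local (X : topologicalType) (A : set X) :
  (forall x, A x -> exists V : opens X, oset V x /\ V `<=` A) -> open A.
Proof.
move=> Aloc; pose D := [set V : opens X | V `<=` A].
rewrite (_ : A = \bigcup_(V in D) V); first by apply: bigcup_open => V _; exact: openP.
apply/seteqP; split=> [x /Aloc [V [Vx VA]]|x [V VA Vx]]; first by exists V.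
exact: VA.
Qed.

Section Germs.
Variables (X : topologicalType) (M : sheaf X).

Lemma germ_irr (x : X) (U : opens X) (h h' : oset U x) (s : M U) : germ h s = germ h' s.
Proof. by rewrite (Prop_irrelevance h h'). Qed.

Lemma germ_additive (x : X) (U : opens X) (Ux : oset U x) :
  nmod_morphism (@germ X M x U Ux).
Proof.
split=> [|s t].
  apply/germP; exists U; split=> //; exists (fun _ k => k), (fun _ _ => I).
  by rewrite !raddf0.
rewrite [RHS]mclassD; apply/germP; exists U; split=> //.
exists (fun _ k => k), (fun _ k => conj k k).
by rewrite /= !raddfD /= !res_trans; congr (_ + _); apply: res_irr.
Qed.

Lemma germ0 (x : X) (U : opens X) (Ux : oset U x) : germ Ux (0 : M U) = 0.
Proof. by case: (germ_additive Ux). Qed.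

Lemma germD (x : X) (U : opens X) (Ux : oset U x) (s t : M U) :
  germ Ux (s + t) = germ Ux s + germ Ux t.
Proof. by case: (germ_additive Ux). Qed.

Lemma germ_sep (U : opens X) (s t : M U) :
  (forall x (Ux : oset U x), germ Ux s = germ Ux t) -> s = t.
Proof.
move=> st; apply: sheaf_sep => x Ux; have /germP [W [Wx [WU [WU' e]]]] := st x Ux.
by exists W; split=> //; exists WU; rewrite e; apply: res_irr.
Qed.
End Germs.

Section GlobalSections.

Definition Gamma (X : lms) : nmodType := \M_X (opensT X).

Definition Gamma_map (X Y : lms) (f : lms_hom X Y) : Gamma Y -> Gamma X :=
  @comap _ _ _ (lms_comap f) (opensT X) (opensT Y) (fun _ _ => I).

Lemma Gamma_map_additive (X Y : lms) (f : lms_hom X Y) : nmod_morphism (Gamma_map f).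
Proof. exact: comap_additive. Qed.

Lemma Gamma_map_comp (X Y Z : lms) (g : lms_hom Y Z) (f : lms_hom X Y) s :
  Gamma_map (g \ol f) s = Gamma_map f (Gamma_map g s).
Proof. exact: lms_comp_comap_at. Qed.

Definition stalk_of (X : lms) (x : X) : Gamma X -> stalk \M_X x := germ (I : oset (opensT X) x).

(** Comorphisms preserve units, and locality reflects them. *)
Lemma stalk_of_unit (X Y : lms) (f : lms_hom X Y) (x : X) (s : Gamma Y) :
  munit (stalk_of x (Gamma_map f s)) <-> munit (stalk_of (lms_map f x) s).
Proof.
split=> [u|/germ_unitP [V [Vfx [VT [r u]]]]].
  by have /local_germP lf := lms_local f x; apply: lf u.
apply/germ_unitP; exists (preopen (lms_map f) V); split=> //.
exists (fun _ _ => I), (comap (lms_comap f) (@preopen_sub _ _ (lms_map f) V) r).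
have VT' : preopen (lms_map f) V `<=` lms_map f @^-1` opensT Y by [].
rewrite /Gamma_map (comap_resl _ _ VT').
by rewrite -(comap_resr _ (@preopen_sub _ _ (lms_map f) V) _ VT) -raddfD u raddf0.
Qed.

Definition unit_locus (X : lms) (s : Gamma X) : set X :=
  [set x | munit (stalk_of x s)].

Lemma unit_locus_open (X : lms) (s : Gamma X) : open (unit_locus s).
Proof.
apply: open_local => x /germ_unitP [V [Vx [VT u]]]; exists V; split=> // y Vy.
by apply/germ_unitP; exists V; split=> //; exists VT.
Qed.

End GlobalSections.

Section SpecSections.
Variable P : nmodType.

Lemma prime_ext (x y : prime_ideal P) : (forall p, pr x p <-> pr y p) -> x = y.
Proof.
case: x y => [x xi x0 xD] [y yi y0 yD] /= xy.
have e : x = y by apply/seteqP; split=> p /xy.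
case: y / e yi y0 yD {xy} => yi y0 yD.
by congr PrimeIdeal; apply: Prop_irrelevance.
Qed.

Lemma open_basic (p : P) : open (basic_open p).
Proof. by change (spec_open (basic_open p)) => x px; exists p; split. Qed.

Definition basic (p : P) : opens (spec_space P) := Opens (@open_basic p).

Lemma spec_elt_loc (p : P) :
  @locally_fraction P (opensT _) (fun x _ => @lfrac P (pr_compl x) p 0 (@pr_0 _ x)).
Proof. by move=> x _; exists (opensT _), p, 0; split=> // y _ _; exists (@pr_0 _ y). Qed.

Definition spec_elt (p : P) : Gamma (Spec P) := SpecSect (spec_elt_loc p).

Lemma spec_elt_additive : nmod_morphism spec_elt.
Proof.
split=> [|p q]; apply: spec_sect_ext => x _ /=.
  by apply/lfrac_eqP; exists 0 => //=; apply: pr_0.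
rewrite lfracD => [|k]; first by apply: pr_D; apply: pr_0.
by apply/lfrac_eqP; exists 0; rewrite /= ?add0r ?addr0 //; apply: pr_0.
Qed.

(** If [p] were in [x] and invertible near [x], then clearing denominators would put
    an element of the complement of [x] into [x]; conversely the inverse of [p] is
    [0 / p] on the basic open set of [p]. *)
Lemma spec_elt_unit (x : Spec P : lms) (p : P) :
  munit (stalk_of x (spec_elt p)) <-> ~ pr x p.
Proof.
split=> [/germ_unitP [V [Vx [VT [t /(congr1 (fun s => ss_val s Vx)) /=]]]]|np].
  rewrite -(mreprK (ss_val t Vx)); case: (mrepr _) => a [b nb].
  rewrite [LHS]lfracD => [|k]; first by apply: pr_D => //; apply: pr_0.
  move=> /lfrac_eqP [c nc /=]; rewrite !add0r addr0 => e px.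
  by case: (pr_D nc nb); rewrite -e addrCA; apply: pr_ideal.
apply/germ_unitP; exists (basic p); split=> //; exists (fun _ _ => I).
have loc : @locally_fraction P (basic p) (fun x nx => @lfrac P (pr_compl x) 0 p nx).
  move=> y ny; exists (basic p), 0, p; split=> // z nz _; by exists nz.
exists (SpecSect loc); apply: spec_sect_ext => y ny /=.
rewrite lfracD => [|k]; first by rewrite /= add0r.
by apply/lfrac_eqP; exists 0; rewrite /= ?add0r ?addr0 //; apply: pr_0.
Qed.
End SpecSections.

Section SpecMaps.
Variables (X : lms) (P : nmodType).

(** The transpose of [f] under the adjunction between spectra and global sections. *)
Definition spec_dual (f : lms_hom X (Spec P)) : P -> Gamma X :=
  Gamma_map f \o @spec_elt P.

Lemma spec_dual_additive f : nmod_morphism (spec_dual f).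
Proof.
have [f0 fD] := Gamma_map_additive f; have [e0 eD] := spec_elt_additive P.
by split=> [|p q]; rewrite /spec_dual /= ?e0 ?eD.
Qed.

(** The point map of a morphism is determined by its transpose, by locality. *)
Lemma spec_dual_pr (f : lms_hom X (Spec P)) x p :
  pr (lms_map f x : prime_ideal P) p <-> ~ munit (stalk_of x (spec_dual f p)).
Proof.
split=> [fp|nu]; first by rewrite stalk_of_unit spec_elt_unit; apply.
by apply: contrapT => np; apply: nu; rewrite stalk_of_unit spec_elt_unit.
Qed.

Section Germs.
Variable phi : P -> Gamma X.
Hypothesis phiA : nmod_morphism phi.

Let ger x p : stalk \M_X x := stalk_of x (phi p).

Let ger_additive x : nmod_morphism (@ger x).
Proof.
have [p0 pD] := phiA; have [g0 gD] := @germ_additive _ \M_X x (opensT X) I.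
by split=> [|p q]; rewrite /ger /stalk_of ?p0 ?pD.
Qed.

(** What the image of a section under the morphism to be constructed from [phi] has to
    satisfy; as denominators become units, the equation determines the germs of
    [t]. *)
Definition spec_image (f : X -> spec_space P) (U : opens X) (W : opens (spec_space P))
    (s : spec_sect W) (t : \M_X U) : Prop :=
  forall x (Ux : oset U x) (Wfx : oset W (f x)), exists (a b : P) (nb : ~ pr (f x) b),
    ss_val s Wfx = @lfrac P (pr_compl (f x)) a b nb /\
    germ Ux t + ger x b = ger x a.

Variable f : X -> spec_space P.
Hypothesis f_unit : forall x p, ~ pr (f x) p -> munit (ger x p).

Lemma spec_image_frac (U : opens X) (W : opens (spec_space P)) (s : spec_sect W)
    (t : \M_X U) x (Ux : oset U x) (Wfx : oset W (f x)) a b (nb : ~ pr (f x) b) :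
  spec_image f s t -> ss_val s Wfx = @lfrac P (pr_compl (f x)) a b nb ->
  germ Ux t + ger x b = ger x a.
Proof.
move=> st sab; have [a' [b' [nb' [sab' e]]]] := st x Ux Wfx.
move: sab'; rewrite sab => /lfrac_eqP [c nc ce].
have [_ gD] := ger_additive x.
apply: (@munit_inj _ (ger x (c + b'))); first by apply: f_unit; apply: pr_D.
have := congr1 (ger x) ce; rewrite /= !gD => ce'.
rewrite [RHS]addrCA ce' -e !addrA.
by rewrite [LHS](ACl (3*1*4*2))%AC.
Qed.

Lemma spec_image_uniq (U : opens X) (W : opens (spec_space P)) (s : spec_sect W)
    (t t' : \M_X U) : U `<=` f @^-1` W ->
  spec_image f s t -> spec_image f s t' -> t = t'.
Proof.
move=> UW st st'; apply: germ_sep => x Ux.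
have [a [b [nb [sab e]]]] := st x Ux (UW x Ux).
apply: (@munit_inj _ (ger x b)); first exact: f_unit.
by rewrite e (spec_image_frac Ux st' sab).
Qed.

Lemma spec_image_res (U U' : opens X) (W W' : opens (spec_space P)) (U'U : U' `<=` U)
    (WW' : W `<=` W') (UW : U `<=` f @^-1` W) (s : spec_sect W') (t : \M_X U) :
  spec_image f (res (\M_(Spec P)) WW' s) t -> spec_image f s (res \M_X U'U t).
Proof.
move=> st x U'x W'fx.
have [a [b [nb [sab e]]]] := st x (U'U x U'x) (UW _ (U'U x U'x)).
exists a, b, nb; split; last by rewrite germ_res.
by rewrite -sab /=; apply: ss_val_irr.
Qed.

Hypothesis f_cts : continuous f.

(** A fraction [a / b] near [f x] gives the section [phi a - phi b] near [x]; these local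
    solutions agree by uniqueness and are glued. *)
Lemma spec_image_ex (U : opens X) (W : opens (spec_space P)) (UW : U `<=` f @^-1` W)
  (s : spec_sect W) : exists t : \M_X U, spec_image f s t.
Proof.
have loc x : oset U x -> exists V : opens X, oset V x /\ exists (VU : V `<=` U)
    (t : \M_X V), spec_image f s t.
  move=> Ux; have [W' [a [b [W'fx W'W sab]]]] := ss_loc s (UW x Ux).
  have [nb _] := sab _ (UW x Ux) W'fx.
  have /germ_unitP [V' [V'x [V'T [v bv]]]] := f_unit nb.
  have oW' : open (f @^-1` W') by apply: (continuousP _).1 => //; apply: openP.
  pose V := opensI (opensI U (Opens oW')) V'.
  have VT : V `<=` opensT X by [].
  have VV' : V `<=` V' by move=> y [].
  exists V; split; first by do !split.
  have VU : V `<=` U by move=> y [[]].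
  exists VU, (res \M_X VT (phi a) + res \M_X VV' v).
  move=> y Vy Wfy; have [[_ W'fy] _] := Vy; have [nb' e] := sab _ Wfy W'fy.
  exists a, b, nb'; split=> //.
  have [_ gD] := @germ_additive _ \M_X y V Vy.
  rewrite gD germ_res (germ_irr _ (I : oset (opensT X) y)) -addrA -[RHS]addr0; congr (_ + _).
  rewrite /ger /stalk_of (germ_irr _ (VT y Vy)) -germ_res -gD addrC.
  have -> : res \M_X VT (phi b) = res \M_X VV' (res \M_X V'T (phi b)).
    by rewrite res_trans; apply: res_irr.
  by rewrite -raddfD bv raddf0 germ0.
pose I := {V : opens X & {VU : V `<=` U & {t : \M_X V | spec_image f s t}}}.
pose V (i : I) := projT1 i; pose VU (i : I) : V i `<=` U := projT1 (projT2 i).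
pose T (i : I) : \M_X (V i) := sval (projT2 (projT2 i)).
have TP (i : I) : spec_image f s (T i) := svalP (projT2 (projT2 i)).
have WW : W `<=` W by [].
have sW : s = res (\M_(Spec P)) WW s by rewrite [RHS]res_id.
have [x Ux|i k Z Zi Zk|t [tT _]] := @sheaf_glue _ \M_X I U V VU _ T.
- have [Vx [Vxx [VxU [t st]]]] := loc x Ux.
  by exists (existT _ Vx (existT _ VxU (exist _ t st))).
- have ZW : Z `<=` f @^-1` W by move=> y /Zi /VU /UW.
  apply: (spec_image_uniq (s := s) ZW).
    by apply: (@spec_image_res _ _ _ _ _ WW) => [y /VU /UW//|]; rewrite -sW.
  by apply: (@spec_image_res _ _ _ _ _ WW) => [y /VU /UW//|]; rewrite -sW.
exists t => x Ux Wfx; have [V' [V'x [V'U [t' st']]]] := loc x Ux.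
pose i : I := existT _ V' (existT _ V'U (exist _ t' st')).
have [a [b [nb [sab e]]]] := TP i x V'x Wfx.
exists a, b, nb; split=> //; rewrite -e -(tT i) germ_res; congr (_ + _).
exact: germ_irr.
Qed.
End Germs.

Section SpecMapOf.
Variable phi : P -> Gamma X.
Hypothesis phiA : nmod_morphism phi.

Let ger x p : stalk \M_X x := stalk_of x (phi p).

Let gerA x : nmod_morphism (@ger x).
Proof.
have [p0 pD] := phiA; have [g0 gD] := @germ_additive _ \M_X x (opensT X) I.
by split=> [|p q]; rewrite /ger /stalk_of ?p0 ?pD.
Qed.

(* The elements of [P] that do not become invertible at [x] form a prime ideal. *)
Let spec_point_ideal x p q : ~ munit (ger x p) -> ~ munit (ger x (p + q)).
Proof. by rewrite (gerA x).2 munitD => np []. Qed.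

Let spec_point_0 x : ~ ~ munit (ger x 0).
Proof. by rewrite (gerA x).1; apply; exists 0; rewrite addr0. Qed.

Let spec_point_D x p q : ~ ~ munit (ger x p) -> ~ ~ munit (ger x q) ->
  ~ ~ munit (ger x (p + q)).
Proof. by rewrite (gerA x).2 munitD => /contrapT up /contrapT uq; apply. Qed.

Let spec_point (x : X) : spec_space P := @PrimeIdeal P
  [set p | ~ munit (ger x p)] (@spec_point_ideal x) (@spec_point_0 x) (@spec_point_D x).

Let spec_point_unit x p : ~ pr (spec_point x) p -> munit (ger x p).
Proof. by move=> /contrapT. Qed.

Let spec_point_cts : continuous spec_point.
Proof.
apply/continuousP => W oW; apply: open_local => x Wx.
have : spec_open W := oW; move=> /(_ _ Wx) [p [px pW]].
exists (Opens (unit_locus_open (phi p))); split; first exact: spec_point_unit.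
by move=> y /= uy; apply: pW => /=; apply.
Qed.

Let spec_map : continuousType X (spec_space P) := mkcts spec_point_cts.

Let spec_comap (U : opens X) (W : opens (spec_space P)) (UW : U `<=` spec_map @^-1` W)
  (s : \M_(Spec P) W) : \M_X U :=
  sval (cid (spec_image_ex phiA spec_point_unit spec_point_cts UW s)).

Let spec_comapP (U : opens X) (W : opens (spec_space P)) (UW : U `<=` spec_map @^-1` W) s :
  spec_image phi spec_map s (spec_comap UW s).
Proof. by rewrite /spec_comap; case: cid. Qed.

Let spec_comapE (U : opens X) (W : opens (spec_space P)) (UW : U `<=` spec_map @^-1` W) s t :
  spec_image phi spec_map s t -> spec_comap UW s = t.
Proof.
by apply: spec_image_uniq => //; exact: spec_comapP.
Qed.

Let spec_comap_additive (U : opens X) (W : opens (spec_space P))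
  (UW : U `<=` spec_map @^-1` W) : nmod_morphism (spec_comap UW).
Proof.
split=> [|s t]; apply: spec_comapE => x Ux Wfx.
  exists 0, 0, (@pr_0 _ _); split=> //.
  by rewrite germ0 add0r.
have [a [b [nb [sab e]]]] := spec_comapP UW s Ux Wfx.
have [a' [b' [nb' [tab e']]]] := spec_comapP UW t Ux Wfx.
have nbb' : ~ pr (spec_map x) (b + b') by apply: pr_D.
exists (a + a'), (b + b'), nbb'; split.
  by rewrite [LHS]/= sab tab; apply: lfracD.
have gD p q : stalk_of x (phi (p + q)) = stalk_of x (phi p) + stalk_of x (phi q).
  exact: (gerA x).2.
by rewrite germD !gD -e -e'; apply: addrACA.
Qed.

Let spec_comap_res (U U' : opens X) (W W' : opens (spec_space P))
    (UW : U `<=` spec_map @^-1` W) (U'W' : U' `<=` spec_map @^-1` W')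
    (U'U : U' `<=` U) (WW' : W `<=` W') s :
  spec_comap U'W' s = res \M_X U'U (spec_comap UW (res \M_(Spec P) WW' s)).
Proof.
apply: spec_comapE; apply: (@spec_image_res _ _ _ _ _ _ _ WW') => //.
Qed.

Let spec_comorphism : @comorphism X (Spec P) spec_map :=
  @Comorphism X (Spec P) spec_map spec_comap spec_comap_additive spec_comap_res.

Let spec_local x : local_hom (stalk_map spec_comorphism (x := x)).
Proof.
apply/local_germP => U W UW Ux Wfx s u.
have [V [a [b [Vfx VW sab]]]] := ss_loc s Wfx.
have [nb sfx] := sab _ Wfx Vfx.
have := spec_image_frac phiA spec_point_unit Ux (spec_comapP UW s) sfx.
rewrite -/(ger x _) -/(ger x _) => e.
have na : ~ pr (spec_map x) a.
  by apply; rewrite -/(ger x _) -e munitD; split=> //; apply: spec_point_unit.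
apply/germ_unitP; pose V' := opensI (opensI V (basic a)) (basic b).
exists V'; split; first by do 2?split.
have V'W : V' `<=` W by move=> y [[/VW]].
exists V'W.
have loc : @locally_fraction P V' (fun y Vy => @lfrac P (pr_compl y) b a Vy.1.2).
  move=> y Vy; exists V', b, a; split=> // z Vz _; by exists Vz.1.2.
exists (SpecSect loc); apply: spec_sect_ext => y Vy /=.
have [nb' ->] := sab y (V'W y Vy) Vy.1.1.
rewrite lfracD => [|k]; first by apply: pr_D => //; exact: Vy.1.2.
by apply/lfrac_eqP; exists 0; rewrite /= ?add0r ?addr0 1?addrC //; apply: pr_0.
Qed.

Definition spec_hom : lms_hom X (Spec P) := LmsHom spec_local.

Lemma spec_homK : spec_dual spec_hom = phi.
Proof.
apply/funext => p; apply: spec_comapE => x Ux Wfx.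
exists p, 0, (@pr_0 _ _); split; first exact: ss_val_irr.
by rewrite [stalk_of _ _](gerA x).1 addr0; apply: germ_irr.
Qed.
End SpecMapOf.

Lemma spec_dual_image (f : lms_hom X (Spec P)) (U : opens X) (W : opens (Spec P : lms))
    (UW : U `<=` lms_map f @^-1` W) (s : \M_(Spec P) W) :
  spec_image (spec_dual f) (lms_map f) s (comap (lms_comap f) UW s).
Proof.
move=> x Ux Wfx; have [V [a [b [Vfx VW sab]]]] := ss_loc s Wfx.
have [nb sfx] := sab _ Wfx Vfx; exists a, b, nb; split=> //.
pose V' := opensI (preopen (lms_map f) V) U.
have V'x : oset V' x by [].
have V'V : V' `<=` lms_map f @^-1` V by move=> y [].
have V'U : V' `<=` U by move=> y [].
have V'T : V' `<=` opensT X by [].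
have VT : V `<=` opensT (spec_space P) by [].
have elt p : res \M_X V'T (spec_dual f p) =
    comap (lms_comap f) V'V (res \M_(Spec P) VT (spec_elt p)).
  have V'P : V' `<=` lms_map f @^-1` opensT (spec_space P) by [].
  by rewrite (comap_resr _ _ V'P) /spec_dual /= /Gamma_map (comap_resl _ _ V'P).
have stE p : stalk_of x (spec_dual f p) = germ V'x (res \M_X V'T (spec_dual f p)).
  by rewrite germ_res; apply: germ_irr.
rewrite !stE (germ_irr Ux (V'U _ V'x)) -(germ_res V'U V'x) -germD; congr germ.
have V'W : V' `<=` lms_map f @^-1` W by move=> y /V'V /VW.
rewrite !elt (comap_resl _ _ V'W) -(comap_resr _ V'V V'W VW) -raddfD; congr comap.
apply: spec_sect_ext => y Vy /=; have [nb' ->] := sab y (VW _ Vy) Vy.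
rewrite lfracD => [|k]; first by apply: pr_D => //; apply: pr_0.
by apply/lfrac_eqP; exists 0; rewrite /= ?addr0 //; apply: pr_0.
Qed.

Lemma spec_dual_inj (f g : lms_hom X (Spec P)) : spec_dual f = spec_dual g -> f = g.
Proof.
move=> fg; have fgE x : lms_map f x = lms_map g x.
  by apply: prime_ext => p; rewrite !spec_dual_pr fg.
apply: lms_hom_ext => // U W UW UW' s.
apply: (spec_image_uniq (f := lms_map f) (spec_dual_additive f) _ UW
          (spec_dual_image UW s)).
  by move=> x p; rewrite spec_dual_pr => /contrapT.
move=> x Ux Wfx; have := spec_dual_image UW' s Ux; rewrite -fgE -fg.
exact.
Qed.
End SpecMaps.

Lemma spec_dual_comp (X Y : lms) (P : nmodType) (g : lms_hom Y (Spec P))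
    (f : lms_hom X Y) p :
  spec_dual (g \ol f) p = Gamma_map f (spec_dual g p).
Proof. exact: Gamma_map_comp. Qed.

(** The complement of the units is a prime ideal lying in no proper open subset, so
    that a global section is a single fraction with invertible denominator. *)
Lemma spec_elt_surj (P : nmodType) (s : Gamma (Spec P)) : exists p, s = spec_elt p.
Proof.
have mi (p q : P) : ~ munit p -> ~ munit (p + q) by rewrite munitD => np [].
have m0 : ~ ~ @munit P 0 by apply; exists 0; rewrite addr0.
have mD (p q : P) : ~ ~ munit p -> ~ ~ munit q -> ~ ~ munit (p + q).
  by rewrite munitD => /contrapT up /contrapT uq; apply.
pose m : spec_space P := @PrimeIdeal P [set p | ~ munit p] mi m0 mD.
have mT : oset (opensT (spec_space P)) m by [].
have [V [a [b [Vm _ sab]]]] := ss_loc s mT.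
have VT y : oset V y.
  have : spec_open V := openP V; move=> /(_ _ Vm) [p [/contrapT [q pq]]]; apply.
  by move=> py; apply: (@pr_0 _ y); rewrite -pq; apply: pr_ideal.
have [/contrapT [b' bb'] _] := sab m mT Vm.
exists (a + b'); apply: spec_sect_ext => y Ty /=.
have [nb ->] := sab y Ty (VT y); apply/lfrac_eqP.
exists 0; first exact: pr_0.
by rewrite /= !add0r addr0 -addrA (addrC b') bb' addr0.
Qed.

Section SpecFunctor.
Variables (P N : nmodType) (psi : P -> N).
Hypothesis psiA : nmod_morphism psi.

Let eltA : nmod_morphism (@spec_elt N \o psi).
Proof.
have [p0 pD] := psiA; have [e0 eD] := spec_elt_additive N.
by split=> [|p q]; rewrite /= ?p0 ?pD.
Qed.

Definition spec_map : lms_hom (Spec N) (Spec P) := spec_hom eltA.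

Lemma spec_dual_map (X : lms) (c : lms_hom X (Spec N)) p :
  spec_dual (spec_map \ol c) p = spec_dual c (psi p).
Proof. by rewrite spec_dual_comp spec_homK. Qed.

Lemma spec_map_basic p : munit (psi p) ->
  range (lms_map spec_map) `<=` basic_open p.
Proof.
move=> [q pq] _ [y _ <-]; change (~ pr (lms_map spec_map y : prime_ideal P) p).
rewrite spec_dual_pr spec_homK /=; apply.
by rewrite spec_elt_unit => py; apply: (@pr_0 _ y); rewrite -pq; apply: pr_ideal.
Qed.
End SpecFunctor.

(** * Spaces representing morphisms to a locally monoidal space *)

Section Realization.
Variable E : category_of_spaces.
Local Notation sp := (und_space (und E)).
Local Notation mp := (@und_map E (und E) _ _).
Local Notation "'lf' u" := (lms_of_map u) (at level 10, u at level 9).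

Section OpenSubspace.
Variables (X : E) (U : opens (sp X)).

Let j : lms_hom (lms_of (opn U)) (lms_of X) := lf (opn_incl U).

Let jU : is_open_inclusion (lms_map j) U := opn_inclusion U.

Let image_sub (W : opens (sp (opn U))) :
  range (mp (opn_incl (image_open jU W : opens (sp X)))) `<=` U.
Proof.
rewrite opn_range image_openE => _ [x _ <-].
by rewrite -[X in X _](opn_range U); exists x.
Qed.

Let image_lift (W : opens (sp (opn U))) :
  range (mp (opn_lift (@image_sub W))) `<=` W.
Proof.
move=> _ [y _ <-]; have : oset (image_open jU W) (mp (opn_incl (image_open jU W : opens (sp X))) y).
  by rewrite -[X in X _](opn_range (image_open jU W : opens (sp X))); exists y.
rewrite image_openE => -[w Ww].
rewrite -[in X in _ = X -> _](opn_liftK (@image_sub W)) und_mapM.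
by have [inj _ _] := opn_inclusion U; move=> /inj <-.
Qed.

(** Over [W], the comorphism of the inclusion is composition with an isomorphism
    between [W], as a subspace of [opn U], and its image in [X]. *)
Lemma opn_incl_represents : @lms_represents (lms_of X) _ U j.
Proof.
apply: (lms_represents_crit (jU := jU)) => W.
exists (fun s => s \oc opn_lift (@image_lift W)) => s /=; rewrite /A_comap.
  rewrite -[RHS](compm1 s) -compA; congr (_ \oc _); apply: opn_mono.
  rewrite compA opn_mapK -compA opn_liftK opn_liftK compm1 //.
rewrite -[RHS](compm1 s) -compA; congr (_ \oc _); apply: opn_mono; apply: opn_mono.
by rewrite compm1 (compA (opn_incl W)) opn_liftK compA opn_liftK opn_mapK.
Qed.
End OpenSubspace.

Lemma represents_open_lms (X V : E) (U : opens (sp X)) (j : hom V X) :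
  represents_open U j -> @lms_represents (lms_of X) _ U (lf j).
Proof.
move=> rj; have [a [ja _]] := (opn_rep U).2 _ _ rj.1.
have [b [jb _]] := rj.2 _ _ (opn_rep U).1.
rewrite -ja lms_of_mapM; apply: lms_represents_comp_iso; first exact: opn_incl_represents.
exists (lf b); rewrite -!lms_of_mapM; split.
  rewrite (_ : b \oc a = idm V); first exact: lms_of_map1.
  by apply: (represents_mono rj); rewrite compA jb ja compm1.
rewrite (_ : a \oc b = idm (opn U)); first exact: lms_of_map1.
by apply: opn_mono; rewrite compA ja jb compm1.
Qed.

(** For [O = setT] this is representability of the presheaf of morphisms to [Y]; keeping
    [Y] fixed and varying [O] avoids passing to open subspaces of [Y]. *)
Definition realizes (Y : lms) (O : set Y) (Z : E) (tau : lms_hom (lms_of Z) Y) : Prop :=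
  range (lms_map tau) `<=` O /\
  forall (X : E) (g : lms_hom (lms_of X) Y), range (lms_map g) `<=` O ->
    exists! u : hom X Z, tau \ol lf u = g.

Definition realizable (Y : lms) (O : set Y) : Prop :=
  exists (Z : E) (tau : lms_hom (lms_of Z) Y), realizes O tau.

Lemma realizes_universal (Y : lms) (Z : E) (tau : lms_hom (lms_of Z) Y) :
  realizes setT tau <-> universal_element (tau : A_presheaf E Y Z).
Proof.
split=> [[_ u] X g|u]; first exact: u.
by split=> // X g _; apply: u.
Qed.

Section Realizes.
Variables (Y : lms) (O : set Y) (Z : E) (tau : lms_hom (lms_of Z) Y).
Hypothesis rtau : realizes O tau.

Lemma realizes_mono (X : E) (a b : hom X Z) :
  tau \ol lf a = tau \ol lf b -> a = b.
Proof.
move=> ab; have [|c [_ cU]] := rtau.2 X (tau \ol lf a).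
  by move=> _ [x _ <-]; apply: rtau.1; exists (lms_map (lf a) x).
by rewrite -(cU a erefl); apply: cU.
Qed.

(** A morphism to [Z] has values in the preimage of [O'] exactly when its composite with
    [tau] has values in [O']. *)
Lemma realizes_sub (O' : opens Y) (Z' : E) (j : hom Z' Z) : O' `<=` O ->
  represents_open (lms_map tau @^-1` O' : set (sp Z)) j <-> realizes O' (tau \ol lf j).
Proof.
move=> O'O; split=> [[jr ju]|[tr tu]].
  split=> [_ [x _ <-]|X g gO']; first by apply: jr; exists x.
  have [u [ug _]] := rtau.2 X g (subset_trans gO' O'O).
  have [|v [jv vU]] := ju X u.
    by move=> _ [x _ <-]; apply: gO'; exists x => //; rewrite -ug.
  exists v; split; first by rewrite -(@compA LMS) -lms_of_mapM jv.
  move=> v' v'E; apply: vU; apply: realizes_mono.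
  by rewrite ug -v'E -(@compA LMS) -lms_of_mapM.
split=> [_ [x _ <-]|X f fO']; first by apply: tr; exists x.
have [|v [vE vU]] := tu X (tau \ol lf f).
  by move=> _ [x _ <-]; apply: fO'; exists x.
exists v; split.
  by apply: realizes_mono; rewrite -vE -(@compA LMS) -lms_of_mapM.
by move=> v' v'E; apply: vU; rewrite -v'E -(@compA LMS) -lms_of_mapM.
Qed.

End Realizes.

Lemma realizes_represents (Y V : lms) (O : opens Y) (k : lms_hom V Y) (Z : E)
    (tau : lms_hom (lms_of Z) V) :
  lms_represents O k -> realizes setT tau -> realizes O (k \ol tau).
Proof.
move=> rk [_ tu]; split=> [_ [x _ <-]|X g gO].
  by apply: rk.1; exists (lms_map tau x).
have [h [kh hU]] := rk.2 _ g gO; have [//|u [uh uU]] := tu X h.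
exists u; split; first by rewrite -(@compA LMS) uh.
by move=> u' u'E; apply: uU; apply/esym/hU; rewrite (@compA LMS).
Qed.

Lemma realizable_represents (Y V : lms) (O : opens Y) (k : lms_hom V Y) :
  lms_represents O k -> @realizable V setT <-> @realizable Y O.
Proof.
move=> rk; split=> [[Z [tau rtau]]|[Z [tau [tr tu]]]].
  by exists Z, (k \ol tau); apply: realizes_represents.
have [tau' [ktau' _]] := rk.2 _ tau tr; exists Z, tau'; split=> // X g _.
have [|u [ug uU]] := tu X (k \ol g).
  by move=> _ [x _ <-]; apply: rk.1; exists (lms_map g x).
exists u; split; last by move=> u' u'E; apply: uU; rewrite -u'E (@compA LMS) ktau'.
by apply: (lms_represents_mono rk); rewrite (@compA LMS) ktau'.
Qed.

Section GlueRealizations.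
Variables (Y : lms) (I : small) (O : I -> opens Y) (Z : I -> E) (Q : E).
Variables (tau : forall i, lms_hom (lms_of (Z i)) Y) (z : forall i, hom (Z i) Q).
Hypothesis rtau : forall i, realizes (O i) (tau i).
Hypothesis zopen : forall i, open_embedding (und E) (z i).
Hypothesis zsurj : forall x : sp Q, exists i y, mp (z i) y = x.
Hypothesis zcompat : forall i k (T : E) (a : hom T (Z i)) (b : hom T (Z k)),
  z i \oc a = z k \oc b <-> tau i \ol lf a = tau k \ol lf b.

(** One direction of [zcompat] makes the [tau i] glue to a morphism [t] from [Q].  By
    the other one, the lifts of a morphism [g] over the preimages of the [O i] agree in
    [Q] on overlaps, hence glue; and two lifts of [g] agree on the open cover of their
    source where they factor through some [z i] and some [z k]. *)
Lemma realizes_glue : exists t : lms_hom (lms_of Q) Y,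
  (forall i, t \ol lf (z i) = tau i) /\ realizes (\bigcup_i O i) t.
Proof.
have [R rR] : exists R : forall i, opens (sp Q), forall i, represents_open (R i) (z i).
  by exists (fun i => sval (cid (zopen i))) => i; exact: (svalP (cid (zopen i))).
have Rrange i : range (mp (z i)) = R i by case: (represents_inclusion (rR i)).
have Rcov x : exists i, oset (R i) x.
  by have [i [y <-]] := zsurj x; exists i; rewrite -[X in X _]Rrange; exists y.
have [|t [tz _]] := @lms_glue (lms_of Q) Y I R _ _
    (fun i => represents_open_lms (rR i)) Rcov tau.
  move=> i k T a b ab; pose W := opensI (R i) (R k).
  have [|a' [ia' _]] := (rR i).2 _ (opn_incl W); first by rewrite opn_range => x [].
  have [|b' [kb' _]] := (rR k).2 _ (opn_incl W); first by rewrite opn_range => x [].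
  have [|c [ic _]] := (opn_incl_represents W).2 _ (lf (z i) \ol a).
    move=> _ [x _ <-]; split; first by rewrite -[X in X _]Rrange; exists (lms_map a x).
    by rewrite ab -[X in X _]Rrange; exists (lms_map b x).
  have -> : a = lf a' \ol c.
    apply: (lms_represents_mono (represents_open_lms (rR i))).
    by rewrite (@compA LMS) -lms_of_mapM ia'.
  have -> : b = lf b' \ol c.
    apply: (lms_represents_mono (represents_open_lms (rR k))).
    by rewrite (@compA LMS) -lms_of_mapM kb' ic.
  by rewrite !(@compA LMS); congr (_ \ol _); apply/zcompat; rewrite ia' kb'.
exists t; split=> //; split=> [_ [x _ <-]|X g gO].
  have [i [y <-]] := zsurj x; exists i => //; apply: (rtau i).1.
  by exists y => //; rewrite -(tz i).
pose G i : opens (sp X) := preopen (lms_map g) (O i).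
pose jG i : hom (opn (G i)) X := opn_incl (G i).
have Gcov x : exists i, oset (G i) x.
  by have [|i _ Ox] := gO (lms_map g x); [exists x | exists i].
have jsurj x : exists i y, mp (jG i) y = x.
  have [i Gx] := Gcov x; exists i.
  by move: Gx; rewrite -[X in X _](opn_range (G i)) => -[y _ yx]; exists y.
have ex i : exists u : hom (opn (G i)) (Z i), tau i \ol lf u = g \ol lf (jG i).
  have [|u [ug _]] := (rtau i).2 _ (g \ol lf (jG i)); last by exists u.
  move=> _ [x _ <-]; have : range (mp (jG i)) `<=` G i by rewrite opn_range.
  by apply; exists x.
pose u i := sval (cid (ex i)).
have uE i : tau i \ol lf (u i) = g \ol lf (jG i) := svalP (cid (ex i)).
have [|v [vz vU]] := @zariski_glue E X Q I _ jG (fun i => z i \oc u i)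
    (fun i => opn_open_embedding (G i)) jsurj.
  move=> i k T a b ab; rewrite -!compA; apply/zcompat.
  by rewrite !lms_of_mapM !(@compA LMS) !uE -!(@compA LMS) -!lms_of_mapM ab.
have gE v' : (forall i, v' \oc jG i = z i \oc u i) -> t \ol lf v' = g.
  move=> v'z; apply: (lms_local_eq (fun i => opn_incl_represents (G i)) Gcov) => i.
  rewrite -(@compA LMS) -lms_of_mapM.
  by rewrite (v'z i) lms_of_mapM (@compA LMS) tz uE.
exists v; split=> [|v' tv']; first exact: gE.
apply: vU => i.
pose W k := preopen (mp (v' \oc jG i)) (R k).
apply: (@zariski_epi E _ _ I _ (fun k => opn_incl (W k))).
- by move=> k; apply: opn_open_embedding.
- move=> x; have [k Rx] := Rcov (mp (v' \oc jG i) x); exists k.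
  have : oset (W k) x by [].
  by rewrite -[X in X _](opn_range (W k)) => -[y _ yx]; exists y.
move=> k; have [|a [ka _]] := (rR k).2 _ (v' \oc jG i \oc opn_incl (W k)).
  move=> _ [x _ <-]; rewrite und_mapM.
  have : range (mp (opn_incl (W k))) `<=` W k by rewrite opn_range.
  by apply; exists x.
rewrite -ka -[in RHS]compA; apply/zcompat.
rewrite lms_of_mapM (@compA LMS) uE -(tz k) -tv' -!(@compA LMS) -!lms_of_mapM ka.
by rewrite !compA.
Qed.
End GlueRealizations.
End Realization.

(** * Gluing realizations *)

Section WellOrder.
Variables (T : choiceType) (R : rel T).
Hypothesis woR : well_order R.

Lemma well_order_min (A : set T) x : A x ->
  exists m, A m /\ forall y, A y -> R m y.
Proof.
move=> Ax; have [|m [[/asboolP Am mA] _]] := woR (A := [pred x | `[< A x >]]).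
  by exists x; apply/asboolP.
by exists m; split=> // y Ay; apply: mA; apply/asboolP.
Qed.

Lemma well_order_total : total R.
Proof.
move=> x y; have [|m [[->|->] mxy]] := @well_order_min [set z | z = x \/ z = y] x.
- by left.
- by rewrite (mxy y) //; right.
by rewrite (mxy x) ?orbT//; left.
Qed.

Lemma well_order_refl : reflexive R.
Proof. by move=> x; rewrite -[R x x]orbb well_order_total. Qed.

Lemma well_order_anti : antisymmetric R.
Proof.
move=> x y /andP[xy yx].
have [|m [_ mU]] := woR (A := pred2 x y); first by exists x; rewrite !inE eqxx.
have <- : m = x.
  apply: mU; split=> [|z]; first by rewrite inE eqxx.
  by rewrite inE => /orP[]/eqP->; rewrite ?well_order_refl.
apply: mU; split=> [|z]; first by rewrite inE eqxx orbT.
by rewrite inE => /orP[]/eqP->; rewrite ?well_order_refl.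
Qed.

Lemma well_order_trans : transitive R.
Proof.
move=> y x z xy yz.
have [|m [mxyz mR]] := @well_order_min [set t | [\/ t = x, t = y | t = z]] x.
  by constructor 1.
have [mx my mz] : [/\ R m x, R m y & R m z].
  by split; apply: mR; [constructor 1|constructor 2|constructor 3].
case: mxyz => e; first by rewrite -e.
  by have -> // : x = y by apply: well_order_anti; rewrite xy -e.
by have <- // : y = z by apply: well_order_anti; rewrite yz -e.
Qed.

Lemma well_order_ind (P : T -> Prop) :
  (forall y, (forall x, R x y -> x <> y -> P x) -> P y) -> forall y, P y.
Proof.
move=> Pstep y; apply: contrapT => nPy.
have [m [nPm mR]] := @well_order_min [set x | ~ P x] y nPy.
apply: nPm; apply: Pstep => x xm xNm; apply: contrapT => nPx; apply: xNm.
by apply: well_order_anti; rewrite xm mR.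
Qed.

Lemma well_order_sub (P : pred T) :
  well_order (fun u v : {x | P x} => R (val u) (val v)).
Proof.
apply: antisymmetric_well_order => [u v /well_order_anti /val_inj//|A [u Au]].
have [|m [[w Aw <-] mR]] := @well_order_min [set x | exists2 w, w \in A & val w = x] (val u).
  by exists u.
by exists w; split=> // v Av; apply: mR; exists v.
Qed.

Definition wo_type of well_order R : Type := T.
HB.instance Definition _ := Choice.copy (wo_type woR) T.
HB.instance Definition _ := Order.Le_isPOrder.Build (Order.Disp tt tt)
  (wo_type woR) well_order_refl well_order_anti well_order_trans.
HB.instance Definition _ := Order.POrder_isTotal.Build (Order.Disp tt tt)
  (wo_type woR) well_order_total.
End WellOrder.

Section IndiscreteTest.

Let two : topologicalType := initial_topology (fun _ : bool => true).

Let two_continuous (T : topologicalType) (f : T -> two) : continuous f.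
Proof.
apply/continuousP => A [A' _ <-]; have [At|At] := pselect (A' true).
  by rewrite (_ : _ @^-1` _ = setT); [exact: openT | apply/seteqP; split].
by rewrite (_ : _ @^-1` _ = set0); [exact: open0 | apply/seteqP; split].
Qed.

Let char (T : topologicalType) (A : set T) : continuousType T two :=
  mkcts (@two_continuous T (fun x => `[< A x >])).

Let charE (T : topologicalType) (A : set T) x : A x -> char A x = true.
Proof. by move=> Ax; change (`[< A x >] = true); apply/asboolP. Qed.

Let charP (T : topologicalType) (A : set T) x : char A x = true -> A x.
Proof. by move=> Ax; apply/asboolP; change (`[< A x >] = true) in Ax. Qed.

(* Colimits of topological spaces are tested on maps to a two-point indiscrete
   space, which are arbitrary subsets. *)

Lemma top_colimit_surj (J : category) (D : functor J Top) (Q : Top)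
    (q : forall j, hom (D j) Q) : is_colimit q ->
  forall x : (Q : topologicalType), exists j y, (q j : continuousType _ _) y = x.
Proof.
move=> [qc qU] x; pose A := [set x | exists j y, (q j : continuousType _ _) y = x].
have [|u [_ uU]] := qU two (fun j => char setT).
  by move=> i j a; apply/continuousEP => y; apply: etrans (charE _) (esym (charE _)).
apply: (@charP _ A); rewrite -(uU (char A)).
  rewrite (uU (char setT)) ?charE// => j.
  by apply/continuousEP => y; apply: etrans (charE _) (esym (charE _)).
move=> j; apply/continuousEP => y; apply: etrans (charE _) (esym (charE _)) => //.
by exists j, y.
Qed.

Lemma top_pushout_surj (X0 X1 X2 Q : Top) (f1 : hom X0 X1) (f2 : hom X0 X2)
    (q1 : hom X1 Q) (q2 : hom X2 Q) : is_pushout f1 f2 q1 q2 ->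
  forall x : (Q : topologicalType), (exists y, (q1 : continuousType _ _) y = x) \/
    (exists y, (q2 : continuousType _ _) y = x).
Proof.
move=> [_ po] x; pose A := [set x | (exists y, (q1 : continuousType _ _) y = x) \/
  (exists y, (q2 : continuousType _ _) y = x)].
have [|u [_ uU]] := po two (char setT) (char setT).
  by apply/continuousEP => y; apply: etrans (charE _) (esym (charE _)).
apply: (@charP _ A); rewrite -(uU (char A)).
  rewrite (uU (char setT)) ?charE//.
  by split; apply/continuousEP => y; apply: etrans (charE _) (esym (charE _)).
split; apply/continuousEP => y; apply: etrans (charE _) (esym (charE _)) => //.
  by left; exists y.
by right; exists y.
Qed.

Lemma top_pushout_overlap (X0 X1 X2 Q : Top) (f1 : hom X0 X1) (f2 : hom X0 X2)
    (q1 : hom X1 Q) (q2 : hom X2 Q) :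
  is_pushout f1 f2 q1 q2 ->
  forall x1 x2, (q1 : continuousType _ _) x1 = (q2 : continuousType _ _) x2 ->
    range (f1 : continuousType _ _) x1.
Proof.
move=> [_ po] x1 x2 e.
have [|u [[u1 u2] _]] := po two (char (range (f1 : continuousType _ _))) (char setT).
  apply/continuousEP => x /=.
  change (`[< range (f1 : continuousType _ _) ((f1 : continuousType _ _) x) >] =
          `[< [set: X2] ((f2 : continuousType _ _) x) >]).
  by rewrite !asboolT//; exists x.
apply/asboolP; change (is_true (char (range (f1 : continuousType _ _)) x1)).
rewrite -u1; change (is_true ((u : continuousType _ _) ((q1 : continuousType _ _) x1))).
rewrite e; change (is_true ((u \oc q2 : continuousType _ _) x2)).
by rewrite u2; apply/asboolP.
Qed.

Lemma top_coproduct_disjoint (I : Type) (F : I -> Top) (Q : Top)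
    (q : forall i, hom (F i) Q) : is_coproduct q ->
  forall i k x y, (q i : continuousType _ _) x = (q k : continuousType _ _) y -> i = k.
Proof.
move=> cop i k x y e.
have [u [uq _]] := cop two (fun l => char [set _ | l = i]).
apply/esym/asboolP; change (is_true (char [set _ | k = i] y)); rewrite -uq.
change (is_true ((u : continuousType _ _) ((q k : continuousType _ _) y))).
rewrite -e; change (is_true ((u \oc q i : continuousType _ _) x)).
by rewrite uq; apply/asboolP.
Qed.
End IndiscreteTest.

Section GlueInE.
Variable E : category_of_spaces.
Local Notation sp := (und_space (und E)).
Local Notation mp := (@und_map E (und E) _ _).
Local Notation "'lf' u" := (lms_of_map u) (at level 10, u at level 9).

Lemma open_embedding_mono (X V : E) (j : hom V X) : open_embedding (und E) j ->
  forall (T : E) (a b : hom T V), j \oc a = j \oc b -> a = b.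
Proof. by move=> [U rj]; apply: represents_mono rj. Qed.

Lemma realizes_open_embedding (Y : lms) (O1 O2 : opens Y) (Z1 Z2 : E)
    (t1 : lms_hom (lms_of Z1) Y) (t2 : lms_hom (lms_of Z2) Y) (f : hom Z1 Z2) :
  realizes O1 t1 -> realizes O2 t2 -> O1 `<=` O2 -> t2 \ol lf f = t1 ->
  open_embedding (und E) f.
Proof.
move=> r1 r2 O12 tf; exists (preopen (lms_map t2) O1).
by apply/(realizes_sub r2 f O12); rewrite tf.
Qed.

(** The union is realized by the pushout along the realization of the intersection.
    Two morphisms to the two pieces that agree in the pushout, or in [Y], both come from
    the intersection: in the first case because points of a topological pushout are
    identified only along the images of the corner, in the second by the universal
    property. *)
Lemma realizableU (Y : lms) (O1 O2 : opens Y) :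
  realizable E O1 -> realizable E O2 -> realizable E (O1 `|` O2).
Proof.
move=> [Z1 [t1 r1]] [Z2 [t2 r2]]; pose O0 := opensI O1 O2.
pose f1 : hom _ Z1 := opn_incl (preopen (lms_map t1) O0 : opens (sp Z1)).
have r0 : realizes O0 (t1 \ol lf f1).
  by apply/(realizes_sub r1 f1 (@opensIl _ O1 O2)); exact: opn_rep.
have [|f2 [tf2 _]] := r2.2 _ (t1 \ol lf f1).
  by apply: subset_trans r0.1 _; apply: opensIr.
have o1 : open_embedding (und E) f1 by apply: opn_open_embedding.
have o2 : open_embedding (und E) f2.
  by apply: (realizes_open_embedding r0 r2) => //; apply: opensIr.
have [Q [q1 [q2 [[qf qU] oq1 oq2 oq [tqf tqU]]]]] := esp_pushout o1 o2.
pose O b := if b then O1 else O2; pose Z b := if b then Z1 else Z2.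
pose t b : lms_hom (lms_of (Z b)) Y := if b as b' return lms_hom (lms_of (Z b')) Y then t1 else t2.
pose q b : hom (Z b) Q := if b as b' return hom (Z b') Q then q1 else q2.
have qc (T : E) (c : hom T (opn _)) : q1 \oc (f1 \oc c) = q2 \oc (f2 \oc c).
  by rewrite !compA qf.
have tc (T : E) (c : hom T (opn _)) : t1 \ol lf (f1 \oc c) = t2 \ol lf (f2 \oc c).
  by rewrite !lms_of_mapM !(@compA LMS) tf2.
have qE (T : E) (a : hom T Z1) (b : hom T Z2) :
    q1 \oc a = q2 \oc b -> exists c, a = f1 \oc c /\ b = f2 \oc c.
  move=> ab; have [U rU] := oq; have [|c [cE _]] := rU.2 _ (q1 \oc a).
    move=> _ [x _ <-]; have [_ <- _] := represents_inclusion rU.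
    have [|y _ yx] := @top_pushout_overlap _ _ _ _ _ _ _ _ (conj tqf tqU) (mp a x) (mp b x).
      by change (mp q1 (mp a x) = mp q2 (mp b x)); rewrite -!und_mapM ab.
    by exists y => //; rewrite !und_mapM; congr (mp q1 _).
  have ac : a = f1 \oc c by apply: (open_embedding_mono oq1); rewrite compA cE.
  exists c; split=> //; apply: (open_embedding_mono oq2).
  by rewrite -ab ac qc.
have tE (T : E) (a : hom T Z1) (b : hom T Z2) :
    t1 \ol lf a = t2 \ol lf b -> exists c, a = f1 \oc c /\ b = f2 \oc c.
  move=> ab; have [|c [cE _]] := r0.2 _ (t1 \ol lf a).
    move=> _ [x _ <-]; split; first by apply: r1.1; exists (lms_map (lf a) x).
    by rewrite ab; apply: r2.1; exists (lms_map (lf b) x).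
  have ac : a = f1 \oc c.
    by apply: (realizes_mono r1); rewrite -cE lms_of_mapM (@compA LMS).
  exists c; split=> //; apply: (realizes_mono r2).
  by rewrite -ab ac tc.
have [||x|[] [] T a b|t' [_ rt']] := @realizes_glue E Y bool O Z Q t q.
- by case.
- by case.
- by have [[y]|[y]] := top_pushout_surj (conj tqf tqU) x; [exists true, y|exists false, y].
- by split=> [/(open_embedding_mono oq1)|/(realizes_mono r1)] ->.
- by split=> [/qE|/tE] [c [-> ->]].
- by split=> /esym => [/qE|/tE] [c [-> ->]].
- by split=> [/(open_embedding_mono oq2)|/(realizes_mono r2)] ->.
exists Q, t'; rewrite (_ : _ `|` _ = \bigcup_b O b) //.
by apply/seteqP; split=> [x [Ox|Ox]|x [[] _ Ox]];
  [exists true|exists false|left|right].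
Qed.

(** The realizations of the members of a chain form a functor, the transition maps
    being determined by the universal properties. *)
Lemma realizable_chain (T : choiceType) (R : rel T) (woR : well_order R) (Y : lms)
    (O : T -> opens Y) :
  (forall x y, R x y -> O x `<=` O y) -> (forall x, realizable E (O x)) ->
  realizable E (\bigcup_x O x).
Proof.
move=> Omono ex; pose Z x := projT1 (cid (ex x)).
pose t x : lms_hom (lms_of (Z x)) Y := sval (cid (projT2 (cid (ex x)))).
have rt x : realizes (O x) (t x) by exact: svalP (cid (projT2 (cid (ex x)))).
have exd x y (xy : R x y) : exists f : hom (Z x) (Z y), t y \ol lf f = t x.
  have [|f [fE _]] := (rt y).2 _ (t x); last by exists f.
  exact: subset_trans (rt x).1 (Omono _ _ xy).
pose W := poset_category (wo_type woR).
pose d (x y : W) (xy : hom x y) : hom (Z x) (Z y) := sval (cid (exd x y xy)).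
have dE (x y : W) (xy : hom x y) : t y \ol lf (d x y xy) = t x.
  exact: svalP (cid (exd x y xy)).
have d1 (x : W) : d x x (idm x) = idm (Z x).
  by apply: (realizes_mono (rt x)); rewrite dE lms_of_map1 (@compm1 LMS).
have dM (x y z : W) (yz : hom y z) (xy : hom x y) : d _ _ (yz \oc xy) = d _ _ yz \oc d _ _ xy.
  by apply: (realizes_mono (rt z)); rewrite dE lms_of_mapM (@compA LMS) !dE.
pose D : functor W E := @Functor W E Z d d1 dM.
have Dopen (x y : W) (xy : hom x y) : open_embedding (und E) (fmor D xy).
  by apply: (realizes_open_embedding (rt x) (rt y)); [apply: Omono | apply: dE].
have [Q [q [[qc qU] qo qtop]]] := @esp_well_ordered E _ _ D woR Dopen.
have key (x y : W) (xy : hom x y) (S : E) (a : hom S (Z x)) (b : hom S (Z y)) :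
    q x \oc a = q y \oc b <-> t x \ol lf a = t y \ol lf b.
  rewrite -(qc _ _ xy) -compA -(dE _ _ xy) -(@compA LMS) -lms_of_mapM.
  by split=> [/(open_embedding_mono (qo y))|/(realizes_mono (rt y))] ->.
have [|x y S a b|t' [_ rt']] := @realizes_glue E Y T O Z Q t q rt qo; last by exists Q, t'.
  by move=> x; have [i [y yx]] := top_colimit_surj qtop x; exists i, y.
have [xy|yx] := orP (well_order_total woR x y); first exact: (key x y xy).
by have := key y x yx S b a; split=> /esym /H /esym.
Qed.

(** Transfinite induction along a well-ordering of the points: the union of the
    neighbourhoods of all points up to [y] is the union of the neighbourhood of [y] and
    of a well-ordered chain of such unions. *)
Lemma realizable_cover (Y : lms) :
  (forall y : Y, exists U : opens Y, oset U y /\ realizable E U) ->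
  @realizable E Y setT.
Proof.
move=> ex; pose U y := sval (cid (ex y)).
have Uy y : oset (U y) y := (svalP (cid (ex y))).1.
have rU y : realizable E (U y) := (svalP (cid (ex y))).2.
have [R woR] := well_ordering_principle Y.
have Vopen y : open (\bigcup_(x in [set x | R x y]) U x).
  by apply: bigcup_open => x _; apply: openP.
pose V y := Opens (Vopen y).
have VE y : oset (V y) = U y `|` \bigcup_(u : {x | R x y && (x != y)}) V (val u).
  apply/seteqP; split=> [z [x Rxy Uz]|z [Uz|[[x /= /andP[xy _]] _ [w wx Uz]]]].
  - have [<-|/eqP xy] := pselect (x = y); first by left.
    have Px : R x y && (x != y) by rewrite [R x y]Rxy.
    by right; exists (exist _ x Px) => //; exists x => //; apply: well_order_refl.
  - by exists y => //; apply: well_order_refl.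
  - by exists w => //; apply: well_order_trans xy.
have -> : [set: Y] = \bigcup_y V y.
  by apply/seteqP; split=> // y _; exists y => //; exists y => //; apply: well_order_refl.
apply: (realizable_chain woR) => [x y xy z [w wx Uz]|].
  by exists w => //; apply: well_order_trans xy.
apply: (well_order_ind woR) => y IHy.
have Bopen : open (\bigcup_(u : {x | R x y && (x != y)}) V (val u)).
  by apply: bigcup_open => x _; apply: openP.
rewrite VE; apply: (@realizableU _ (U y) (Opens Bopen)) => //.
apply: (@realizable_chain _ _ (@well_order_sub _ _ woR _) _ (fun u => V (val u)))
  => [u v uv z [w wu Uz]|u].
  by exists w => //; apply: well_order_trans uv.
by apply: IHy; have /andP[//] := valP u => _ /eqP.
Qed.

(** An object mapping compatibly to two different summands has no points, so it is
    initial, and it has only one morphism to [Y] as there is only one section over the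
    empty set. *)
Lemma realizes_coproduct (Y : lms) (I : small) (O : I -> opens Y) (Z : I -> E)
    (t : forall i, lms_hom (lms_of (Z i)) Y) (Q : E) (q : forall i, hom (Z i) Q) :
  (forall i, realizes (O i) (t i)) ->
  (forall i k y, oset (O i) y -> oset (O k) y -> i = k) -> is_coproduct q ->
  exists t' : lms_hom (lms_of Q) Y,
    (forall i, t' \ol lf (q i) = t i) /\ realizes (\bigcup_i O i) t'.
Proof.
move=> rt disj cop; apply: realizes_glue => //.
- exact: esp_coproduct_open.
- exact: coproduct_surj.
move=> i k T a b; have [ik|ik] := pselect (i = k).
  case: k / ik b => b; split.
    by move=> /(open_embedding_mono (esp_coproduct_open cop i)) ->.
  by move=> /(realizes_mono (rt i)) ->.
suff e : (sp T -> False) -> q i \oc a = q k \oc b /\ t i \ol lf a = t k \ol lf b.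
  split=> ab; apply e => x; apply: ik.
    apply: (top_coproduct_disjoint (esp_und_coproducts cop) (x := mp a x) (y := mp b x)).
    by change (mp (q i) (mp a x) = mp (q k) (mp b x)); rewrite -!und_mapM ab.
  apply: (disj i k (lms_map (t i \ol lf a) x)).
    by apply: (rt i).1; exists (lms_map (lf a) x).
  by rewrite ab; apply: (rt k).1; exists (lms_map (lf b) x).
move=> T0; split; last first.
  exact: lms_hom_empty.
have [h [_ hU]] := esp_empty T0 Q.
by rewrite -(hU (q i \oc a)) // -(hU (q k \oc b)).
Qed.
End GlueInE.

(** * Affine fans *)

Section FiniteTypes.

Lemma finite_type_sigma (A : Type) (F : A -> Type) :
  finite_type A -> (forall a, finite_type (F a)) -> finite_type {a & F a}.
Proof.
move=> [n [e eA]] fin.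
pose m a := sval (cid (fin a)); pose d a : 'I_(m a) -> F a := sval (cid (svalP (cid (fin a)))).
have dA a f : exists k, d a k = f := svalP (cid (svalP (cid (fin a)))) f.
pose T := {k : 'I_n & 'I_(m (e k))}.
exists #|{: T}|, (fun i => let t : T := enum_val i in existT _ (e (tag t)) (d _ (tagged t))).
move=> [a f]; have [k ka] := eA a; case: a / ka f => f; have [l lf] := dA _ f.
by exists (enum_rank (Tagged (fun k => 'I_(m (e k))) l : T)); rewrite enum_rankK /= lf.
Qed.

Lemma finite_type_bool : finite_type bool.
Proof.
exists 2%N, (fun k : 'I_2 => (k : nat) == 0%N) => -[]; first by exists ord0.
by exists ord_max.
Qed.

Lemma finite_open (A : Type) (X : topologicalType) (x : X) (O : A -> opens X) :
  finite_type A -> (forall a, oset (O a) x) ->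
  exists W : opens X, oset W x /\ forall a, W `<=` O a.
Proof.
move=> [n [e eA]] Ox; suff [W [Wx WO]] : exists W : opens X, oset W x /\
    forall k, W `<=` O (e k).
  by exists W; split=> // a; have [k <-] := eA a.
elim: n e {eA} => [|n IHn] e; first by exists (opensT X); split=> // -[].
have [W [Wx WO]] := IHn (fun k => e (lift ord0 k)).
exists (opensI W (O (e ord0))); split=> // k y [Wy Oy].
by have [j ->|->] := unliftP ord0 k; first exact: WO.
Qed.
End FiniteTypes.

Section FiniteLimits.
Variable C : category.
Hypothesis limits : forall (J : category) (D : functor J C), finite_category J ->
  exists (L : C) (p : forall j, hom L (D j)), is_limit p.

Let discrete (n : nat) : category := @Category 'I_n (fun i j => i = j)
  (fun _ => erefl) (fun _ _ _ yz xy => etrans xy yz)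
  (fun _ _ _ _ _ _ _ => eq_irrelevance _ _) (fun _ _ _ => eq_irrelevance _ _)
  (fun _ _ _ => eq_irrelevance _ _).

Lemma finite_power (A : C) (n : nat) : exists (L : C) (x : 'I_n -> hom L A),
  forall (X : C) (y : 'I_n -> hom X A), exists! u : hom X L, forall i, x i \oc u = y i.
Proof.
pose J := discrete n.
pose D : functor J C := @Functor J C (fun _ => A) (fun _ _ _ => idm A)
  (fun _ => erefl) (fun _ _ _ _ _ => esym (comp1m (idm A))).
have finJ : finite_category J.
  split; first by exists n, id => i; exists i.
  move=> i j; have [->|ij] := pselect (i = j).
    by exists 1%N, (fun _ => erefl) => e; exists ord0; apply: eq_irrelevance.
  by exists 0%N, (fun k : 'I_0 => False_rect _ (elimF idP (ltn0 k) (ltn_ord k))) => e.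
have [L [p [_ pU]]] := limits D finJ; exists L, p => X y.
by have [|u [uy uU]] := pU X y; [move=> i j e; case: _ / e; apply: comp1m|exists u].
Qed.

Let arrow (i j : bool) : Type :=
  if i then (if j then unit else void) else (if j then bool else unit).

Let arrow_id i : arrow i i := match i with true => tt | false => tt end.

Let arrow_comp i j k : arrow j k -> arrow i j -> arrow i k :=
  match i, j, k return arrow j k -> arrow i j -> arrow i k with
  | true, true, true => fun _ _ => tt
  | false, true, true => fun _ a => a
  | false, false, true => fun a _ => a
  | false, false, false => fun _ _ => tt
  | _, true, false => fun a _ => match a with end
  | true, false, _ => fun _ a => match a with end
  end.

Let arrow_compA i j k l (h : arrow k l) (g : arrow j k) (f : arrow i j) :
  arrow_comp h (arrow_comp g f) = arrow_comp (arrow_comp h g) f.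
Proof. by case: i j k l h g f => [] [] [] [] //= h g f; case: h; case: g; case: f. Qed.

Let arrow_comp1m i j (f : arrow i j) : arrow_comp (arrow_id j) f = f.
Proof. by case: i j f => [] [] //= []. Qed.

Let arrow_compm1 i j (f : arrow i j) : arrow_comp f (arrow_id i) = f.
Proof. by case: i j f => [] [] //= []. Qed.

Let parallel : category := Category arrow_compA arrow_comp1m arrow_compm1.

Let finite_unit : finite_type unit.
Proof. by exists 1%N, (fun _ => tt) => -[]; exists ord0. Qed.

Let finite_void : finite_type void.
Proof.
exists 0%N, (fun k : 'I_0 => False_rect _ (elimF idP (ltn0 k) (ltn_ord k))).
by case.
Qed.

Lemma finite_equalizer (A B : C) (f g : hom A B) : exists (L : C) (e : hom L A),
  f \oc e = g \oc e /\ forall (X : C) (h : hom X A), f \oc h = g \oc h ->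
    exists! u : hom X L, e \oc u = h.
Proof.
pose Do (i : parallel) : C := if i then B else A.
pose Dm (i j : parallel) : hom i j -> hom (Do i) (Do j) :=
  match i, j return arrow i j -> hom (Do i) (Do j) with
  | true, true => fun _ => idm B
  | false, false => fun _ => idm A
  | false, true => fun a : bool => if a then f else g
  | true, false => fun a : void => match a with end
  end.
have D1 i : Dm i i (idm i) = idm (Do i) by case: i.
have DM i j k (b : hom j k) (a : hom i j) : Dm i k (b \oc a) = Dm j k b \oc Dm i j a.
  by case: i j k b a => [] [] [] //= b a; rewrite ?comp1m ?compm1 //; case: a; case: b.
pose D : functor parallel C := Functor D1 DM.
have finJ : finite_category parallel.
  by split=> [|[] []]; [exact: finite_type_bool|exact: finite_unit|exact: finite_void|
    exact: finite_type_bool|exact: finite_unit].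
have [L [p [pc pU]]] := limits D finJ; exists L, (p false); split.
  by rewrite (pc false true true) (pc false true false).
move=> X h fgh.
pose p' (i : parallel) : hom X (D i) :=
  match i return hom X (Do i) with true => f \oc h | false => h end.
have [|u [up uU]] := pU X p'.
  by move=> [] [] [] //=; rewrite ?comp1m.
exists u; split; first exact: (up false).
move=> u' u'h; apply: uU => -[] //=.
by rewrite -(pc false true true) -compA u'h.
Qed.
End FiniteLimits.

Section Evaluation.
Variables (M N : nmodType) (n : nat).

Lemma evaluation_morph (f : M -> N) (x : nat -> M) v : nmod_morphism f ->
  f (evaluation n x v) = evaluation n (f \o x) v.
Proof.
move=> [f0 fD]; rewrite /evaluation (big_morph f fD f0); apply: eq_bigr => i _.
by elim: (v i) => [|m IHm]; rewrite ?mulr0n// !mulrS fD IHm.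
Qed.

Lemma eq_evaluation (x y : nat -> M) v :
  (forall i, (i < n)%N -> x i = y i) -> evaluation n x v = evaluation n y v.
Proof. by move=> xy; apply: eq_bigr => i _; rewrite xy. Qed.

Lemma evaluation0 (x : nat -> M) : evaluation n x (fun _ => 0%N) = 0.
Proof. by apply: big1 => i _; rewrite mulr0n. Qed.

Lemma evaluation_unit (x : nat -> M) i : (i < n)%N ->
  evaluation n x (fun k => (k == i : nat)%N) = x i.
Proof.
move=> ni; rewrite /evaluation (bigD1 (Ordinal ni)) //= eqxx mulr1n big1 ?addr0//.
move=> k ki; rewrite (_ : (k == i :> nat) = false) ?mulr0n//.
by apply: contraNF ki => /eqP ki; apply/eqP/val_inj.
Qed.
End Evaluation.

Section AffineRealization.
Variable E : category_of_spaces.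
Local Notation "'lf' u" := (lms_of_map u) (at level 10, u at level 9).
Let A := A1 E.

Lemma comp_additive (X Y : E) (f : hom X Y) :
  nmod_morphism ((fun a => a \oc f) : mhom A Y -> mhom A X).
Proof. by split=> [|a b]; [exact: mo_zero_comp | exact: mo_add_comp]. Qed.

Definition global_section (X : E) (a : mhom A X) : Gamma (lms_of X) := a \oc opn_incl _.

Lemma global_section_additive X : nmod_morphism (@global_section X).
Proof. exact: comp_additive. Qed.

(** The inclusion of the whole space, as an open subspace, is an isomorphism. *)
Lemma global_section_bij X : bijective (@global_section X).
Proof.
have rT : range (und_map (und E) (idm X)) `<=` opensT (und_space (und E) X) by [].
exists (fun s => s \oc opn_lift rT) => a; rewrite /global_section /= -compA.
  by rewrite opn_liftK compm1.
rewrite -[RHS](compm1 a); congr (_ \oc _); apply: opn_mono.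
by rewrite compA opn_liftK comp1m compm1.
Qed.

Lemma Gamma_map_global (X Y : E) (f : hom X Y) a :
  Gamma_map (lf f) (global_section a) = global_section (a \oc f).
Proof. by rewrite /Gamma_map /= /A_comap /global_section -!compA opn_mapK. Qed.

(** The equalizer of two morphisms from the [n]-th to the [k]-th power of [A1].  In
    additive notation, the monomials are the linear combinations [evaluation]. *)
Lemma monomial_equations n k (a b : 'I_k -> nat -> nat) :
  exists (L : E) (z : nat -> mhom A L),
  (forall j, evaluation n z (a j) = evaluation n z (b j)) /\
  forall (X : E) (y : nat -> mhom A X),
    (forall j, evaluation n y (a j) = evaluation n y (b j)) ->
    exists! u : hom X L, forall i, (i < n)%N -> z i \oc u = y i.
Proof.
have [L1 [x xU]] := finite_power (@esp_finite_limits E) A n.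
have [L2 [w wU]] := finite_power (@esp_finite_limits E) A k.
(* extended by 0 to all indices, as evaluations take families indexed by [nat] *)
pose x' i : mhom A L1 := oapp (x : 'I_n -> mhom A L1) 0 (insub i).
have xE (i : 'I_n) : x' i = x i by rewrite /x' valK.
have [F [FE _]] := wU _ (fun j => evaluation n x' (a j) : hom L1 A).
have [G [GE _]] := wU _ (fun j => evaluation n x' (b j) : hom L1 A).
have [L [e [FGe eU]]] := finite_equalizer (@esp_finite_limits E) F G.
exists L, (fun i => x' i \oc e); split=> [j|X y yab].
  have ev v : evaluation n (fun i => x' i \oc e : mhom A L) v = evaluation n x' v \oc e.
    by rewrite (evaluation_morph _ _ _ (comp_additive e)).
  by rewrite !ev -FE -GE -!compA FGe.
have [h [hy hU]] := xU X (fun i => y i).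
have ev v : (evaluation n x' v \oc h : mhom A X) = evaluation n y v.
  rewrite (evaluation_morph _ _ _ (comp_additive h)).
  by apply: eq_evaluation => i ni; rewrite /= (xE (Ordinal ni)) hy.
have [|u [uh uU]] := eU X h.
  have [m [_ mU]] := wU _ (fun j => evaluation n y (a j) : hom X A).
  rewrite -(mU (F \oc h)) => [|j]; last by rewrite compA FE ev.
  by apply: mU => j; rewrite compA GE ev yab.
exists u; split=> [i ni|u' u'y].
  by rewrite -compA uh (xE (Ordinal ni)) hy.
by apply: uU; apply/esym/hU => i; rewrite compA -xE; apply: u'y.
Qed.

(** A monoid map from [P] to the sections of [X] is a family of images of the generators
    satisfying the finitely many relations given by Redei's theorem. *)
Lemma spec_realizable (P : nmodType) : fin_gen P -> @realizable E (Spec P) setT.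
Proof.
move=> [s0 gen]; pose n := size s0; pose s i := s0`_i.
have /choice [c cP] : forall p, exists v, evaluation n s v = p.
  by move=> p; have [v pv] := gen p; exists v; rewrite [RHS]pv.
have [k [a [b [sab rel]]]] := redei n s.
have [L [z [zab zU]]] := monomial_equations n a b.
pose phi p : mhom A L := evaluation n z (c p).
have phiE v p : evaluation n s v = p -> phi p = evaluation n z v.
  by move=> vp; apply: (rel _ z zab); rewrite cP.
have phiA : nmod_morphism (@global_section L \o phi).
  have [g0 gD] := global_section_additive L; split=> [|p q] /=.
    by rewrite (phiE (fun _ => 0%N)) ?evaluation0.
  by rewrite (phiE (fun i => c p i + c q i)%N) evaluationD ?cP// gD.
pose tau : lms_hom (lms_of L) (Spec P) := spec_hom phiA.
have dual X (u : hom X L) p : spec_dual (tau \ol lf u) p = global_section (phi p \oc u).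
  by rewrite spec_dual_comp spec_homK Gamma_map_global.
exists L, tau; split=> // X g _.
have [inv gK invK] := global_section_bij X.
pose y i : mhom A X := inv (spec_dual g (s i)).
have yE v : global_section (evaluation n y v) = spec_dual g (evaluation n s v).
  rewrite (evaluation_morph _ _ _ (global_section_additive X)).
  rewrite (evaluation_morph _ _ _ (spec_dual_additive g)).
  by apply: eq_evaluation => i _; rewrite /= invK.
have [|u [uy uU]] := zU X y.
  by move=> j; apply: (can_inj gK); rewrite !yE sab.
exists u; split=> [|u' u'g].
  apply: spec_dual_inj; apply/funext => p; rewrite dual -{2}(cP p) -yE; congr global_section.
  rewrite (evaluation_morph _ _ _ (comp_additive u)).
  by apply: eq_evaluation => i ni; apply: uy.
apply: uU => i ni; apply: (can_inj gK); rewrite invK -u'g dual; congr (global_section (_ \oc _)).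
by rewrite (phiE (fun k => (k == i : nat)%N)) evaluation_unit.
Qed.
End AffineRealization.

(** * Disjoint unions *)

Section DisjointUnion.
Variables (I : choiceType) (F : I -> lms).

Definition sum_space : topologicalType := {i : I & lms_space (F i)}.

Definition sum_inj i : continuousType (F i) sum_space :=
  mkcts (@existT_continuous I (fun i => lms_space (F i)) i).

Definition sum_part (U : opens sum_space) i : opens (F i) := preopen (sum_inj i) U.

Definition sum_sect (U : opens sum_space) : Type := forall i, \M_(F i) (sum_part U i).

HB.instance Definition _ U := gen_eqMixin (sum_sect U).
HB.instance Definition _ U := gen_choiceMixin (sum_sect U).

Section Monoid.
Variable U : opens sum_space.

Definition sum_add (s t : sum_sect U) : sum_sect U := fun i => s i + t i.

Lemma sum_addA : associative sum_add.
Proof. by move=> r s t; apply/functional_extensionality_dep => i; apply: addrA. Qed.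

Lemma sum_addC : commutative sum_add.
Proof. by move=> s t; apply/functional_extensionality_dep => i; apply: addrC. Qed.

Lemma sum_add0 : left_id (fun i => 0 : \M_(F i) (sum_part U i)) sum_add.
Proof. by move=> s; apply/functional_extensionality_dep => i; apply: add0r. Qed.

HB.instance Definition _ :=
  GRing.isNmodule.Build (sum_sect U) sum_addA sum_addC sum_add0.
End Monoid.

Section Restriction.
Variables (U V : opens sum_space) (VU : V `<=` U).

Lemma sum_part_sub i : sum_part V i `<=` sum_part U i.
Proof. by move=> x; apply: VU. Qed.

Definition sum_res (s : sum_sect U) : sum_sect V :=
  fun i => res \M_(F i) (@sum_part_sub i) (s i).

Lemma sum_res_additive : nmod_morphism sum_res.
Proof.
by split=> [|s t]; apply/functional_extensionality_dep => i;
  [apply: raddf0 | apply: raddfD].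
Qed.

HB.instance Definition _ :=
  GRing.isNmodMorphism.Build (sum_sect U) (sum_sect V) sum_res sum_res_additive.

Definition sum_res_additive_fun : {additive sum_sect U -> sum_sect V} := sum_res.
End Restriction.

Lemma sum_res_id (U : opens sum_space) (UU : U `<=` U) s : sum_res_additive_fun UU s = s.
Proof. by apply/functional_extensionality_dep => i; apply: res_id. Qed.

Lemma sum_res_res (U V W : opens sum_space) (VU : V `<=` U) (WV : W `<=` V)
  (WU : W `<=` U) s :
  sum_res_additive_fun WV (sum_res_additive_fun VU s) = sum_res_additive_fun WU s.
Proof. by apply/functional_extensionality_dep => i; apply: res_res. Qed.

Lemma sum_inj_inclusion i : is_open_inclusion (sum_inj i) (range (sum_inj i)).
Proof.
split=> // [x y e|W oW]; last exact: existT_open_map.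
exact: eq_from_Tagged e.
Qed.

Lemma sum_inj_open i : open (range (sum_inj i)).
Proof. by have [_ _] := sum_inj_inclusion i; apply; apply: openT. Qed.

Definition sum_image i (W : opens (F i)) : opens sum_space :=
  let: And3 _ _ op := sum_inj_inclusion i in Opens (op W (openP W)).

Lemma sum_imageE i (W : opens (F i)) : oset (sum_image W) = sum_inj i @` W.
Proof. by rewrite /sum_image; case: sum_inj_inclusion. Qed.

Lemma sum_part_image i (W : opens (F i)) : sum_part (sum_image W) i `<=` W.
Proof.
have [inj _ _] := sum_inj_inclusion i.
by move=> x; rewrite /sum_part /= sum_imageE => -[y Wy /inj <-].
Qed.

Lemma sum_image_part i (W : opens (F i)) : W `<=` sum_part (sum_image W) i.
Proof. by move=> x Wx; rewrite /sum_part /= sum_imageE; exists x. Qed.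

Lemma sum_glue (K : small) (U : opens sum_space) (V : K -> opens sum_space)
    (VU : forall k, V k `<=` U) : U `<=` \bigcup_k V k ->
  forall s : (forall k, sum_sect (V k)),
  (forall k l (W : opens sum_space) (Wk : W `<=` V k) (Wl : W `<=` V l),
     sum_res_additive_fun Wk (s k) = sum_res_additive_fun Wl (s l)) ->
  exists! t : sum_sect U, forall k, sum_res_additive_fun (VU k) t = s k.
Proof.
move=> cov s compat.
have ex i : exists! t : \M_(F i) (sum_part U i),
    forall k, res \M_(F i) (@sum_part_sub _ _ (VU k) i) t = s k i.
  apply: sheaf_glue => [x /cov [k _ Vx]|k l W Wk Wl]; first by exists k.
  have iW k' : W `<=` sum_part (V k') i -> sum_image W `<=` V k'.
    by move=> Wk' y; rewrite sum_imageE => -[x /Wk' Vx <-].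
  have := compat k l (sum_image W) (iW _ Wk) (iW _ Wl).
  move=> /(congr1 (fun r : sum_sect (sum_image W) => res \M_(F i) (@sum_image_part i W) (r i))).
  rewrite [LHS]res_trans [RHS]res_trans => e.
  exact: etrans (res_irr _ _ _) (etrans e (res_irr _ _ _)).
exists (fun i => sval (cid (ex i))); split=> [k|t tE].
  by apply/functional_extensionality_dep => i; case: (svalP (cid (ex i))) => tE _; apply: tE.
apply/functional_extensionality_dep => i; case: (svalP (cid (ex i))) => _; apply => k.
by rewrite -(tE k).
Qed.

Definition sum_sheaf : sheaf sum_space :=
  @Sheaf sum_space (fun U => sum_sect U : nmodType)
    (fun U V VU => sum_res_additive_fun VU) sum_res_id sum_res_res sum_glue.

Definition lms_sum : lms := Lms sum_sheaf.

Section Injection.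
Variable i : I.

Definition sum_comap (U : opens (F i)) (W : opens sum_space) (UW : U `<=` sum_inj i @^-1` W)
  (s : sum_sect W) : \M_(F i) U := @res _ \M_(F i) (sum_part W i) U UW (s i).

Lemma sum_comap_additive (U : opens (F i)) (W : opens sum_space)
  (UW : U `<=` sum_inj i @^-1` W) :
  nmod_morphism (@sum_comap U W UW).
Proof. by split=> [|s t]; [apply: raddf0 | apply: raddfD]. Qed.

Lemma sum_comap_res (U U' : opens (F i)) (W W' : opens sum_space)
    (UW : U `<=` sum_inj i @^-1` W) (U'W' : U' `<=` sum_inj i @^-1` W') (U'U : U' `<=` U)
    (WW' : W `<=` W') (s : sum_sect W') :
  sum_comap U'W' s = res \M_(F i) U'U (sum_comap UW (sum_res WW' s)).
Proof. by rewrite /sum_comap /sum_res !res_trans; apply: res_irr. Qed.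

Definition sum_comorphism : @comorphism (F i) lms_sum (sum_inj i) :=
  @Comorphism (F i) lms_sum (sum_inj i) sum_comap sum_comap_additive sum_comap_res.

Lemma sum_extend (W : opens (F i)) (t : \M_(F i) W) : exists2 s : sum_sect (sum_image W),
  res \M_(F i) (@sum_image_part i W) (s i) = t & forall k, k <> i -> s k = 0.
Proof.
pose t' := res \M_(F i) (@sum_part_image i W) t.
pose s : sum_sect (sum_image W) := fun k => if pselect (i = k) is left e then
  eq_rect i (fun k => \M_(F k) (sum_part (sum_image W) k)) t' k e else 0.
exists s => [|k ki]; rewrite /s.
  case: pselect => // e; rewrite (Prop_irrelevance e erefl) /=.
  by rewrite res_trans res_id.
by case: pselect => // e; case: ki.
Qed.

Lemma sum_image_empty (W : opens (F i)) k x : k <> i -> ~ oset (sum_part (sum_image W) k) x.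
Proof.
by move=> ki; rewrite /sum_part /= sum_imageE => -[y _ e]; case: ki; case: e.
Qed.

Lemma sum_local x : local_hom (stalk_map sum_comorphism (x := x)).
Proof.
apply/local_germP => U W UW Ux Wx s /germ_unitP [V [Vx [VU [t u]]]].
have VW : sum_image V `<=` W.
  by rewrite sum_imageE => _ [y /VU /UW Wy <-].
apply/germ_unitP; exists (sum_image V); split; first by rewrite sum_imageE; exists x.
have [r rt r0] := sum_extend t; exists VW, r.
apply/functional_extensionality_dep => k; have [ki|ki] := pselect (k = i).
  case: _ / (esym ki) => {ki}.
  apply: sheaf_sep => y /sum_part_image Vy; exists V; split=> //.
  exists (@sum_image_part i V); rewrite raddf0 -[RHS]u raddfD; congr (_ + _) => //.
  by rewrite /= /sum_comap /sum_res !res_trans; apply: res_irr.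
by apply: sheaf_sep => y /(sum_image_empty ki).
Qed.

Definition sum_hom : lms_hom (F i) lms_sum := LmsHom sum_local.

Definition sum_summand : opens sum_space := Opens (@sum_inj_open i).

Lemma sum_represents : lms_represents (sum_summand : set lms_sum) sum_hom.
Proof.
pose jU : is_open_inclusion (lms_map sum_hom) sum_summand := sum_inj_inclusion i.
apply: (lms_represents_crit (jU := jU)) => W.
pose g (t : \M_(F i) W) : sum_sect (sum_image W) := s2val (cid2 (sum_extend t)).
have gE (t : \M_(F i) W) : res \M_(F i) (@sum_image_part i W) (g t i) = t.
  by rewrite /g; case: cid2.
exists (g : _ -> \M_lms_sum (image_open jU W)) => [s|t]; last first.
  by rewrite -[RHS]gE; apply: res_irr.
apply/functional_extensionality_dep => k; have [ki|ki] := pselect (k = i).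
  case: _ / (esym ki) => {ki}.
  apply: sheaf_sep => y /sum_part_image Wy; exists W; split=> //.
  by exists (@sum_image_part i W); rewrite gE; apply: res_irr.
by apply: sheaf_sep => y /(sum_image_empty ki).
Qed.
End Injection.

Lemma sum_cover x : exists i, oset (sum_summand i) x.
Proof. by case: x => i x; exists i, x. Qed.

Lemma sum_disjoint i k x : oset (sum_summand i) x -> oset (sum_summand k) x -> i = k.
Proof. by move=> [y _ <-] [z _ e]; case: e. Qed.
End DisjointUnion.

(** Morphisms on the members glue without any condition, as an object mapping to two
    different members has no points. *)
Lemma lms_coproduct (Y : lms) (I : small) (O : I -> opens Y) (F : I -> lms)
    (q : forall i, lms_hom (F i) Y) :
  (forall i, lms_represents (O i) (q i)) -> (forall y, exists i, oset (O i) y) ->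
  (forall i k y, oset (O i) y -> oset (O k) y -> i = k) ->
  @is_coproduct LMS I F Y q.
Proof.
move=> rq cov disj Z f; apply: (lms_glue rq cov) => i k T a b ab.
have [ik|ik] := pselect (i = k).
  by case: k / ik b ab => b /(lms_represents_mono (rq i)) ->.
apply: lms_hom_empty => x; apply: ik; apply: (disj i k (lms_map (q i \ol a) x)).
  by apply: (rq i).1; exists (lms_map a x).
by rewrite ab; apply: (rq k).1; exists (lms_map b x).
Qed.

(** * Fans *)

Lemma lms_represents_id (X : lms) : lms_represents (opensT X) (idm (X : LMS) : lms_hom X X).
Proof. by apply: lms_is_iso_represents; exists (idm (X : LMS)); rewrite (@comp1m LMS). Qed.

(** Charts as open embeddings of spectra, which compose, instead of isomorphisms with
    restrictions. *)
Lemma locally_specP (Q : nmodType -> Prop) (X : lms) : locally_spec Q X <->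
  forall x : X, exists (U : opens X) (P : nmodType) (k : lms_hom (Spec P) X),
    [/\ oset U x, Q P & lms_represents U k].
Proof.
split=> loc x.
  have [U [Ux [P [QP [f [g [gf fg]]]]]]] := loc x.
  exists U, P, (restr_incl U \ol g); split=> //.
  by apply: lms_represents_comp_iso (restr_represents U) _; exists f.
have [U [P [k [Ux QP rk]]]] := loc x; exists U; split=> //; exists P; split=> //.
by have [f] := lms_represents_iso rk (restr_represents U); exists f.
Qed.

Lemma locally_spec_cover (Q : nmodType -> Prop) (X : lms) (I : Type) (U : I -> opens X)
    (F : I -> lms) (j : forall i, lms_hom (F i) X) :
  (forall i, lms_represents (U i) (j i)) -> (forall x, exists i, oset (U i) x) ->
  (forall i, locally_spec Q (F i)) -> locally_spec Q X.
Proof.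
move=> rj cov loc; apply/locally_specP => x; have [i Ux] := cov x.
have [_ jU op] := lms_represents_inclusion (rj i).
move: Ux; rewrite -[X in X _]jU => -[y _ <-].
have /locally_specP /(_ y) [W [P [k [Wy QP rk]]]] := loc i.
exists (Opens (op W (openP W))), P, (j i \ol k); split=> //; first by exists y.
exact: lms_represents_comp (rj i) rk.
Qed.

Lemma Spec_locally_spec (Q : nmodType -> Prop) (P : nmodType) :
  Q P -> locally_spec Q (Spec P).
Proof.
move=> QP; apply/locally_specP => x; exists (opensT _), P, (idm (Spec P)).
by split=> //; apply: lms_represents_id.
Qed.

(** The disjoint union is again a fan, so it is the coproduct in the category of fans
    and isomorphic to [Y]. *)
Lemma fan_coproduct (Q : nmodType -> Prop) (I : small)
    (F : I -> full_sub (locally_spec Q)) (Y : full_sub (locally_spec Q))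
    (q : forall i, hom (F i) Y) : is_coproduct q ->
  exists O : I -> opens (lms_space (sval Y)),
    [/\ forall i, lms_represents (O i) (q i : lms_hom _ _),
        forall y, exists i, oset (O i) y &
        forall i k y, oset (O i) y -> oset (O k) y -> i = k].
Proof.
move=> cop; pose I' : choiceType := {classic I}.
pose S := @lms_sum I' (fun i => sval (F i) : lms).
pose F' (i : I') : lms := sval (F i).
have rS (i : I') : @lms_represents S _ (sum_summand F' i) (sum_hom F' i) := sum_represents F' i.
have QS : locally_spec Q S.
  by apply: (locally_spec_cover rS (@sum_cover _ _)) => i; exact: svalP (F i).
pose S' : full_sub (locally_spec Q) := exist _ (S : LMS) QS.
have copS := @lms_coproduct S I' _ _ _ rS (@sum_cover _ _) (@sum_disjoint _ _).
have [u [uq _]] := copS (sval Y) (fun i => q i).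
have [v [vs _]] := cop S' (fun i => sum_hom _ (i : I')).
have vu : v \ol u = idm (S : LMS).
  have [w [_ wU]] := copS S (fun i => sum_hom _ i).
  rewrite -(wU (idm (S : LMS))) => [|i]; last exact: (@comp1m LMS).
  by apply/esym/wU => i; rewrite -(@compA LMS) uq; apply: vs.
have uv : u \ol v = idm (sval Y : LMS).
  have [w [_ wU]] := cop Y q.
  have e1 : w = idm Y by apply: wU => i; exact: (@comp1m LMS).
  apply: etrans e1; apply/esym/wU => i.
  by transitivity (u \ol (v \ol q i)); [apply/esym/(@compA LMS)|rewrite [_ \ol q i]vs uq].
have ru : lms_represents (opensT _) (u : lms_hom S (sval Y)).
  by apply: lms_is_iso_represents; exists v.
have [inj _ op] := lms_represents_inclusion ru.
exists (fun i : I' => Opens (op _ (openP (sum_summand _ i)))); split=> [i|y|i k y].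
- by have := lms_represents_comp ru (rS i); rewrite uq.
- have [i Oi] := sum_cover (lms_map (v : lms_hom _ _) y); exists i.
  exists (lms_map (v : lms_hom _ _) y) => //.
  by change (lms_map (u \ol v) y = y); rewrite uv.
- by move=> /= [z Oz <-] [w Ow /inj wz]; apply: sum_disjoint Oz _; rewrite -wz.
Qed.

(** * Finite limits of fans *)

(** What finite limits require of the class [Q] of monoids whose spectra model the fans:
    finitely many coordinate monoids and finitely many inverses have to lie in one
    submonoid [N] of [G] that belongs to [Q]. *)
Definition generates_submonoids (Q : nmodType -> Prop) : Prop :=
  forall (A B : Type) (P : A -> nmodType) (G : nmodType) (phi : forall a, P a -> G)
    (g : B -> G), finite_type A -> finite_type B -> (forall a, Q (P a)) ->
    (forall a, nmod_morphism (phi a)) ->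
  exists (N : nmodType) (iota : N -> G), [/\ Q N, nmod_morphism iota, injective iota,
    forall a p, exists m, iota m = phi a p & forall b, exists m, iota m = g b].

Lemma all_generates_submonoids : generates_submonoids (fun _ => True).
Proof.
move=> A B P G phi g _ _ _ _; exists G, id; split=> // [a p|b]; first by exists (phi a p).
by exists (g b).
Qed.

(* The submonoid of [G] generated by [s] is encoded as the quotient of the vectors of
   multiplicities by equality of their values in [G]. *)
Section GeneratedSubmonoid.
Variables (G : nmodType) (s : seq G).

Let ev (v : nat -> nat) : G := evaluation (size s) (nth 0 s) v.

Let gen_eq v w := ev v = ev w.

Let evD v w : ev (fun i => v i + w i)%N = ev v + ev w.
Proof. exact: evaluationD. Qed.

Let gen_congr v v' w : gen_eq v v' ->
  gen_eq (fun i => v i + w i)%N (fun i => v' i + w i)%N.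
Proof. by rewrite /gen_eq !evD => ->. Qed.

Let gen_addA u v w :
  gen_eq (fun i => u i + (v i + w i))%N (fun i => (u i + v i) + w i)%N.
Proof. by apply: evaluation_agree => i _; apply: addnA. Qed.

Let gen_addC v w : gen_eq (fun i => v i + w i)%N (fun i => w i + v i)%N.
Proof. by apply: evaluation_agree => i _; apply: addnC. Qed.

Let gen_add0 v : gen_eq (fun i => 0 + v i)%N v.
Proof. by []. Qed.

Definition generated_presentation : monoid_presentation :=
  @MonoidPresentation (nat -> nat) gen_eq (fun _ => 0%N) (fun v w i => v i + w i)%N
    (fun _ => erefl) (fun _ _ => @esym _ _ _) (fun _ _ _ => @etrans _ _ _ _)
    gen_congr gen_addA gen_addC gen_add0.

Definition generated : nmodType := mquot generated_presentation.

Definition generated_incl (c : generated) : G := ev (mrepr c).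

Let inclE v : generated_incl (mclass (v : generated_presentation)) = ev v.
Proof. exact: (mrepr_eq (v : generated_presentation)). Qed.

Lemma generated_incl_inj : injective generated_incl.
Proof. by move=> c d e; rewrite -(mreprK c) -(mreprK d); apply/mclassP. Qed.

Lemma generated_incl_additive : nmod_morphism generated_incl.
Proof.
split=> [|c d]; first by rewrite [LHS]inclE; apply: evaluation0.
by rewrite [LHS]inclE [LHS]evD.
Qed.

Lemma generated_gens x : x \in s -> exists c, generated_incl c = x.
Proof.
move=> /(nthP 0) [i ni <-].
exists (mclass ((fun k => (k == i : nat)%N) : generated_presentation)).
by rewrite inclE; apply: evaluation_unit.
Qed.

Lemma generated_fin_gen : fin_gen generated.
Proof.
exists (mkseq (fun i => mclass ((fun k => (k == i : nat)%N) : generated_presentation))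
  (size s)) => c; exists (mrepr c).
apply: generated_incl_inj; rewrite size_mkseq.
rewrite (evaluation_morph _ _ _ generated_incl_additive).
apply: eq_evaluation => i ni; rewrite /= nth_mkseq// inclE.
by rewrite -[LHS](@evaluation_unit _ (size s) (nth 0 s)).
Qed.
End GeneratedSubmonoid.

Lemma fin_gen_generates_submonoids : generates_submonoids fin_gen.
Proof.
move=> A B P G phi g [n [e eA]] [m [d dB]] fin phiA.
pose r a := sval (cid (fin a)).
pose s := flatten [seq map (phi (e k)) (r (e k)) | k <- enum 'I_n] ++
          [seq g (d k) | k <- enum 'I_m].
have iA := generated_incl_additive s.
exists (generated s), (@generated_incl G s); split=> //.
- exact: generated_fin_gen.
- exact: generated_incl_inj.
- move=> a p; have [k ka] := eA a; case: a / ka p => p.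
  have [v ->] := svalP (cid (fin (e k))) p; rewrite -/(r _).
  have /choice [c cE] : forall i : 'I_(size (r (e k))), exists c,
      generated_incl (s := s) c = phi (e k) (r (e k))`_i.
    move=> i; apply: generated_gens; rewrite mem_cat; apply/orP; left.
    apply/flatten_mapP; exists k; first by rewrite mem_enum.
    by apply: map_f; apply: mem_nth.
  exists (\sum_i c i *+ v i).
  have [i0 iD] := iA; have [p0 pD] := phiA (e k).
  rewrite (big_morph _ iD i0) (big_morph _ pD p0); apply: eq_bigr => i _.
  elim: (v i) => [|l IHl]; first by rewrite !mulr0n i0 p0.
  by rewrite !mulrS iD pD IHl cE.
move=> b; have [k <-] := dB b; apply: generated_gens.
by rewrite mem_cat map_f ?orbT// mem_enum.
Qed.

Section LocalFactorization.
Variable Q : nmodType -> Prop.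
Hypothesis Qsub : generates_submonoids Q.

(** The affine fan is the spectrum of a monoid [N] of sections near [x] that contains
    the pullbacks of the coordinates of a chart of each [Y a], and the inverses of some
    of these pullbacks.  The inverses keep [f b] and [f' b], composed with the charts,
    inside one chart of [Z b].  The relations then become equalities between elements of
    [N], and these hold because they hold after embedding [N] into the sections. *)
Lemma local_factor (A B : Type) (X : lms) (x : X) (Y : A -> lms) (Z : B -> lms)
    (s t : B -> A) (g : forall a, lms_hom X (Y a))
    (f : forall b, lms_hom (Y (s b)) (Z b)) (f' : forall b, lms_hom (Y (t b)) (Z b)) :
  finite_type A -> finite_type B ->
  (forall a, locally_spec Q (Y a)) -> (forall b, locally_spec Q (Z b)) ->
  (forall b, f b \ol g (s b) = f' b \ol g (t b)) ->
  exists (W : opens X) (V : lms) (w : lms_hom V X) (N : nmodType)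
    (c : lms_hom V (Spec N)) (h : forall a, lms_hom (Spec N) (Y a)),
    [/\ oset W x, lms_represents W w, Q N, forall a, h a \ol c = g a \ol w &
        forall b, f b \ol h (s b) = f' b \ol h (t b)].
Proof.
move=> finA finB QY QZ fg.
have chartY a : exists (U : opens (Y a)) (P : nmodType), exists2 k : lms_hom (Spec P) (Y a),
    oset U (lms_map (g a) x) & Q P /\ lms_represents U k.
  by have /locally_specP /(_ (lms_map (g a) x)) [U [P [k []]]] := QY a; exists U, P, k.
pose U a := sval (cid (chartY a)).
pose P a := sval (cid (svalP (cid (chartY a)))).
pose chi a : lms_hom (Spec (P a)) (Y a) := s2val (cid2 (svalP (cid (svalP (cid (chartY a)))))).
have Ux a : oset (U a) (lms_map (g a) x) := s2valP (cid2 (svalP (cid (svalP (cid (chartY a)))))).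
have [QP rchi] : (forall a, Q (P a)) /\ (forall a, lms_represents (U a) (chi a)).
  by split=> a; have [] := s2valP' (cid2 (svalP (cid (svalP (cid (chartY a)))))).
have chartZ b : exists (O : opens (Z b)) (R : nmodType), exists2 k : lms_hom (Spec R) (Z b),
    oset O (lms_map (f b \ol g (s b)) x) & lms_represents O k.
  have /locally_specP /(_ (lms_map (f b \ol g (s b)) x)) [O [R [k []]]] := QZ b.
  by exists O, R, k.
pose O b := sval (cid (chartZ b)).
pose R b := sval (cid (svalP (cid (chartZ b)))).
pose kap b : lms_hom (Spec (R b)) (Z b) := s2val (cid2 (svalP (cid (svalP (cid (chartZ b)))))).
have Ox b : oset (O b) (lms_map (f b \ol g (s b)) x) :=
  s2valP (cid2 (svalP (cid (svalP (cid (chartZ b)))))).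
have rkap b : lms_represents (O b) (kap b) :=
  s2valP' (cid2 (svalP (cid (svalP (cid (chartZ b)))))).
have [W0 [W0x W0U]] := finite_open (O := fun a => preopen (lms_map (g a)) (U a)) finA Ux.
pose w0 : lms_hom (restr W0) X := restr_incl W0.
have rw0 : lms_represents W0 w0 := restr_represents W0.
have exgam a : exists gam : lms_hom (restr W0) (Spec (P a)), chi a \ol gam = g a \ol w0.
  have [|gam [gamE _]] := (rchi a).2 _ (g a \ol w0); last by exists gam.
  by move=> _ [y _ <-]; apply: (W0U a); apply: set_valP.
pose gam a := sval (cid (exgam a)).
have gamE a : chi a \ol gam a = g a \ol w0 := svalP (cid (exgam a)).
pose x0 : restr W0 := SigSub (mem_set W0x).
(* the basic open set of [p] is sent by [k] into the chart of [Z b], and the pullback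
   of [p] is invertible near [x0] *)
have near a b (k : lms_hom (Y a) (Z b)) : oset (O b) (lms_map (k \ol g a) x) ->
    exists p : P a, ~ pr (lms_map (gam a) x0 : prime_ideal _) p /\
      basic_open p `<=` lms_map (k \ol chi a) @^-1` O b.
  move=> kx; have oW : open (lms_map (k \ol chi a) @^-1` O b).
    by apply: (continuousP _).1; [exact: cts_fun | exact: openP].
  have : spec_open (lms_map (k \ol chi a) @^-1` O b) := oW.
  apply; change (oset (O b) (lms_map k (lms_map (chi a \ol gam a) x0))).
  by rewrite gamE.
have exp b : exists p, ~ pr (lms_map (gam (s b)) x0 : prime_ideal _) p /\
    basic_open p `<=` lms_map (f b \ol chi (s b)) @^-1` O b by exact: near.
have exp' b : exists p, ~ pr (lms_map (gam (t b)) x0 : prime_ideal _) p /\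
    basic_open p `<=` lms_map (f' b \ol chi (t b)) @^-1` O b.
  by apply: near; rewrite -fg.
pose p b := sval (cid (exp b)); pose p' b := sval (cid (exp' b)).
have [px pO] : (forall b, ~ pr (lms_map (gam (s b)) x0 : prime_ideal _) (p b)) /\
    (forall b, basic_open (p b) `<=` lms_map (f b \ol chi (s b)) @^-1` O b).
  by split=> b; have [] := svalP (cid (exp b)).
have [p'x p'O] : (forall b, ~ pr (lms_map (gam (t b)) x0 : prime_ideal _) (p' b)) /\
    (forall b, basic_open (p' b) `<=` lms_map (f' b \ol chi (t b)) @^-1` O b).
  by split=> b; have [] := svalP (cid (exp' b)).
(* a sum is invertible when both terms are, so one inverse for each [b] suffices *)
pose sig b := spec_dual (gam (s b)) (p b) + spec_dual (gam (t b)) (p' b).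
have exV b : exists V : opens (restr W0), oset V x0 /\
    exists VT : V `<=` opensT _, munit (res \M_(restr W0) VT (sig b)).
  have : munit (stalk_of x0 (sig b)).
    rewrite /stalk_of germD munitD; split; apply: contrapT.
      by move=> /spec_dual_pr; apply: px.
    by move=> /spec_dual_pr; apply: p'x.
  by move=> /germ_unitP.
pose VV b := sval (cid (exV b)).
have VVx b : oset (VV b) x0 by have [] := svalP (cid (exV b)).
have [W1 [W1x W1V]] := finite_open finB VVx.
pose w1 : lms_hom (restr W1) (restr W0) := restr_incl W1.
have rw1 : lms_represents W1 w1 := restr_represents W1.
have sigu b : munit (Gamma_map w1 (sig b)).
  have [_ [VT [r ur]]] := svalP (cid (exV b)).
  have WV : opensT (restr W1) `<=` lms_map w1 @^-1` VV b.
    by move=> y _; apply: (W1V b); apply: set_valP.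
  exists (comap (lms_comap w1) WV r).
  by rewrite /Gamma_map -(comap_resr _ WV _ VT) -raddfD ur raddf0.
have [W [Ww Wx]] : exists W : opens X, oset W = lms_map w0 @` W1 /\ oset W x.
  have [_ _ op] := lms_represents_inclusion rw0.
  by exists (Opens (op W1 (openP W1))); split=> //; exists x0.
pose phi a := spec_dual (gam a \ol w1).
have phiA a : nmod_morphism (phi a) by apply: spec_dual_additive.
have [N [iota [QN iA inj imP imB]]] := Qsub (fun b => sval (cid (sigu b))) finA finB QP phiA.
pose psi a q := sval (cid (imP a q)).
have psiE a q : iota (psi a q) = phi a q := svalP (cid (imP a q)).
have psiA a : nmod_morphism (psi a).
  have [i0 iD] := iA; have [f0 fD] := phiA a.
  by split=> [|q q']; apply: inj; rewrite ?iD !psiE ?f0 ?fD ?i0.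
pose c := spec_hom iA; pose h a := chi a \ol spec_map (psiA a).
have hc a : h a \ol c = g a \ol (w0 \ol w1).
  rewrite /h -(@compA LMS) (@compA LMS _ _ _ _ (g a)) -gamE -(@compA LMS).
  congr (_ \ol _); apply: spec_dual_inj; apply/funext => q.
  by rewrite spec_dual_map spec_homK psiE.
have psiu b : munit (psi (s b) (p b)) /\ munit (psi (t b) (p' b)).
  apply/munitD; have [m mE] := imB b; exists m; apply: inj.
  have [i0 iD] := iA; rewrite !iD !psiE mE i0 /phi !spec_dual_comp.
  rewrite -(Gamma_map_additive w1).2; exact: svalP (cid (sigu b)).
exists W, (restr W1), (w0 \ol w1), N, c, h; split=> // [|b].
  by rewrite Ww; exact: lms_represents_comp rw0 rw1.
have lands a b' (k : lms_hom (Y a) (Z b')) q : munit (psi a q) ->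
    basic_open q `<=` lms_map (k \ol chi a) @^-1` O b' ->
    exists m : lms_hom (Spec N) (Spec (R b')), kap b' \ol m = k \ol h a.
  move=> uq qO; have [|m [mE _]] := (rkap b').2 _ (k \ol h a); last by exists m.
  move=> _ [y _ <-]; apply: (qO (lms_map (spec_map (psiA a)) y)).
  by apply: spec_map_basic uq _ _; exists y.
have [m mE] := lands _ _ (f b) _ (psiu b).1 (pO b).
have [m' m'E] := lands _ _ (f' b) _ (psiu b).2 (p'O b).
rewrite -mE -m'E; congr (_ \ol _); apply: spec_dual_inj; apply/funext => q.
have [n e] := spec_elt_surj (spec_dual m q); have [n' e'] := spec_elt_surj (spec_dual m' q).
rewrite e e'; congr spec_elt; apply: inj.
have iotaE k : iota k = Gamma_map c (spec_elt k) by rewrite -[iota](spec_homK iA).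
rewrite !iotaE -e -e' -!spec_dual_comp; congr (spec_dual _ q).
apply: (lms_represents_mono (rkap b)).
transitivity (f b \ol (h (s b) \ol c)); first by rewrite (@compA LMS) mE [RHS](@compA LMS).
rewrite hc (@compA LMS) fg -(@compA LMS) -hc.
by rewrite (@compA LMS) [RHS](@compA LMS) m'E.
Qed.
End LocalFactorization.

Section FiniteLimits.
Variable Q : nmodType -> Prop.
Hypothesis Qsub : generates_submonoids Q.
Local Notation fans := (full_sub (locally_spec Q)).

(** Cones from an arbitrary [X] factor locally through cones from affine fans, which
    lift to [L]; likewise two morphisms to [L] with the same components factor locally
    through two such morphisms from an affine fan, which are equal.  Finiteness of the
    diagram makes the local factorizations exist. *)
Lemma fan_finite_limit (J : category) (D : functor J fans) (L : fans)
    (p : forall j, hom L (D j)) : finite_category J -> is_limit p ->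
  @is_limit J LMS (comp_functor (full_incl (locally_spec Q)) D)
    (full_incl (locally_spec Q) L) (fun j => fmor (full_incl (locally_spec Q)) (p j)).
Proof.
move=> [finJ finhom] [pc pU].
pose pl j : lms_hom (sval L) (sval (D j)) := p j.
have uniq (T : lms) (u v : lms_hom T (sval L)) :
    (forall j, pl j \ol u = pl j \ol v) -> u = v.
  move=> puv; pose g (b : bool) := if b then u else v.
  have loc x : exists (W : opens T) (V : lms) (w : lms_hom V T),
      [/\ oset W x, lms_represents W w & u \ol w = v \ol w].
    have [W [V [w [N [c [h [Wx rw QN hc ph]]]]]]] := @local_factor Q Qsub bool J T x
      (fun _ => sval L) (fun j => sval (D j)) (fun _ => true) (fun _ => false) g pl pl
      finite_type_bool finJ (fun _ => svalP L) (fun j => svalP (D j)) puv.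
    exists W, V, w; split=> //.
    pose N' : fans := exist _ (Spec N : LMS) (Spec_locally_spec QN).
    have [|k [_ kU]] := pU N' (fun j => p j \oc (h true : hom N' L)).
      by move=> i j a; rewrite compA pc.
    have e : h true = h false.
      transitivity (k : lms_hom (Spec N) (sval L)); first by apply/esym/kU.
      by apply: kU => j; apply/esym/ph.
    by rewrite -[u \ol w](hc true) -[v \ol w](hc false) e.
  pose W x := sval (cid (loc x)); pose V x := sval (cid (svalP (cid (loc x)))).
  pose w x : lms_hom (V x) T := sval (cid (svalP (cid (svalP (cid (loc x)))))).
  have wP x : [/\ oset (W x) x, lms_represents (W x) (w x) & u \ol w x = v \ol w x].
    exact: svalP (cid (svalP (cid (svalP (cid (loc x)))))).
  apply: (@lms_local_eq T _ T W V w) => [x|x|x]; first by case: (wP x).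
    by exists x; case: (wP x).
  by case: (wP x).
split=> [i j a|X g gc]; first exact: pc.
pose gl j : lms_hom X (sval (D j)) := g j.
pose B := {i : J & {j : J & hom i j}}.
have finB : finite_type B.
  by apply: finite_type_sigma => // i; apply: finite_type_sigma.
have loc x : exists (W : opens (lms_space X)) (V : lms) (w : lms_hom V X) (k : lms_hom V (sval L)),
    [/\ oset W x, lms_represents W w & forall j, pl j \ol k = gl j \ol w].
  have [b|W [V [w [N [c [h [Wx rw QN hc Dh]]]]]]] := @local_factor Q Qsub J B X x
    (fun j => sval (D j)) (fun b => sval (D (projT1 (projT2 b)))) (fun b => projT1 b)
    (fun b => projT1 (projT2 b)) gl (fun b => fmor D (projT2 (projT2 b)))
    (fun b => @idm LMS (sval (D (projT1 (projT2 b))))) finJ finB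
    (fun j => svalP (D j)) (fun b => svalP (D _)) _.
    exact: etrans (gc _ _ _) (esym (@comp1m LMS _ _ _)).
  pose N' : fans := exist _ (Spec N : LMS) (Spec_locally_spec QN).
  have [|k [kh _]] := pU N' (fun j => h j : hom N' (D j)).
    move=> i j a; exact: etrans (Dh (existT _ i (existT _ j a))) (@comp1m LMS _ _ _).
  exists W, V, w, ((k : lms_hom (Spec N) (sval L)) \ol c); split=> // j.
  by rewrite (@compA LMS) -hc -kh.
pose W x := sval (cid (loc x)); pose V x := sval (cid (svalP (cid (loc x)))).
pose w x : lms_hom (V x) X := sval (cid (svalP (cid (svalP (cid (loc x)))))).
pose k x : lms_hom (V x) (sval L) := sval (cid (svalP (cid (svalP (cid (svalP (cid (loc x)))))))).
have P x : [/\ oset (W x) x, lms_represents (W x) (w x) &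
    forall j, pl j \ol k x = gl j \ol w x].
  exact: svalP (cid (svalP (cid (svalP (cid (svalP (cid (loc x)))))))).
have rw x : lms_represents (W x) (w x) by case: (P x).
have Wcov x : exists y, oset (W y) x by exists x; case: (P x).
have pk x j : pl j \ol k x = gl j \ol w x by case: (P x).
have [|u [uk _]] := @lms_glue X (sval L) X W V w rw Wcov k.
  move=> x y T a b ab; apply: uniq => j.
  by rewrite !(@compA LMS) !pk -!(@compA LMS) ab.
exists u; split=> [j|u' u'g].
  apply: (lms_local_eq rw Wcov) => x.
  by transitivity (pl j \ol (u \ol w x)); [apply/esym/(@compA LMS)|rewrite uk pk].
apply: uniq => j; rewrite [RHS]u'g; apply: (lms_local_eq rw Wcov) => x.
by transitivity (pl j \ol (u \ol w x)); [apply/esym/(@compA LMS)|rewrite uk pk].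
Qed.
End FiniteLimits.

(** * The realization functor *)

Section RealizationProperties.
Variable E : category_of_spaces.
Local Notation "'lf' u" := (lms_of_map u) (at level 10, u at level 9).

Lemma realizable_representable (Y : LMS) :
  @realizable E Y setT <-> representable (A_presheaf E Y).
Proof.
split=> -[Z [tau rtau]]; exists Z, tau; first exact/realizes_universal.
exact/(realizes_universal (tau : lms_hom _ _)).
Qed.

Lemma fan_representable (Q : nmodType -> Prop) (Y : LMS) :
  (forall P, Q P -> @realizable E (Spec P) setT) -> locally_spec Q Y ->
  representable (A_presheaf E Y).
Proof.
move=> Qreal /locally_specP loc; apply/realizable_representable/realizable_cover => y.
have [U [P [k [Uy QP rk]]]] := loc y; exists U; split=> //.
by apply/(realizable_represents E rk)/Qreal.
Qed.

Variables (K : LMS -> Prop) (R : forall Y : full_sub K, representation (A_presheaf E (sval Y))).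

Let AR := A_functor R.
Let tau Y : lms_hom (lms_of (AR Y)) (sval Y) := A_tau R Y.

Let rtau Y : realizes setT (tau Y).
Proof. exact/realizes_universal/rep_univ. Qed.

Let tauE (Y Y' : full_sub K) (f : hom Y Y') :
  tau Y' \ol lf (fmor AR f) = (f : lms_hom _ _) \ol tau Y.
Proof. exact: A_mapE. Qed.

Let realizes_open (Y Y' : full_sub K) (f : hom Y Y') (O : opens (lms_space (sval Y'))) :
  lms_represents O (f : lms_hom _ _) -> realizes O ((f : lms_hom _ _) \ol tau Y).
Proof. by move=> rf; apply: realizes_represents rf _. Qed.

(** The coproduct of the realizations of the [F i] realizes the union of the [O i], which
    is [Y], and realizations are unique. *)
Lemma realization_coproduct (I : small) (F : I -> full_sub K) (Y : full_sub K)
    (q : forall i, hom (F i) Y) (O : I -> opens (lms_space (sval Y))) :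
  (forall i, lms_represents (O i) (q i : lms_hom _ _)) ->
  (forall y, exists i, oset (O i) y) ->
  (forall i k y, oset (O i) y -> oset (O k) y -> i = k) ->
  is_coproduct (fun i => fmor AR (q i)).
Proof.
move=> rq cov disj; have [S [s cop]] := esp_coproducts (fun i => AR (F i)).
have [t [ts [_ tU]]] := realizes_coproduct (fun i => realizes_open (rq i)) disj cop.
have [u [ut _]] := (rtau Y).2 _ t (fun _ _ => Logic.I).
have us i : u \oc s i = fmor AR (q i).
  by apply: (realizes_mono (rtau Y)); rewrite tauE lms_of_mapM (@compA LMS) ut ts.
have [|v [vt _]] := tU _ (tau Y).
  by move=> y _; have [i Oy] := cov y; exists i.
have rt : realizes (\bigcup_i O i) t.
  by split=> // y _; have [i Oy] := cov y; exists i.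
have vu : v \oc u = idm S.
  by apply: (realizes_mono rt); rewrite lms_of_mapM (@compA LMS) vt ut lms_of_map1 (@compm1 LMS).
have uv : u \oc v = idm _.
  apply: (realizes_mono (rtau Y)).
  by rewrite lms_of_mapM (@compA LMS) ut vt lms_of_map1 (@compm1 LMS).
move=> Z f; have [h [hs hU]] := cop Z f.
exists (h \oc v); split=> [i|h' h'f].
  by rewrite -us compA -(compA h) vu compm1 hs.
rewrite (hU (h' \oc u)) => [|i]; first by rewrite -compA uv compm1.
by rewrite -compA us h'f.
Qed.

(** The realization functor is a partial right adjoint of [X |-> |X|]. *)
Lemma realization_limit (J : category) (D : functor J (full_sub K)) (L : full_sub K)
    (p : forall j, hom L (D j)) : is_cone p ->
  @is_limit J LMS (comp_functor (full_incl K) D) (full_incl K L)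
    (fun j => fmor (full_incl K) (p j)) ->
  @is_limit J E (comp_functor AR D) (AR L) (fun j => fmor AR (p j)).
Proof.
move=> pc [_ pU]; split=> [i j a|X p' p'c].
  by rewrite -[RHS](congr1 (fmor AR) (pc i j a)) fmorM.
have [|k [kE kU]] := pU (lms_of X) (fun j => tau (D j) \ol lf (p' j)).
  move=> i j a; transitivity ((tau (D j) \ol lf (fmor AR (fmor D a))) \ol lf (p' i)).
    by rewrite tauE; exact: (@compA LMS).
  rewrite -(@compA LMS) -lms_of_mapM; congr (_ \ol lf _); exact: p'c.
have [u [uk uU]] := (rtau L).2 _ k (fun _ _ => Logic.I).
have pE j (v : hom X (AR L)) :
    tau (D j) \ol lf (fmor AR (p j) \oc v) = (p j : lms_hom _ _) \ol (tau L \ol lf v).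
  by rewrite lms_of_mapM (@compA LMS) tauE (@compA LMS).
exists u; split=> [j|u' u'p].
  by apply: (realizes_mono (rtau (D j))); rewrite pE uk; apply: kE.
by apply: uU; apply/esym/kU => j; rewrite -u'p pE.
Qed.

Lemma realization_open_embedding (U Y : full_sub K) (f : hom U Y) :
  lms_open_embedding (fmor (full_incl K) f) ->
  open_embedding (und E) (fmor AR f) /\
  range (und_map (und E) (fmor AR f)) =
    lms_map (A_tau R Y) @^-1` range (lms_map (fmor (full_incl K) f)).
Proof.
move=> /lms_open_embeddingP [O rO]; have := realizes_open rO; rewrite -tauE => rU.
have rj := (realizes_sub (rtau Y) (fmor AR f) (fun _ _ => Logic.I)).2 rU.
pose O' : opens (und_space (und E) (AR Y)) := preopen (lms_map (tau Y)) O.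
have rj' : represents_open O' (fmor AR f) := rj.
split; first by exists O'.
have [_ -> _] := represents_inclusion rj'.
by rewrite (lms_represents_range rO).
Qed.
End RealizationProperties.

Section RealizationOfFans.
Variables (E : category_of_spaces) (Q : nmodType -> Prop).
Hypothesis Qsub : generates_submonoids Q.
Local Notation K := (locally_spec Q).
Variable R : forall Y : full_sub K, representation (A_presheaf E (sval Y)).

Lemma fan_realization_properties :
  (forall (I : small) (F : I -> full_sub K) (Y : full_sub K)
     (q : forall i, hom (F i) Y),
     is_coproduct q -> is_coproduct (fun i => fmor (A_functor R) (q i))) /\
  (forall (J : category) (D : functor J (full_sub K)) (L : full_sub K)
     (p : forall j, hom L (D j)),
     is_limit p ->
     finite_category J \/
       @is_limit J LMS (comp_functor (full_incl K) D) (full_incl K L)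
         (fun j => fmor (full_incl K) (p j)) ->
     @is_limit J E (comp_functor (A_functor R) D) (A_functor R L)
       (fun j => fmor (A_functor R) (p j))) /\
  (forall (U Y : full_sub K) (f : hom U Y),
     lms_open_embedding (fmor (full_incl K) f) ->
     open_embedding (und E) (fmor (A_functor R) f) /\
     range (und_map (und E) (fmor (A_functor R) f)) =
       lms_map (A_tau R Y) @^-1` range (lms_map (fmor (full_incl K) f))).
Proof.
split=> [I F Y q cop|]; last split=> [J D L p lim fin|U Y f].
- have [O [rq cov disj]] := fan_coproduct cop.
  exact: realization_coproduct rq cov disj.
- apply: realization_limit; first by case: lim.
  by case: fin => // finJ; apply: fan_finite_limit.
- exact: realization_open_embedding.
Qed.
End RealizationOfFans.

Theorem theorem4p5p11 (E : category_of_spaces) :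
  (forall Y : LMS, is_lft_fan Y -> representable (A_presheaf E Y)) /\
  ((forall P : nmodType, representable (A_presheaf E (Spec P))) ->
     forall Y : LMS, is_fan Y -> representable (A_presheaf E Y)) /\
  (forall K : LMS -> Prop,
     (K = is_lft_fan \/
      (K = is_fan /\
       forall P : nmodType, representable (A_presheaf E (Spec P)))) ->
   forall R : (forall Y : full_sub K, representation (A_presheaf E (sval Y))),
     (forall (I : small) (F : I -> full_sub K) (Y : full_sub K)
        (q : forall i, hom (F i) Y),
        is_coproduct q -> is_coproduct (fun i => fmor (A_functor R) (q i))) /\
     (* Limits that are finite or computed in LMS: infinite limits that exist
        among fans need not be limits in LMS, and are then not preserved. *)
     (forall (J : category) (D : functor J (full_sub K)) (L : full_sub K)
        (p : forall j, hom L (D j)),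
        is_limit p ->
        finite_category J \/
          @is_limit J LMS (comp_functor (full_incl K) D) (full_incl K L)
            (fun j => fmor (full_incl K) (p j)) ->
        @is_limit J E (comp_functor (A_functor R) D) (A_functor R L)
          (fun j => fmor (A_functor R) (p j))) /\
     (forall (U Y : full_sub K) (f : hom U Y),
        lms_open_embedding (fmor (full_incl K) f) ->
        open_embedding (und E) (fmor (A_functor R) f) /\
        range (und_map (und E) (fmor (A_functor R) f)) =
          lms_map (A_tau R Y) @^-1` range (lms_map (fmor (full_incl K) f)))).
Proof.
split=> [Y|]; last split=> [rep Y|K [->|[-> _]] R].
- by apply: fan_representable => P; apply: spec_realizable.
- by apply: fan_representable => P _; apply/realizable_representable.
- exact: (fan_realization_properties fin_gen_generates_submonoids).
- exact: (fan_realization_properties all_generates_submonoids).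
Qed.
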